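(* Let $\{\mathcal{C}_{0,a}\}_{a>0}$ be the family of minimal catenoids in $\mathbb{H}^3$ parametrized by $Y_0(a,s,\theta)$. 1. The index of $\mathcal{C}_{0,a}$ depends on the value of the integral $E_0(a)$: if $E_0(a)\le0$, then $\mathcal{C}_{0,a}$ is stable; if $E_0(a)>0$, then $\mathcal{C}_{0,a}$ has index $1$. 2. When $\mathcal{C}_{0,a}$ has index $1$, there exists $z(a)>0$ such that $\mathcal{D}_{0,z(a)}=Y_0(a,]-z(a),z(a)[,[0,2\pi])$ is a maximal weakly stable domain. 3. When $\mathcal{C}_{0,a}$ has index $1$, there exists $\ell(a)$ with $0<\ell(a)<z(a)$ such that $\mathcal{D}_{0,\ell(a)}=Y_0(a,]-\ell(a),\infty[,[0,2\pi])$ is a maximal weakly stable rotation invariant domain. 4. The catenoids $\mathcal{C}_{0,a}$ do not satisfy Lindelöf's property. 5. There exist two numbers $0<a_2<a_1$ such that for all $a>a_1$ the catenoids $\mathcal{C}_{0,a}$ are stable, and for all $a<a_2$ the catenoids $\mathcal{C}_{0,a}$ have index $1$.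
   Context: $\mathbb{H}^3=\{(x_1,x_2,x_3):x_3>0\}$ with metric $x_3^{-2}(dx_1^2+dx_2^2+dx_3^2)$. For $a>0$, $s\in\mathbb{R}$, let $y_0(a,s)\ge a$ be defined by $\cosh(2y_0(a,s))=\cosh(2a)\cosh(2s)$, let $$J_0(a,t)=\frac{\sinh(2a)}{(\cosh(2a)\cosh(2t)+1)(\cosh(2a)\cosh(2t)-1)^{1/2}},\qquad \Lambda_0(a,s)=\sqrt2\int_0^sJ_0(a,t)\,dt,$$ and let $$Y_0(a,s,\theta)=\Big(e^{\Lambda_0(a,s)}\tanh(y_0(a,s))\,\omega_\theta,\ \frac{e^{\Lambda_0(a,s)}}{\cosh(y_0(a,s))}\Big),\quad \omega_\theta=(\cos\theta,\sin\theta),$$ with $s\in\mathbb{R}$, $\theta\in[0,2\pi]$. The surface $\mathcal{C}_{0,a}$ parametrized by $Y_0(a,\cdot,\cdot)$ is a complete minimal surface of revolution about the vertical geodesic $\{(0,0,x_3)\}$. Put $I_0(a,t)=\partial J_0/\partial a(a,t)$ and $E_0(a)=\int_0^\infty I_0(a,t)\,dt$ (a convergent integral for all $a>0$). Stability: for a minimal orientable hypersurface $M$ with unit normal $N$ and second fundamental form $A$, $J_M=-\Delta-(\mathrm{Ric}(N,N)+|A|^2)$, with $\Delta$ the non-positive Laplacian of the induced metric and $\mathrm{Ric}$ the ambient Ricci curvature. For an open domain $D\subset M$ (possibly $D=M$) consider the quadratic form $f\mapsto\int_M fJ_M(f)\,d\mu_M$ on $C_0^\infty(D)$ (smooth compactly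 supported functions). $D$ is stable if the form is positive for all nonzero $f\in C_0^\infty(D)$, weakly stable if it is $\ge0$ for all such $f$, and has index $k$ if the maximal dimension of subspaces of $C_0^\infty(D)$ on which it is negative definite is $k$. A domain is maximal weakly stable if it is weakly stable and no strictly larger open domain is; it is a maximal weakly stable rotation invariant domain if it is rotation invariant, weakly stable, and no strictly larger rotation invariant open domain is weakly stable. Lindelöf's property for $\mathcal{C}_{0,a}$: the upper half $\{s>0\}$ of $\mathcal{C}_{0,a}$ is a maximal weakly stable domain among domains invariant under rotations about the axis. *)

(* Defs.v *)
From Stdlib Require Import Reals Lra Lia.
From Coquelicot Require Import Coquelicot.
Open Scope R_scope.

(** * Hyperbolic space *)

(* Points of R^3; hyperbolic space is the part with positive third coordinate. *)
Definition pt : Type := (R * R * R)%type.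

Inductive idx : Set := i1 | i2 | i3.

Definition idx_eqb (i j : idx) : bool :=
  match i, j with
  | i1, i1 | i2, i2 | i3, i3 => true
  | _, _ => false
  end.

Definition sum3 (u : idx -> R) : R := u i1 + u i2 + u i3.

Definition coord (p : pt) (i : idx) : R :=
  match i with
  | i1 => fst (fst p)
  | i2 => snd (fst p)
  | i3 => snd p
  end.

Definition upd (p : pt) (i : idx) (t : R) : pt :=
  match i with
  | i1 => (t, snd (fst p), snd p)
  | i2 => (fst (fst p), t, snd p)
  | i3 => (fst p, t)
  end.

Definition partial (i : idx) (F : pt -> R) (p : pt) : R :=
  Derive (fun t => F (upd p i t)) (coord p i).

Definition hyp_metric (i j : idx) (p : pt) : R :=
  if idx_eqb i j then / (coord p i3) ^ 2 else 0.

(* The inverse matrix of [hyp_metric]. *)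
Definition hyp_metric_inv (i j : idx) (p : pt) : R :=
  if idx_eqb i j then (coord p i3) ^ 2 else 0.

Definition hyp_inner (p : pt) (v w : idx -> R) : R :=
  sum3 (fun i => sum3 (fun j => hyp_metric i j p * v i * w j)).

(* Christoffel symbols Gamma^k_{ij} of the Levi-Civita connection. *)
Definition christoffel (k i j : idx) (p : pt) : R :=
  / 2 * sum3 (fun l => hyp_metric_inv k l p *
    (partial i (hyp_metric j l) p + partial j (hyp_metric i l) p
     - partial l (hyp_metric i j) p)).

(* Sign convention: the Ricci curvature of the round sphere is positive. *)
Definition ricci_coef (j k : idx) (p : pt) : R :=
  sum3 (fun i =>
    partial i (christoffel i j k) p - partial j (christoffel i i k) p
    + sum3 (fun m => christoffel i i m p * christoffel m j k p
                     - christoffel i j m p * christoffel m i k p)).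

Definition ricci (p : pt) (v w : idx -> R) : R :=
  sum3 (fun j => sum3 (fun k => ricci_coef j k p * v j * w k)).

Definition rotation (phi : R) (p : pt) : pt :=
  (cos phi * coord p i1 - sin phi * coord p i2,
   sin phi * coord p i1 + cos phi * coord p i2,
   coord p i3).

(** * Surfaces *)

(* A surface is given by a map X : (s, theta) |-> X s theta from R^2 to hyperbolic
   space which is an immersion, 2 pi-periodic in theta, and one-to-one on
   R x (R / 2 pi Z), so that it embeds R x (R / 2 pi Z) in hyperbolic space.
   Topology, smooth structure and metric of the surface are read through X. *)
Definition surf : Type := R -> R -> pt.

Inductive par : Set := Ps | Pth.

Definition sum2 (u : par -> R) : R := u Ps + u Pth.

Definition par_deriv (al : par) (F : R -> R -> R) (s th : R) : R :=
  match al with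
  | Ps => Derive (fun u => F u th) s
  | Pth => Derive (fun v => F s v) th
  end.

Definition tangent (X : surf) (al : par) (s th : R) (i : idx) : R :=
  par_deriv al (fun u v => coord (X u v) i) s th.

Definition first_form (X : surf) (al be : par) (s th : R) : R :=
  hyp_inner (X s th) (tangent X al s th) (tangent X be s th).

Definition first_form_det (X : surf) (s th : R) : R :=
  first_form X Ps Ps s th * first_form X Pth Pth s th
  - first_form X Ps Pth s th * first_form X Pth Ps s th.

Definition first_form_inv (X : surf) (al be : par) (s th : R) : R :=
  match al, be with
  | Ps, Ps => first_form X Pth Pth s th
  | Pth, Pth => first_form X Ps Ps s th
  | Ps, Pth => - first_form X Ps Pth s th
  | Pth, Ps => - first_form X Pth Ps s th
  end / first_form_det X s th.

Definition cross (v w : idx -> R) (i : idx) : R :=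
  match i with
  | i1 => v i2 * w i3 - v i3 * w i2
  | i2 => v i3 * w i1 - v i1 * w i3
  | i3 => v i1 * w i2 - v i2 * w i1
  end.

(* The Euclidean cross product of the tangent vectors, seen as a covector, vanishes on
   them; raising its index with the hyperbolic metric gives a normal vector. *)
Definition normal (X : surf) (s th : R) (i : idx) : R :=
  sum3 (fun j => hyp_metric_inv i j (X s th) *
                 cross (tangent X Ps s th) (tangent X Pth s th) j).

Definition unit_normal (X : surf) (s th : R) (i : idx) : R :=
  normal X s th i / sqrt (hyp_inner (X s th) (normal X s th) (normal X s th)).

(* k-th component of nabla_{d_al X} (d_be X), nabla the Levi-Civita connection of
   hyperbolic space. *)
Definition cov_deriv (X : surf) (al be : par) (s th : R) (k : idx) : R :=
  par_deriv al (fun u v => tangent X be u v k) s th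
  + sum3 (fun i => sum3 (fun j =>
      christoffel k i j (X s th) * tangent X al s th i * tangent X be s th j)).

Definition second_form (X : surf) (al be : par) (s th : R) : R :=
  hyp_inner (X s th) (cov_deriv X al be s th) (unit_normal X s th).

Definition second_form_norm2 (X : surf) (s th : R) : R :=
  sum2 (fun al => sum2 (fun be => sum2 (fun ga => sum2 (fun de =>
    first_form_inv X al ga s th * first_form_inv X be de s th
    * second_form X al be s th * second_form X ga de s th)))).

(* Laplace-Beltrami operator (non-positive) of the induced metric, acting on functions
   on the surface composed with X. *)
Definition laplacian (X : surf) (F : R -> R -> R) (s th : R) : R :=
  / sqrt (first_form_det X s th) *
  sum2 (fun al => par_deriv al (fun u v =>
    sqrt (first_form_det X u v) *
    sum2 (fun be => first_form_inv X al be u v * par_deriv be F u v)) s th).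

Definition jacobi_op (X : surf) (F : R -> R -> R) (s th : R) : R :=
  - laplacian X F s th
  - (ricci (X s th) (unit_normal X s th) (unit_normal X s th)
     + second_form_norm2 X s th) * F s th.

(** * Test functions, stability, index *)

(* X (I x [0, 2 pi]) *)
Definition band (X : surf) (I : R -> Prop) (p : pt) : Prop :=
  exists s th, I s /\ 0 <= th <= 2 * PI /\ p = X s th.

Definition whole (X : surf) : pt -> Prop := band X (fun _ => True).

Definition open_in (X : surf) (D : pt -> Prop) : Prop :=
  (forall p, D p -> whole X p) /\
  open (fun q : R * R => D (X (fst q) (snd q))).

(* Domains are connected: with disconnected sets allowed, no proper open subset of a
   surface would be a maximal weakly stable one unless it were dense. *)
Definition open_domain (X : surf) (D : pt -> Prop) : Prop :=
  open_in X D /\ (exists p, D p) /\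
  (forall U V : pt -> Prop, open_in X U -> open_in X V ->
     (forall p, D p <-> U p \/ V p) -> (forall p, ~ (U p /\ V p)) ->
     (exists p, U p) -> (exists p, V p) -> False).

Definition bounded_set (K : R * R -> Prop) : Prop :=
  exists B, forall q, K q -> Rabs (fst q) <= B /\ Rabs (snd q) <= B.

(* C_0^oo(D): smooth functions on the surface vanishing outside a compact subset X(K)
   of D.  They are extended by 0 outside the surface, so that equality of functions on
   the surface is equality of functions. *)
Definition test_function (X : surf) (D : pt -> Prop) (f : pt -> R) : Prop :=
  (forall n s th, ex_diff_n (fun u v => f (X u v)) n s th) /\
  exists K : R * R -> Prop,
    closed K /\ bounded_set K /\
    (forall q, K q -> D (X (fst q) (snd q))) /\
    (forall p, (forall q, K q -> p <> X (fst q) (snd q)) -> f p = 0).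

(* Integral over the surface of f J(f) for the Riemannian measure, which is
   sqrt(det) ds dtheta on the fundamental domain R x [0, 2 pi]. *)
Definition jacobi_form (X : surf) (f : pt -> R) : R :=
  RInt_gen (fun s => RInt (fun th =>
      f (X s th) * jacobi_op X (fun u v => f (X u v)) s th
      * sqrt (first_form_det X s th)) 0 (2 * PI))
    (Rbar_locally m_infty) (Rbar_locally p_infty).

Definition stable (X : surf) (D : pt -> Prop) : Prop :=
  forall f, test_function X D f -> (exists p, f p <> 0) -> 0 < jacobi_form X f.

Definition weakly_stable (X : surf) (D : pt -> Prop) : Prop :=
  forall f, test_function X D f -> 0 <= jacobi_form X f.

Fixpoint lin_comb (k : nat) (c : nat -> R) (e : nat -> pt -> R) (p : pt) : R :=
  match k with
  | O => 0
  | S k' => lin_comb k' c e p + c k' * e k' p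
  end.

Definition lin_indep (k : nat) (e : nat -> pt -> R) : Prop :=
  forall c, (forall p, lin_comb k c e p = 0) -> forall i, (i < k)%nat -> c i = 0.

(* e 0, ..., e (k-1) is a basis of V *)
Definition is_basis (V : (pt -> R) -> Prop) (k : nat) (e : nat -> pt -> R) : Prop :=
  lin_indep k e /\
  forall f, V f <-> exists c, forall p, f p = lin_comb k c e p.

(* V is a k-dimensional subspace of C_0^oo(D) on which the form is negative definite *)
Definition neg_def_subspace (X : surf) (D : pt -> Prop) (k : nat)
    (V : (pt -> R) -> Prop) : Prop :=
  (exists e, is_basis V k e) /\
  (forall f, V f -> test_function X D f) /\
  (forall f, V f -> (exists p, f p <> 0) -> jacobi_form X f < 0).

Definition has_index (X : surf) (D : pt -> Prop) (k : nat) : Prop :=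
  (exists V, neg_def_subspace X D k V) /\
  (forall m V, neg_def_subspace X D m V -> (m <= k)%nat).

Definition strictly_larger (D' D : pt -> Prop) : Prop :=
  (forall p, D p -> D' p) /\ exists p, D' p /\ ~ D p.

Definition rotation_invariant (D : pt -> Prop) : Prop :=
  forall phi p, D p -> D (rotation phi p).

Definition max_weakly_stable (X : surf) (D : pt -> Prop) : Prop :=
  open_domain X D /\ weakly_stable X D /\
  forall D', open_domain X D' -> strictly_larger D' D -> ~ weakly_stable X D'.

Definition max_weakly_stable_rot (X : surf) (D : pt -> Prop) : Prop :=
  open_domain X D /\ rotation_invariant D /\ weakly_stable X D /\
  forall D', open_domain X D' -> rotation_invariant D' -> strictly_larger D' D ->
    ~ weakly_stable X D'.

(** * Catenoids *)

Definition arcosh (x : R) : R := ln (x + sqrt (x ^ 2 - 1)).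

Definition y0 (a s : R) : R := arcosh (cosh (2 * a) * cosh (2 * s)) / 2.

Definition J0 (a t : R) : R :=
  sinh (2 * a) /
  ((cosh (2 * a) * cosh (2 * t) + 1) * sqrt (cosh (2 * a) * cosh (2 * t) - 1)).

Definition Lambda0 (a s : R) : R := sqrt 2 * RInt (J0 a) 0 s.

Definition Y0 (a : R) : surf := fun s th =>
  (exp (Lambda0 a s) * tanh (y0 a s) * cos th,
   exp (Lambda0 a s) * tanh (y0 a s) * sin th,
   exp (Lambda0 a s) / cosh (y0 a s)).

Definition I0 (a t : R) : R := Derive (fun b => J0 b t) a.

Definition E0 (a : R) : R := RInt_gen (I0 a) (at_point 0) (Rbar_locally p_infty).

Definition catenoid_stable (a : R) : Prop := stable (Y0 a) (whole (Y0 a)).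

Definition catenoid_has_index (a : R) (k : nat) : Prop :=
  has_index (Y0 a) (whole (Y0 a)) k.

Definition lindelof_property (a : R) : Prop :=
  max_weakly_stable_rot (Y0 a) (band (Y0 a) (fun s => 0 < s)).

(* [y0 a s] is the y >= a with cosh (2 y) = cosh (2 a) cosh (2 s). *)

Lemma cosh_ge_1 (x : R) : 1 <= cosh x.
Proof.
  unfold cosh.
  assert (H : exp x * exp (- x) = 1)
    by (rewrite <- exp_plus, Rplus_opp_r; apply exp_0).
  pose proof (exp_pos x); pose proof (exp_pos (- x)).
  pose proof (Rle_0_sqr (exp x - exp (- x))); unfold Rsqr in *; nra.
Qed.

Lemma y0_spec (a s : R) : 0 < a ->
  a <= y0 a s /\ cosh (2 * y0 a s) = cosh (2 * a) * cosh (2 * s).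
Proof.
  intros Ha; unfold y0, arcosh.
  pose proof (cosh_ge_1 (2 * a)) as H1; pose proof (cosh_ge_1 (2 * s)) as H2.
  set (c := cosh (2 * a) * cosh (2 * s)).
  assert (Hc : cosh (2 * a) <= c) by (unfold c; nra).
  assert (Hs : 0 <= sinh (2 * a)).
  { unfold sinh.
    assert (exp (- (2 * a)) < exp (2 * a)) by (apply exp_increasing; lra). lra. }
  assert (Hcs : cosh (2 * a) ^ 2 - 1 = (sinh (2 * a)) ^ 2).
  { assert (H : exp (2 * a) * exp (- (2 * a)) = 1)
      by (rewrite <- exp_plus, Rplus_opp_r; apply exp_0).
    unfold cosh, sinh; nra. }
  set (r := sqrt (c ^ 2 - 1)).
  assert (Hr : sinh (2 * a) <= r).
  { unfold r; rewrite <- (sqrt_pow2 (sinh (2 * a)) Hs), <- Hcs.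
    apply sqrt_le_1_alt; nra. }
  assert (Hrr : r * r = c ^ 2 - 1) by (apply sqrt_sqrt; nra).
  assert (Hpos : 0 < c + r) by lra.
  replace (2 * (ln (c + r) / 2)) with (ln (c + r)) by field.
  split.
  - assert (2 * a <= ln (c + r)); [|lra].
    rewrite <- (ln_exp (2 * a)).
    apply Rcomplements.ln_le; [apply exp_pos|].
    replace (exp (2 * a)) with (cosh (2 * a) + sinh (2 * a))
      by (unfold cosh, sinh; field).
    lra.
  - unfold cosh at 1; rewrite exp_Ropp, exp_ln by assumption.
    replace (/ (c + r)) with (c - r); [field|].
    apply Rmult_eq_reg_r with (c + r); [|lra].
    rewrite Rinv_l by lra. nra.
Qed.

(* Main.v *)
Require Import Defs.
From Stdlib Require Import Reals ZArith Lra Lia.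
From Stdlib Require Import FunctionalExtensionality ClassicalEpsilon.
From Coquelicot Require Import Coquelicot.
Open Scope R_scope.

(** Let [g s = sinh (y0 a s)].  In the parameters (s, th) the metric of the catenoid is
    ds^2 + g^2 dth^2, its principal curvatures are opposite with absolute value
    sinh (2 a) / (2 g^2), and integration by parts turns the Jacobi form of a test function
    [f] into the integral of the energy density

      g f_s^2 + f_th^2 / g + g q f^2,   where   q = 2 - sinh (2 a)^2 / (2 g^4)

    ([jacobi_form_energy]).  Everything is then read off from the rotation invariant Jacobi
    fields, the solutions of the linear equation (g u')' = g q u.  Two of them come from the
    geometry: [vfield], the normal component of the translations along the axis, is odd and
    positive for s > 0; [efield], the normal component of the variation of [a], is even and
    negative at 0.  Because of their constant Wronskian the quotient e / v increases on
    s > 0, and its limit at infinity is sqrt 2 * E0 a ([ratio_lim]).  So the sign of [E0 a]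
    decides whether [efield] changes sign.

    - If [E0 a <= 0] then [- efield] is positive everywhere.  A positive Jacobi field [u]
      makes the energy of [f] a sum of squares up to a derivative, through the Riccati
      equation of T = g u' / u, and the catenoid is stable ([energy_pos]).

    - If [E0 a > 0] then [efield] has a zero [z > 0] and is negative between - z and z, while
      the combination u = sqrt 2 * E0 a * v - e, which decays at infinity, vanishes at some
      - l with 0 < l < z and is positive beyond ([efield_zero], [ufield_zero]).  Both bands, between
      - z and z and beyond - l, are therefore weakly stable.  They are maximal: a larger
      domain contains a point of a boundary circle, where the Jacobi field [u] of the band
      vanishes and u' does not.  Cutting [u] off near the ends of the band costs arbitrarily
      little energy, and a perturbation near that point then makes the energy negative, since
      it contributes to first order ([not_weakly_stable_beyond]).  In particular the whole
      catenoid is not weakly stable, and its index is at least 1.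

    For the upper bound of the index, a test function with mean value zero on the waist circle
    has nonnegative energy ([jacobi_form_ge_0_waist]), which is one linear condition.  On each
    half, its mean value on the circles is compared with the field [u], positive on s >= 0.
    The other Fourier modes are compared with the supersolution 1 / (sinh y0 cosh y0),
    thanks to the term f_th^2 / g and to Wirtinger's inequality ([energy_lower_bound]).

    The upper half of the catenoid is never maximal: it is strictly contained in the whole
    surface, weakly stable if [E0 a <= 0], and in the band beyond - l otherwise.  Finally the
    sign of [E0 a] is obtained from the explicit formula of the integrand: it is nonpositive if
    cosh (2 a) >= 3, whereas for small [a] it is negative only on an interval whose length
    tends to 0, bounded below there, and bounded away from 0 on [1, 2]. *)

(** * Derivatives and continuity *)

Create HintDb pos.
Create HintDb deriv.
Create HintDb smooth.

Ltac pos_tac :=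
  lazymatch goal with
  | |- _ > _ => apply Rlt_gt; pos_tac
  | |- _ <> 0 => apply Rgt_not_eq; pos_tac
  | |- _ /\ _ => split; pos_tac
  | |- 0 < _ * _ => apply Rmult_lt_0_compat; pos_tac
  | |- 0 < _ / _ => apply Rdiv_lt_0_compat; pos_tac
  | |- 0 < / _ => apply Rinv_0_lt_compat; pos_tac
  | |- 0 < _ ^ _ => first [assumption | apply pow_lt; pos_tac]
  | |- 0 < sqrt _ => apply sqrt_lt_R0; pos_tac
  | |- 0 < _ + _ => first
      [solve [auto with pos] | lra | solve [apply Rplus_lt_0_compat; pos_tac] | nra]
  | |- _ => first [solve [auto with pos] | lra | nra]
  end.

Lemma is_derive_cst (c x : R) : is_derive (fun _ : R => c) x 0.
Proof. exact (is_derive_const c x). Qed.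

Lemma is_derive_idR (x : R) : is_derive (fun y : R => y) x 1.
Proof. exact (is_derive_id x). Qed.

Lemma is_derive_plusR (f g : R -> R) (x l m : R) : is_derive f x l -> is_derive g x m ->
  is_derive (fun y => f y + g y) x (l + m).
Proof. apply (is_derive_plus f g). Qed.

Lemma is_derive_minusR (f g : R -> R) (x l m : R) : is_derive f x l -> is_derive g x m ->
  is_derive (fun y => f y - g y) x (l - m).
Proof. apply (is_derive_minus f g). Qed.

Lemma is_derive_oppR (f : R -> R) (x l : R) : is_derive f x l ->
  is_derive (fun y => - f y) x (- l).
Proof. apply (is_derive_opp f). Qed.

Lemma is_derive_compR (f k : R -> R) (x l m : R) : is_derive f (k x) l ->
  is_derive k x m -> is_derive (fun y => f (k y)) x (m * l).
Proof. apply (is_derive_comp f k). Qed.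

#[export] Hint Resolve is_derive_exp is_derive_sin is_derive_cos : deriv.

(** A second-order pattern also matches open terms, whence a test on two values. *)
Ltac is_const f :=
  let u := eval cbv beta in (f 0) in
  let v := eval cbv beta in (f 1) in
  constr_eq u v.

(** Differentiates along the structure of the function, with hypotheses and hints at the
    leaves.  The derivative is left as an existential variable: the expected expression is
    compared with the outcome afterwards, by [field]. *)
Ltac der :=
  lazymatch goal with
  | |- is_derive (fun y => @?f y + @?g y) ?x _ =>
      apply (is_derive_plusR f g x); der
  | |- is_derive (fun y => @?f y - @?g y) ?x _ =>
      apply (is_derive_minusR f g x); der
  | |- is_derive (fun y => @?f y * @?g y) ?x _ =>
      apply (Derive.is_derive_mult f g x); der
  | |- is_derive (fun y => @?f y / @?g y) ?x _ =>
      apply (is_derive_div f g x); [der|der|cbv beta; try pos_tac]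
  | |- is_derive (fun y => / @?g y) ?x _ =>
      apply (is_derive_inv g x); [der|cbv beta; try pos_tac]
  | |- is_derive (fun y => - @?f y) ?x _ => apply (is_derive_oppR f x); der
  | |- is_derive (fun y => @?f y ^ ?n) ?x _ => apply (is_derive_pow f n x); der
  | |- is_derive (fun y => sqrt (@?f y)) ?x _ =>
      apply (is_derive_sqrt f x); [der|cbv beta; try pos_tac]
  | |- is_derive (fun y => y) ?x _ => apply (is_derive_idR x)
  | |- is_derive (fun y => ?f y) ?x _ => first [eassumption | solve [eauto with deriv]]
  | |- is_derive (fun y => ?f (@?k y)) ?x _ =>
      tryif is_const (fun y : R => f (k y)) then apply is_derive_cst
      else (apply (is_derive_compR f k x); [solve [eauto with deriv]|der])
  | |- is_derive ?f _ _ =>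
      tryif is_const f then apply is_derive_cst
      else first [eassumption | solve [eauto with deriv]]
  end.

Lemma is_derive_continuous (f : R -> R) (x l : R) : is_derive f x l -> continuous f x.
Proof. intro H; apply (ex_derive_continuous f); exists l; exact H. Qed.

(** * Smooth functions of one variable *)

Fixpoint Cn (n : nat) (f : R -> R) : Prop :=
  match n with
  | O => forall x, continuous f x
  | S m => (forall x, ex_derive f x) /\ Cn m (Derive f)
  end.

Definition smooth (f : R -> R) : Prop := forall n, Cn n f.

Lemma Cn_of_derive (n : nat) (f f' : R -> R) :
  (forall x, is_derive f x (f' x)) -> Cn n f' -> Cn (S n) f.
Proof.
  intros H H'; split.
  - intro x; exists (f' x); apply H.
  - replace (Derive f) with f'; [assumption|].
    apply functional_extensionality; intro x; symmetry; apply is_derive_unique, H.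
Qed.

Lemma Cn_pred (n : nat) (f : R -> R) : Cn (S n) f -> Cn n f.
Proof.
  revert f; induction n as [|n IH]; intros f [H1 H2].
  - intro x; apply (ex_derive_continuous f), H1.
  - split; [assumption|]; apply IH; assumption.
Qed.

Lemma smooth_Derive (f : R -> R) : smooth f -> smooth (Derive f).
Proof. intros H n; apply (H (S n)). Qed.

Lemma smooth_is_derive (f : R -> R) (x : R) : smooth f -> is_derive f x (Derive f x).
Proof. intro H; apply Derive_correct, (H 1%nat). Qed.

Lemma smooth_ex_derive (f : R -> R) (x : R) : smooth f -> ex_derive f x.
Proof. intro H; apply (H 1%nat). Qed.

Lemma smooth_continuous (f : R -> R) (x : R) : smooth f -> continuous f x.
Proof. intro H; apply (H 0%nat). Qed.

Lemma smooth_of_derive (f f' : R -> R) :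
  (forall x, is_derive f x (f' x)) -> smooth f' -> smooth f.
Proof.
  intros H H' n; apply Cn_pred, Cn_of_derive with f'; [assumption|apply H'].
Qed.

Lemma Cn_const (n : nat) (c : R) : Cn n (fun _ => c).
Proof.
  revert c; induction n as [|n IH]; intro c.
  - intro x; apply continuous_const.
  - apply Cn_of_derive with (fun _ => 0); [|apply IH].
    intro x; apply is_derive_cst.
Qed.

Lemma smooth_const (c : R) : smooth (fun _ => c).
Proof. intro n; apply Cn_const. Qed.

Lemma smooth_id : smooth (fun x => x).
Proof.
  apply smooth_of_derive with (fun _ => 1); [|apply smooth_const].
  intro x; apply is_derive_idR.
Qed.

Lemma Cn_plus (n : nat) (f g : R -> R) : Cn n f -> Cn n g -> Cn n (fun x => f x + g x).
Proof.
  revert f g; induction n as [|n IH]; intros f g Hf Hg.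
  - intro x; apply (continuous_plus f g); [apply Hf|apply Hg].
  - destruct Hf as [F1 F2], Hg as [G1 G2].
    apply Cn_of_derive with (fun x => Derive f x + Derive g x); [|apply IH; assumption].
    intro x; apply (is_derive_plus f g); apply Derive_correct; auto.
Qed.

Lemma Cn_mult (n : nat) (f g : R -> R) : Cn n f -> Cn n g -> Cn n (fun x => f x * g x).
Proof.
  revert f g; induction n as [|n IH]; intros f g Hf Hg.
  - intro x; apply (continuous_mult f g); [apply Hf|apply Hg].
  - pose proof (Cn_pred _ _ Hf); pose proof (Cn_pred _ _ Hg).
    destruct Hf as [F1 F2], Hg as [G1 G2].
    apply Cn_of_derive with (fun x => Derive f x * g x + f x * Derive g x).
    + intro x; apply Derive.is_derive_mult; apply Derive_correct; auto.
    + apply Cn_plus; apply IH; assumption.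
Qed.

Lemma Cn_comp (n : nat) (f k : R -> R) :
  smooth f -> Cn n k -> Cn n (fun x => f (k x)).
Proof.
  revert f k; induction n as [|n IH]; intros f k Hf Hk.
  - intro x; apply (continuous_comp k f); [apply Hk|apply smooth_continuous, Hf].
  - pose proof (Cn_pred _ _ Hk) as Hk0; destruct Hk as [K1 K2].
    apply Cn_of_derive with (fun x => Derive k x * Derive f (k x)).
    + intro x; apply (is_derive_comp f k);
        [apply smooth_is_derive, Hf|apply Derive_correct, K1].
    + apply Cn_mult; [assumption|]; apply IH; [apply smooth_Derive|]; assumption.
Qed.

Lemma smooth_plus (f g : R -> R) : smooth f -> smooth g -> smooth (fun x => f x + g x).
Proof. intros Hf Hg n; apply Cn_plus; auto. Qed.

Lemma smooth_mult (f g : R -> R) : smooth f -> smooth g -> smooth (fun x => f x * g x).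
Proof. intros Hf Hg n; apply Cn_mult; auto. Qed.

Lemma smooth_opp (f : R -> R) : smooth f -> smooth (fun x => - f x).
Proof.
  intro Hf; replace (fun x => - f x) with (fun x => (-1) * f x).
  - apply smooth_mult; [apply smooth_const|assumption].
  - apply functional_extensionality; intro; ring.
Qed.

Lemma smooth_minus (f g : R -> R) : smooth f -> smooth g -> smooth (fun x => f x - g x).
Proof. intros Hf Hg; apply smooth_plus; [|apply smooth_opp]; assumption. Qed.

Lemma smooth_comp (f k : R -> R) : smooth f -> smooth k -> smooth (fun x => f (k x)).
Proof. intros Hf Hk n; apply Cn_comp; auto. Qed.

Lemma smooth_exp : smooth exp.
Proof.
  intro n; induction n as [|n IH].
  - intro x; apply continuous_exp.
  - apply Cn_of_derive with exp; [|assumption]; intro x; apply is_derive_exp.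
Qed.

(** The derivative of [/ f] is a polynomial in [Derive f] and [/ f] itself, so each
    order of differentiability follows from the previous one. *)
Lemma smooth_inv (f : R -> R) :
  smooth f -> (forall x, f x <> 0) -> smooth (fun x => / f x).
Proof.
  intros Hf Hn n.
  assert (Hd : forall x, is_derive (fun x => / f x) x
                 (((-1) * Derive f x) * (/ f x * / f x))).
  { intro x; replace (((-1) * Derive f x) * (/ f x * / f x))
      with (- Derive f x / f x ^ 2) by (field; apply Hn).
    apply is_derive_inv; [apply smooth_is_derive, Hf|apply Hn]. }
  induction n as [|n IH].
  - intro x; apply (ex_derive_continuous (fun x => / f x)); eexists; apply Hd.
  - eapply Cn_of_derive; [apply Hd|].
    repeat apply Cn_mult; try assumption; [apply Cn_const|apply (smooth_Derive f Hf)].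
Qed.

Lemma smooth_sqrt (f : R -> R) :
  smooth f -> (forall x, 0 < f x) -> smooth (fun x => sqrt (f x)).
Proof.
  intros Hf Hp n.
  assert (Hd : forall x, is_derive (fun x => sqrt (f x)) x
                 ((/ 2 * Derive f x) * (sqrt (f x) * / f x))).
  { intro x; replace ((/ 2 * Derive f x) * (sqrt (f x) * / f x))
      with (Derive f x / (2 * sqrt (f x))).
    - apply is_derive_sqrt; [apply smooth_is_derive, Hf|apply Hp].
    - pose proof (sqrt_lt_R0 _ (Hp x)).
      pose proof (sqrt_sqrt (f x) (Rlt_le _ _ (Hp x))) as Hr.
      set (r := sqrt (f x)) in *; rewrite <- Hr; field; lra. }
  induction n as [|n IH].
  - intro x; apply (ex_derive_continuous (fun x => sqrt (f x))); eexists; apply Hd.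
  - eapply Cn_of_derive; [apply Hd|].
    repeat apply Cn_mult; try assumption.
    + apply Cn_const.
    + apply (smooth_Derive f Hf).
    + apply smooth_inv; [assumption|]; intro x; apply Rgt_not_eq, Hp.
Qed.

Lemma smooth_div (f g : R -> R) : smooth f -> smooth g -> (forall x, g x <> 0) ->
  smooth (fun x => f x / g x).
Proof. intros Hf Hg H; apply smooth_mult; [|apply smooth_inv]; assumption. Qed.

Lemma smooth_pow (f : R -> R) (n : nat) : smooth f -> smooth (fun x => f x ^ n).
Proof.
  intro Hf; induction n as [|n IH];
    [exact (smooth_const 1)|apply (smooth_mult f (fun x => f x ^ n)); assumption].
Qed.

#[export] Hint Resolve smooth_exp smooth_Derive : smooth.

Ltac smooth_tac :=
  lazymatch goal with
  | |- smooth (fun y => @?f y + @?g y) => apply (smooth_plus f g); smooth_tac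
  | |- smooth (fun y => @?f y - @?g y) => apply (smooth_minus f g); smooth_tac
  | |- smooth (fun y => @?f y * @?g y) => apply (smooth_mult f g); smooth_tac
  | |- smooth (fun y => @?f y / @?g y) =>
      apply (smooth_div f g); [smooth_tac|smooth_tac|intro; cbv beta; try pos_tac]
  | |- smooth (fun y => / @?g y) =>
      apply (smooth_inv g); [smooth_tac|intro; cbv beta; try pos_tac]
  | |- smooth (fun y => - @?f y) => apply (smooth_opp f); smooth_tac
  | |- smooth (fun y => @?f y ^ ?n) => apply (smooth_pow f n); smooth_tac
  | |- smooth (fun y => sqrt (@?f y)) =>
      apply (smooth_sqrt f); [smooth_tac|intro; cbv beta; try pos_tac]
  | |- smooth (fun y => y) => apply smooth_id
  | |- smooth (fun y => ?f y) => solve [auto with smooth]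
  | |- smooth (fun y => ?f (@?k y)) =>
      tryif is_const (fun y : R => f (k y)) then apply smooth_const
      else first [ assumption
                 | apply (smooth_comp f k); [solve [auto with smooth]|smooth_tac] ]
  | |- smooth ?f =>
      tryif is_const f then apply smooth_const else solve [auto with smooth]
  end.

Lemma smooth_cosh : smooth cosh.
Proof. unfold cosh; smooth_tac. Qed.

Lemma smooth_sinh : smooth sinh.
Proof. unfold sinh; smooth_tac. Qed.

Lemma Cn_sin_cos (n : nat) : Cn n sin /\ Cn n cos.
Proof.
  induction n as [|n [IHs IHc]].
  - split; intro x; [apply continuous_sin|apply continuous_cos].
  - split.
    + apply Cn_of_derive with cos; [intro; apply is_derive_sin|assumption].
    + apply Cn_of_derive with (fun x => (-1) * sin x).
      * intro x; replace ((-1) * sin x) with (- sin x) by ring; apply is_derive_cos.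
      * apply Cn_mult; [apply Cn_const|assumption].
Qed.

Lemma smooth_cos : smooth cos.
Proof. intro n; apply Cn_sin_cos. Qed.

Lemma cont_inv (f : R -> R) (x : R) : continuous f x -> f x <> 0 ->
  continuous (fun y => / f y) x.
Proof. intros H H0; apply (continuous_Rinv_comp f x H H0). Qed.

Lemma cont_pow (f : R -> R) (n : nat) (x : R) : continuous f x ->
  continuous (fun y => f y ^ n) x.
Proof.
  intro H; induction n as [|n IH]; [exact (continuous_const 1 x)|].
  apply (continuous_mult f (fun y => f y ^ n)); assumption.
Qed.

Ltac cont_leaf f x :=
  match goal with
  | H : continuous f x |- _ => exact H
  | H : forall z, continuous f z |- _ => apply H
  | H : smooth f |- _ => exact (smooth_continuous f x H)
  | _ => apply smooth_continuous; solve [auto with smooth]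
  end.

Ltac cont_tac :=
  lazymatch goal with
  | |- continuous (fun y => @?f y + @?g y) _ => apply (continuous_plus f g); cont_tac
  | |- continuous (fun y => @?f y - @?g y) _ => apply (continuous_minus f g); cont_tac
  | |- continuous (fun y => @?f y * @?g y) _ => apply (continuous_mult f g); cont_tac
  | |- continuous (fun y => @?f y / @?g y) _ =>
      apply (continuous_mult f (fun y => / g y)); cont_tac
  | |- continuous (fun y => / @?g y) _ => apply (cont_inv g); [cont_tac|cbv beta; pos_tac]
  | |- continuous (fun y => - @?f y) _ => apply (continuous_opp f); cont_tac
  | |- continuous (fun y => @?f y ^ ?n) _ => apply (cont_pow f n); cont_tac
  | |- continuous (fun y => y) _ => apply continuous_id
  | |- continuous (fun y => ?f y) ?x => cont_leaf f x
  | |- continuous ?f ?x =>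
      tryif is_const f then apply continuous_const else first [cont_leaf f x | assumption | idtac]
  end.

(** * Bump functions *)

(** The functions x^(-k) exp(-1/x), extended by 0 to x <= 0: the family is closed under
    differentiation up to linear combinations, which makes each member smooth. *)
Definition flat (k : nat) (x : R) : R :=
  if Rlt_dec 0 x then exp (- / x) * (/ x) ^ k else 0.

Lemma flat_pos (k : nat) (x : R) : 0 < x -> 0 < flat k x.
Proof.
  intro Hx; unfold flat; destruct (Rlt_dec 0 x); [|lra].
  apply Rmult_lt_0_compat; [apply exp_pos|].
  apply pow_lt, Rinv_0_lt_compat; assumption.
Qed.

Lemma flat_nonpos (k : nat) (x : R) : x <= 0 -> flat k x = 0.
Proof. intro Hx; unfold flat; destruct (Rlt_dec 0 x); [lra|reflexivity]. Qed.

Lemma flat_ge_0 (k : nat) (x : R) : 0 <= flat k x.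
Proof.
  destruct (Rlt_le_dec 0 x); [apply Rlt_le, flat_pos|rewrite flat_nonpos]; lra.
Qed.

Lemma pow_le_exp (n : nat) (y : R) : 0 <= y -> y ^ n <= INR (fact n) * exp y.
Proof.
  intro Hy.
  assert (Hf : 0 < INR (fact n)) by apply INR_fact_lt_0.
  assert (H : y ^ n / INR (fact n) <= exp y).
  { eapply Rle_trans; [|apply exp_ge_taylor with (n := n); assumption].
    destruct n as [|n]; [simpl; lra|].
    rewrite tech5.
    assert (0 <= sum_f_R0 (fun k => y ^ k / INR (fact k)) n); [|lra].
    apply cond_pos_sum; intro k; apply Rmult_le_pos; [apply pow_le; assumption|].
    apply Rlt_le, Rinv_0_lt_compat, INR_fact_lt_0. }
  apply Rmult_le_compat_l with (r := INR (fact n)) in H; [|lra].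
  replace (INR (fact n) * (y ^ n / INR (fact n))) with (y ^ n) in H by (field; lra).
  assumption.
Qed.

(** This quadratic bound gives the derivative 0 at the origin. *)
Lemma flat_le_sqr (k : nat) (x : R) : flat k x <= INR (fact (k + 2)) * x ^ 2.
Proof.
  destruct (Rlt_le_dec 0 x) as [Hx|Hx].
  - unfold flat; destruct (Rlt_dec 0 x); [|lra].
    assert (Hy : 0 < / x) by (apply Rinv_0_lt_compat; assumption).
    pose proof (pow_le_exp (k + 2) (/ x) (Rlt_le _ _ Hy)) as H.
    rewrite exp_Ropp.
    pose proof (exp_pos (/ x)) as He.
    set (F := INR (fact (k + 2))) in *.
    replace (/ exp (/ x) * (/ x) ^ k) with (((/ x) ^ (k + 2)) * / exp (/ x) * x ^ 2)
      by (rewrite pow_add; field; lra).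
    apply Rmult_le_compat_r; [nra|].
    apply Rmult_le_reg_r with (exp (/ x)); [assumption|].
    rewrite Rmult_assoc, Rinv_l by lra; lra.
  - rewrite flat_nonpos by assumption.
    apply Rmult_le_pos; [apply Rlt_le, INR_fact_lt_0|nra].
Qed.

Lemma is_derive_flat (k : nat) (x : R) :
  is_derive (flat k) x (flat (k + 2) x + (- INR k) * flat (k + 1) x).
Proof.
  destruct (Rtotal_order x 0) as [Hx|[Hx|Hx]].
  - rewrite 2!flat_nonpos by lra.
    replace (0 + (- INR k) * 0) with 0 by ring.
    apply is_derive_ext_loc with (fun _ => 0); [|apply is_derive_cst].
    exists (mkposreal (- x) ltac:(lra)); intros y Hy.
    symmetry; apply flat_nonpos.
    apply Rabs_lt_between' in Hy; simpl in Hy; lra.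
  - subst x; rewrite 2!flat_nonpos by lra.
    replace (0 + (- INR k) * 0) with 0 by ring.
    apply is_derive_Reals; intros eps Heps.
    set (F := INR (fact (k + 2))).
    assert (HF : 0 < F) by apply INR_fact_lt_0.
    exists (mkposreal (eps / F) (Rdiv_lt_0_compat _ _ Heps HF)).
    intros h Hh Hlt; simpl in Hlt.
    rewrite Rplus_0_l, (flat_nonpos k 0), !Rminus_0_r by lra.
    unfold Rdiv; rewrite Rabs_mult, Rabs_inv.
    assert (Hp : 0 < Rabs h) by (apply Rabs_pos_lt; assumption).
    rewrite (Rabs_pos_eq (flat k h)) by apply flat_ge_0.
    apply Rle_lt_trans with (F * Rabs h).
    + apply Rmult_le_reg_r with (Rabs h); [assumption|].
      rewrite Rmult_assoc, Rinv_l, Rmult_1_r by lra.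
      eapply Rle_trans; [apply flat_le_sqr|].
      fold F; rewrite <- (pow2_abs h); lra.
    + apply Rmult_lt_compat_l with (r := F) in Hlt; [|assumption].
      replace (F * (eps / F)) with eps in Hlt by (field; lra); assumption.
  - apply is_derive_ext_loc with (fun y => exp (- / y) * (/ y) ^ k).
    + exists (mkposreal x Hx); intros y Hy.
      apply Rabs_lt_between' in Hy; simpl in Hy.
      unfold flat; destruct (Rlt_dec 0 y); [reflexivity|lra].
    + unfold flat; destruct (Rlt_dec 0 x); [|lra].
      evar_last; [der|].
      rewrite !pow_add; destruct k as [|k]; simpl; field; lra.
Qed.

Lemma smooth_flat (k : nat) : smooth (flat k).
Proof.
  intro n; revert k; induction n as [|n IH]; intro k.
  - intro x; apply (ex_derive_continuous (flat k)); eexists; apply is_derive_flat.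
  - eapply Cn_of_derive; [apply is_derive_flat|].
    apply Cn_plus; [apply IH|apply Cn_mult; [apply Cn_const|apply IH]].
Qed.

(** A smooth transition from 0 on (-oo, 1] to 1 on [2, oo). *)
Definition step (x : R) : R := flat 0 (x - 1) * / (flat 0 (x - 1) + flat 0 (2 - x)).

Lemma step_den_pos (x : R) : 0 < flat 0 (x - 1) + flat 0 (2 - x).
Proof.
  pose proof (flat_ge_0 0 (x - 1)); pose proof (flat_ge_0 0 (2 - x)).
  destruct (Rlt_le_dec 1 x).
  - assert (0 < flat 0 (x - 1)) by (apply flat_pos; lra); lra.
  - assert (0 < flat 0 (2 - x)) by (apply flat_pos; lra); lra.
Qed.

#[export] Hint Resolve smooth_flat smooth_cosh smooth_sinh smooth_cos : smooth.
#[export] Hint Resolve step_den_pos : pos.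

Lemma smooth_step : smooth step.
Proof. unfold step; smooth_tac. Qed.

Lemma step_0 (x : R) : x <= 1 -> step x = 0.
Proof. intro Hx; unfold step; rewrite (flat_nonpos 0 (x - 1)) by lra; ring. Qed.

Lemma step_1 (x : R) : 2 <= x -> step x = 1.
Proof.
  intro Hx; pose proof (step_den_pos x) as H; unfold step.
  rewrite (flat_nonpos 0 (2 - x)) in * by lra; field; lra.
Qed.

Lemma step_bounds (x : R) : 0 <= step x <= 1.
Proof.
  pose proof (step_den_pos x) as H; unfold step.
  pose proof (flat_ge_0 0 (x - 1)); pose proof (flat_ge_0 0 (2 - x)).
  set (u := flat 0 (x - 1)) in *; set (v := flat 0 (2 - x)) in *.
  split; [apply Rmult_le_pos; [assumption|apply Rlt_le, Rinv_0_lt_compat, H]|].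
  apply Rmult_le_reg_r with (u + v); [assumption|].
  rewrite Rmult_assoc, Rinv_l by lra; lra.
Qed.

Lemma Derive_at_min (f : R -> R) (x : R) : smooth f -> (forall y, f x <= f y) ->
  Derive f x = 0.
Proof.
  intros Hf Hmin; assert (pr : derivable_pt f x)
    by (apply ex_derive_Reals_0, smooth_ex_derive, Hf).
  rewrite <- (Derive_Reals f x pr).
  apply (deriv_minimum f (x - 1) (x + 1)); [lra|lra|auto].
Qed.

Lemma Derive_step_out (x : R) : x <= 1 \/ 2 <= x -> Derive step x = 0.
Proof.
  intros [Hx|Hx].
  - apply Derive_at_min; [apply smooth_step|]; intro y; rewrite step_0 by assumption.
    apply step_bounds.
  - assert (E : Derive (fun y => - step y) x = 0).
    { apply (Derive_at_min (fun y => - step y)); [apply smooth_opp, smooth_step|].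
      intro y; rewrite step_1 by assumption; pose proof (step_bounds y); lra. }
    rewrite Derive_opp in E; lra.
Qed.

Lemma continuous_bounded (f : R -> R) (a b : R) : a <= b ->
  (forall x, a <= x <= b -> continuous f x) ->
  exists M, forall x, a <= x <= b -> Rabs (f x) <= M.
Proof.
  intros Hab Hf.
  destruct (continuity_ab_maj (fun x => Rabs (f x)) a b Hab) as [m [Hm _]].
  - intros c Hc; apply (continuity_pt_comp f Rabs).
    + apply continuity_pt_filterlim, Hf, Hc.
    + apply Rcontinuity_abs.
  - exists (Rabs (f m)); assumption.
Qed.

Lemma Derive_step_bounded : exists M, 0 < M /\ forall x, Rabs (Derive step x) <= M.
Proof.
  destruct (continuous_bounded (Derive step) 1 2) as [M HM]; [lra| |].
  - intros x _; apply smooth_continuous, smooth_Derive, smooth_step.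
  - exists (Rmax M 1); split; [apply Rlt_le_trans with 1; [lra|apply Rmax_r]|].
    intro x; destruct (Rlt_le_dec x 1); [|destruct (Rlt_le_dec 2 x)].
    + rewrite Derive_step_out, Rabs_R0 by lra.
      apply Rle_trans with 1; [lra|apply Rmax_r].
    + rewrite Derive_step_out, Rabs_R0 by lra.
      apply Rle_trans with 1; [lra|apply Rmax_r].
    + eapply Rle_trans; [apply HM; lra|apply Rmax_l].
Qed.

(** Positive exactly on (-1, 1). *)
Definition bump (x : R) : R := flat 0 (1 - x * x).

Lemma smooth_bump : smooth bump.
Proof. unfold bump; smooth_tac. Qed.

Lemma bump_ge_0 (x : R) : 0 <= bump x.
Proof. apply flat_ge_0. Qed.

Lemma bump_out (x : R) : 1 <= Rabs x -> bump x = 0.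
Proof.
  intro H; apply flat_nonpos.
  assert (Rabs x * Rabs x = x * x) by (rewrite <- Rabs_mult; apply Rabs_pos_eq; nra).
  nra.
Qed.

Lemma bump_0 : 0 < bump 0.
Proof. apply flat_pos; lra. Qed.

Lemma Derive_affine_comp (f : R -> R) (k m s : R) : smooth f ->
  Derive (fun s => f (k * (s - m))) s = k * Derive f (k * (s - m)).
Proof.
  intro Hf; pose proof (smooth_is_derive f (k * (s - m)) Hf) as H.
  apply is_derive_unique; evar_last; [der|ring].
Qed.

Lemma angle_representative (th0 th : R) : exists t, th0 <= t <= th0 + 2 * PI /\
  cos t = cos th /\ sin t = sin th.
Proof.
  pose proof PI_RGT_0 as Hpi.
  assert (Hplus : forall n, forall x, cos (x + 2 * INR n * PI) = cos x /\
                              sin (x + 2 * INR n * PI) = sin x)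
    by (intros; split; [apply cos_period|apply sin_period]).
  destruct (archimed ((th - th0) / (2 * PI))) as [H1 H2].
  set (k := up ((th - th0) / (2 * PI))) in *.
  assert (E : (th - th0) / (2 * PI) * (2 * PI) = th - th0) by (field; lra).
  exists (th - (IZR k - 1) * (2 * PI)); split; [nra|].
  assert (Hm : exists n : nat, IZR k - 1 = INR n \/ IZR k - 1 = - INR n).
  { exists (Z.abs_nat (k - 1)); rewrite INR_IZR_INZ, Zabs2Nat.id_abs.
    rewrite <- (minus_IZR k 1).
    destruct (Z.abs_spec (k - 1)) as [[_ ->]|[_ ->]]; [left|right];
      rewrite ?opp_IZR; lra. }
  destruct Hm as [n [->| ->]].
  - destruct (Hplus n (th - INR n * (2 * PI))) as [A1 A2].
    replace (th - INR n * (2 * PI) + 2 * INR n * PI) with th in * by ring.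
    auto.
  - destruct (Hplus n th) as [A1 A2].
    replace (th - - INR n * (2 * PI)) with (th + 2 * INR n * PI) by ring.
    auto.
Qed.

(** Positive exactly at angular distance less than [rho] from [th0], and a function of
    [cos th] and [sin th] only, as is required of a function on a circle. *)
Definition angle_bump (th0 rho th : R) : R := flat 0 (cos (th - th0) - cos rho).

Lemma smooth_angle_bump (th0 rho : R) : smooth (angle_bump th0 rho).
Proof. unfold angle_bump; smooth_tac. Qed.

#[export] Hint Resolve smooth_step smooth_bump smooth_angle_bump : smooth.

Lemma angle_bump_ext (th0 rho th th' : R) : cos th = cos th' -> sin th = sin th' ->
  angle_bump th0 rho th = angle_bump th0 rho th'.
Proof. intros Hc Hs; unfold angle_bump; rewrite !cos_minus, Hc, Hs; reflexivity. Qed.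

Lemma angle_bump_center (th0 rho : R) : 0 < rho < PI -> 0 < angle_bump th0 rho th0.
Proof.
  intro Hr; apply flat_pos; rewrite Rminus_eq_0.
  pose proof (cos_decreasing_1 0 rho ltac:(lra) ltac:(lra) ltac:(lra) ltac:(lra) ltac:(lra)).
  lra.
Qed.

Lemma angle_bump_support (th0 rho th : R) : 0 < rho < PI -> angle_bump th0 rho th <> 0 ->
  exists t, Rabs (t - th0) <= rho /\ cos t = cos th /\ sin t = sin th.
Proof.
  intros Hr Hn; destruct (angle_representative (th0 - PI) th) as [t [Ht [Hc Hs]]].
  exists t; split; [|auto].
  rewrite <- (angle_bump_ext th0 rho t th Hc Hs) in Hn.
  destruct (Rle_lt_dec (Rabs (t - th0)) rho) as [|Hlt]; [assumption|exfalso; apply Hn].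
  apply flat_nonpos.
  assert (E : cos (t - th0) = cos (Rabs (t - th0))).
  { unfold Rabs; destruct (Rcase_abs (t - th0)); [symmetry; apply cos_neg|reflexivity]. }
  assert (Rabs (t - th0) <= PI) by (apply Rabs_le_between; lra).
  rewrite E.
  pose proof (cos_decreasing_1 rho (Rabs (t - th0)) ltac:(lra) ltac:(lra) ltac:(lra)
    ltac:(lra) ltac:(lra)); lra.
Qed.

(** * Integrals of continuous functions *)

(** The type of an equation between integrals is the carrier of a normed module, whereas
    arithmetic tactics look for the type R. *)
Ltac toR := match goal with |- @eq _ ?x ?y => refine (Rminus_diag_uniq x y _) end.

Lemma ex_RInt_cont (f : R -> R) (a b : R) : (forall x, continuous f x) -> ex_RInt f a b.
Proof. intro H; apply (ex_RInt_continuous f); intros; apply H. Qed.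

Lemma RInt_lin (f g : R -> R) (k l a b : R) : ex_RInt f a b -> ex_RInt g a b ->
  RInt (fun x => k * f x + l * g x) a b = k * RInt f a b + l * RInt g a b.
Proof.
  intros Hf Hg; apply is_RInt_unique.
  apply (is_RInt_plus (fun x => k * f x) (fun x => l * g x));
    apply (is_RInt_scal (V := R_NormedModule));
    apply (RInt_correct (V := R_CompleteNormedModule)); assumption.
Qed.

Lemma RInt_scalR (f : R -> R) (k a b : R) : ex_RInt f a b ->
  RInt (fun x => k * f x) a b = k * RInt f a b.
Proof. apply (RInt_scal (V := R_CompleteNormedModule) f). Qed.

Lemma RInt_FTC (f f' : R -> R) (a b : R) : a <= b ->
  (forall x, a <= x <= b -> is_derive f x (f' x)) ->
  (forall x, a <= x <= b -> continuous f' x) ->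
  RInt f' a b = f b - f a.
Proof.
  intros Hab H1 H2; apply is_RInt_unique.
  apply (is_RInt_derive f f'); rewrite Rmin_left, Rmax_right by assumption; assumption.
Qed.

Lemma RInt_ChaslesR (f : R -> R) (a b c : R) : (forall x, continuous f x) ->
  RInt f a b + RInt f b c = RInt f a c.
Proof. intro H; apply (RInt_Chasles f); apply ex_RInt_cont, H. Qed.

Lemma RInt_nonneg (f : R -> R) (a b : R) : a <= b -> (forall x, continuous f x) ->
  (forall x, a <= x <= b -> 0 <= f x) -> 0 <= RInt f a b.
Proof.
  intros Hab Hc H; apply RInt_ge_0; [assumption|apply ex_RInt_cont, Hc|].
  intros x Hx; apply H; lra.
Qed.

Lemma RInt_eq_0 (f : R -> R) (a b : R) :
  (forall x, Rmin a b < x < Rmax a b -> f x = 0) -> RInt f a b = 0.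
Proof.
  intro H; rewrite (RInt_ext f (fun _ => 0)) by exact H.
  rewrite RInt_const; apply Rmult_0_r.
Qed.

Lemma RInt_support (f : R -> R) (x1 x2 y1 y2 : R) : y1 <= x1 -> x1 <= x2 -> x2 <= y2 ->
  (forall x, continuous f x) -> (forall x, x <= x1 \/ x2 <= x -> f x = 0) ->
  RInt f y1 y2 = RInt f x1 x2.
Proof.
  intros H1 H2 H3 Hc H.
  rewrite <- (RInt_ChaslesR f y1 x1 y2), <- (RInt_ChaslesR f x1 x2 y2) by assumption.
  rewrite (RInt_eq_0 f y1 x1), (RInt_eq_0 f x2 y2); [toR; ring| |];
    intros x Hx; apply H; rewrite Rmin_left, Rmax_right in Hx by assumption; lra.
Qed.

Lemma RInt_bound (f : R -> R) (a b y1 y2 M : R) : y1 <= a -> a <= b -> b <= y2 ->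
  (forall x, continuous f x) -> (forall x, x <= a \/ b <= x -> f x = 0) ->
  (forall x, a <= x <= b -> Rabs (f x) <= M) ->
  Rabs (RInt f y1 y2) <= (b - a) * M.
Proof.
  intros H1 H2 H3 Hc H HM; rewrite (RInt_support f a b y1 y2) by assumption.
  apply abs_RInt_le_const; [assumption|apply ex_RInt_cont, Hc|assumption].
Qed.

Lemma RInt_pos (f : R -> R) (a b x0 : R) : a < b -> (forall x, continuous f x) ->
  (forall x, a <= x <= b -> 0 <= f x) -> a <= x0 <= b -> 0 < f x0 -> 0 < RInt f a b.
Proof.
  intros Hab Hc Hf Hx0 Hpos.
  assert (Hcp : continuity_pt f x0) by (apply continuity_pt_filterlim, Hc).
  destruct (Hcp (f x0 / 2) ltac:(lra)) as [d [Hd Hn]].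
  assert (Hnear : forall x, Rabs (x - x0) < d -> f x0 / 2 < f x).
  { intros x Hx; destruct (Req_dec x x0) as [->|Hne]; [lra|].
    assert (H : Rabs (f x - f x0) < f x0 / 2).
    { apply Hn; split; [split; [exact I|auto]|exact Hx]. }
    apply Rabs_lt_between' in H; lra. }
  set (l := Rmax a (x0 - d / 2)); set (r := Rmin b (x0 + d / 2)).
  assert (Hl : a <= l /\ x0 - d / 2 <= l) by (split; [apply Rmax_l|apply Rmax_r]).
  assert (Hr : r <= b /\ r <= x0 + d / 2) by (split; [apply Rmin_l|apply Rmin_r]).
  assert (Hlr : l < r).
  { unfold l, r; apply Rmin_glb_lt; apply Rmax_lub_lt; lra. }
  rewrite <- (RInt_ChaslesR f a l b), <- (RInt_ChaslesR f l r b) by assumption.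
  assert (0 <= RInt f a l) by (apply RInt_nonneg; [lra|assumption|intros; apply Hf; lra]).
  assert (0 <= RInt f r b) by (apply RInt_nonneg; [lra|assumption|intros; apply Hf; lra]).
  assert (0 < RInt f l r); [|lra].
  apply RInt_gt_0; [assumption| |intros; apply Hc].
  intros x Hx; apply Rlt_trans with (f x0 / 2); [lra|].
  apply Hnear, Rabs_lt_between'; lra.
Qed.

Lemma RInt_gen_compact (f : R -> R) (x1 x2 : R) : x1 <= x2 ->
  (forall x, continuous f x) -> (forall x, x <= x1 \/ x2 <= x -> f x = 0) ->
  RInt_gen f (Rbar_locally m_infty) (Rbar_locally p_infty) = RInt f x1 x2.
Proof.
  intros H12 Hc H; apply is_RInt_gen_unique.
  intros P HP; unfold filtermapi.
  apply Filter_prod with (fun a => a < x1) (fun b => x2 < b).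
  - exists x1; intros; assumption.
  - exists x2; intros; assumption.
  - intros a b Ha Hb; exists (RInt f x1 x2); split; [|apply locally_singleton, HP].
    simpl; rewrite <- (RInt_support f x1 x2 a b) by (assumption || lra).
    apply (RInt_correct (V := R_CompleteNormedModule)), ex_RInt_cont, Hc.
Qed.

Lemma RInt_periodic (f : R -> R) (per a : R) : (forall x, continuous f x) ->
  (forall x, f (x + per) = f x) -> RInt f a (a + per) = RInt f 0 per.
Proof.
  intros Hc Hp.
  rewrite <- (RInt_ChaslesR f a 0 (a + per)), <- (RInt_ChaslesR f 0 per (a + per))
    by assumption.
  assert (H : RInt f per (a + per) = RInt f 0 a).
  { rewrite (RInt_ext f (fun y => f (y + per)) 0 a) by (intros; symmetry; apply Hp).
    transitivity (RInt (fun y => scal 1 (f (1 * y + per))) 0 a).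
    - replace per with (1 * 0 + per) at 1 by ring.
      replace (a + per) with (1 * a + per) by ring.
      symmetry; apply (RInt_comp_lin f 1 per 0 a), ex_RInt_cont, Hc.
    - apply RInt_ext; intros x _; unfold scal; simpl; unfold mult; simpl.
      rewrite !Rmult_1_l; reflexivity. }
  rewrite H; generalize (RInt_ChaslesR f a 0 a Hc); rewrite RInt_point.
  change (@zero R_CompleteNormedModule) with 0; intro E; toR; lra.
Qed.

(** * Wirtinger's inequality *)

Lemma cos_pos_near (w x : R) : 0 < w < 1 -> Rabs x <= PI / 2 -> 0 < cos (w * x).
Proof.
  intros Hw Hx; apply Rabs_le_between in Hx.
  pose proof PI_RGT_0; apply cos_gt_0; nra.
Qed.

(** For [w < 1] the function [cos (w (t - a - PI / 2))] is positive on the closed interval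
    [a, a + PI]; with [T] its logarithmic derivative,
    [h'^2 - w^2 h^2 = (h' - T h)^2 + (T h^2)'].  The constant 1 is reached in the limit,
    without meeting the poles of the cotangent. *)
Lemma dirichlet_ineq_lt (h h' : R -> R) (a w : R) : 0 < w < 1 ->
  (forall t, is_derive h t (h' t)) -> (forall t, continuous h' t) ->
  h a = 0 -> h (a + PI) = 0 ->
  w ^ 2 * RInt (fun t => h t ^ 2) a (a + PI) <= RInt (fun t => h' t ^ 2) a (a + PI).
Proof.
  intros Hw Hd Hc' H0 H1.
  pose proof PI_RGT_0 as Hpi.
  assert (Hc : forall t, continuous h t)
    by (intro t; apply is_derive_continuous with (h' t), Hd).
  set (T := fun t => - w * sin (w * (t - a - PI / 2)) / cos (w * (t - a - PI / 2))).
  assert (Hcos : forall t, a <= t <= a + PI -> 0 < cos (w * (t - a - PI / 2))).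
  { intros t Ht; apply cos_pos_near; [assumption|apply Rabs_le_between; lra]. }
  assert (HT : forall t, a <= t <= a + PI -> is_derive T t (- w ^ 2 - T t ^ 2)).
  { intros t Ht; pose proof (Hcos t Ht).
    unfold T; evar_last; [der; lra|].
    set (S := sin (w * (t - a - PI / 2))) in *.
    set (K := cos (w * (t - a - PI / 2))) in *.
    field; lra. }
  assert (HTc : forall t, a <= t <= a + PI -> continuous T t)
    by (intros t Ht; eapply is_derive_continuous, HT, Ht).
  clearbody T.
  assert (Hder : forall t, a <= t <= a + PI ->
    is_derive (fun t => T t * (h t * h t)) t
      ((- w ^ 2 - T t ^ 2) * (h t * h t) + T t * (h' t * h t + h t * h' t))).
  { intros t Ht; pose proof (HT t Ht); der. }
  assert (Hcd : forall t, a <= t <= a + PI -> continuous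
     (fun t => (- w ^ 2 - T t ^ 2) * (h t * h t) + T t * (h' t * h t + h t * h' t)) t).
  { intros t Ht; pose proof (HTc t Ht); cont_tac. }
  assert (HI := RInt_FTC _ _ a (a + PI) ltac:(lra) Hder Hcd).
  cbv beta in HI; rewrite H0, H1 in HI.
  assert (Hsq : forall t, continuous (fun t => h t ^ 2) t).
  { intro t; cont_tac. }
  assert (Hsq' : forall t, continuous (fun t => h' t ^ 2) t).
  { intro t; cont_tac. }
  assert (Hle : RInt (fun t => (- w ^ 2 - T t ^ 2) * (h t * h t)
                   + T t * (h' t * h t + h t * h' t)) a (a + PI)
          <= RInt (fun t => 1 * h' t ^ 2 + (- w ^ 2) * h t ^ 2) a (a + PI)).
  { apply RInt_le; [lra| | |].
    - apply (ex_RInt_continuous (V := R_CompleteNormedModule)).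
      intros z Hz; rewrite Rmin_left, Rmax_right in Hz by lra; apply Hcd, Hz.
    - apply ex_RInt_cont; intro t; cont_tac.
    - intros t Ht; pose proof (Rle_0_sqr (h' t - T t * h t)); unfold Rsqr in *; nra. }
  rewrite HI, RInt_lin in Hle by (apply ex_RInt_cont; assumption).
  lra.
Qed.

Lemma dirichlet_ineq (h h' : R -> R) (a c : R) :
  (forall t, is_derive h t (h' t)) -> (forall t, continuous h' t) ->
  h a = c -> h (a + PI) = c ->
  RInt (fun t => (h t - c) ^ 2) a (a + PI) <= RInt (fun t => h' t ^ 2) a (a + PI).
Proof.
  intros Hd Hc' H0 H1; pose proof PI_RGT_0 as Hpi.
  assert (Hd' : forall t, is_derive (fun t => h t - c) t (h' t)).
  { intro t; evar_last; [der|ring]. }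
  assert (H : forall w, 0 < w < 1 -> w ^ 2 * RInt (fun t => (h t - c) ^ 2) a (a + PI)
                <= RInt (fun t => h' t ^ 2) a (a + PI)).
  { intros w Hw.
    apply (dirichlet_ineq_lt (fun t => h t - c) h' a w); auto; rewrite ?H0, ?H1; ring. }
  assert (Hb : 0 <= RInt (fun t => (h t - c) ^ 2) a (a + PI)).
  { apply RInt_nonneg; [lra| |intros; apply pow2_ge_0].
    intro t; pose proof (is_derive_continuous _ _ _ (Hd t)); cont_tac. }
  set (B := RInt (fun t => (h t - c) ^ 2) a (a + PI)) in *.
  set (E := RInt (fun t => h' t ^ 2) a (a + PI)) in *.
  destruct (Rle_lt_dec B E) as [|HEB]; [assumption|exfalso].
  assert (HE : 0 <= E).
  { specialize (H (1 / 2) ltac:(lra)); nra. }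
  set (r := (B - E) / (4 * B)).
  assert (Hr : r * (4 * B) = B - E) by (unfold r; field; lra).
  assert (0 < r) by (apply Rdiv_lt_0_compat; lra).
  assert (r < 1) by nra.
  specialize (H (1 - r) ltac:(lra)).
  nra.
Qed.

(** Some [t0] has [h t0 = h (t0 + PI)]; subtracting this common value [c] gives a function
    vanishing at the ends of two half periods, and replacing the mean value of [h] by [c]
    can only increase the integral of [(h - c)^2]. *)
Lemma wirtinger (h h' : R -> R) :
  (forall t, is_derive h t (h' t)) -> (forall t, continuous h' t) ->
  (forall t, h (t + 2 * PI) = h t) ->
  RInt (fun t => h t ^ 2) 0 (2 * PI) - RInt h 0 (2 * PI) ^ 2 / (2 * PI)
  <= RInt (fun t => h' t ^ 2) 0 (2 * PI).
Proof.
  intros Hd Hc' Hper; pose proof PI_RGT_0 as Hpi.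
  assert (Hc : forall t, continuous h t)
    by (intro t; apply is_derive_continuous with (h' t), Hd).
  assert (Hper' : forall t, h' (t + 2 * PI) = h' t).
  { intro t; rewrite <- (is_derive_unique _ _ _ (Hd t)); symmetry.
    apply is_derive_unique.
    apply is_derive_ext with (fun t => h (t + 2 * PI)); [intro; apply Hper|].
    evar_last; [der|ring]. }
  assert (Ht0 : exists t0, h t0 = h (t0 + PI)).
  { set (k := fun t => h (t + PI) - h t).
    assert (Hk : continuity k).
    { intro t; apply continuity_pt_filterlim.
      apply is_derive_continuous with ((1 + 0) * h' (t + PI) - h' t); unfold k; der. }
    assert (E : k PI = - k 0).
    { unfold k; replace (PI + PI) with (0 + 2 * PI) by ring.
      rewrite Hper, Rplus_0_l; ring. }
    destruct (IVT_cor k 0 PI Hk ltac:(lra)) as [t [_ Ht]]; [rewrite E; nra|].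
    exists t; unfold k in Ht; lra. }
  destruct Ht0 as [t0 Ht0].
  set (c := h t0).
  assert (D1 := dirichlet_ineq h h' t0 c Hd Hc' eq_refl (eq_sym Ht0)).
  assert (D2 := dirichlet_ineq h h' (t0 + PI) c Hd Hc' (eq_sym Ht0)).
  replace (t0 + PI + PI) with (t0 + 2 * PI) in D2 by ring.
  specialize (D2 (Hper t0)).
  assert (Hsq : forall c t, continuous (fun t => (h t - c) ^ 2) t).
  { intros d t; cont_tac. }
  assert (Hsq' : forall t, continuous (fun t => h' t ^ 2) t) by (intro t; cont_tac).
  pose proof (Rplus_le_compat _ _ _ _ D1 D2) as D.
  rewrite !RInt_ChaslesR in D by auto.
  rewrite (RInt_periodic (fun t => (h t - c) ^ 2)) in D
    by (auto; intro; rewrite Hper; reflexivity).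
  rewrite (RInt_periodic (fun t => h' t ^ 2)) in D
    by (auto; intro; rewrite Hper'; reflexivity).
  assert (Hsq0 : forall t, continuous (fun t => h t ^ 2) t) by (intro t; cont_tac).
  assert (E : RInt (fun t => (h t - c) ^ 2) 0 (2 * PI)
    = RInt (fun t => h t ^ 2) 0 (2 * PI) - 2 * c * RInt h 0 (2 * PI) + c ^ 2 * (2 * PI)).
  { rewrite (RInt_ext _ (fun t => 1 * h t ^ 2 + 1 * ((- 2 * c) * h t + c ^ 2 * 1)))
      by (intros; simpl; ring).
    assert (Hl : forall t, continuous (fun t => (- 2 * c) * h t + c ^ 2 * 1) t).
    { intro t; cont_tac. }
    rewrite RInt_lin by (apply ex_RInt_cont; auto).
    rewrite (RInt_lin h (fun _ => 1))
      by (apply ex_RInt_cont; auto; intro; apply continuous_const).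
    rewrite RInt_const; unfold scal; simpl; unfold mult; simpl; ring. }
  rewrite E in D.
  set (m := RInt h 0 (2 * PI)) in *.
  assert (0 <= (m - c * (2 * PI)) ^ 2 / (2 * PI)).
  { apply Rmult_le_pos; [apply pow2_ge_0|apply Rlt_le, Rinv_0_lt_compat; lra]. }
  replace ((m - c * (2 * PI)) ^ 2 / (2 * PI))
    with (m ^ 2 / (2 * PI) - 2 * c * m + c ^ 2 * (2 * PI)) in H by (field; lra).
  lra.
Qed.

(** The integral of the square of [h] minus its mean value is nonnegative. *)
Lemma RInt_2PI_cauchy_schwarz (h : R -> R) : (forall t, continuous h t) ->
  RInt h 0 (2 * PI) ^ 2 / (2 * PI) <= RInt (fun t => h t * h t) 0 (2 * PI).
Proof.
  intro Hc; pose proof PI_RGT_0 as Hpi.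
  set (m := RInt h 0 (2 * PI) / (2 * PI)).
  assert (H : 0 <= RInt (fun t => 1 * (h t * h t) + 1 * ((- 2 * m) * h t + m ^ 2 * 1))
                     0 (2 * PI)).
  { apply RInt_nonneg; [lra|intro; cont_tac|].
    intros t _; replace (1 * (h t * h t) + 1 * (- 2 * m * h t + m ^ 2 * 1))
      with ((h t - m) ^ 2) by ring; apply pow2_ge_0. }
  rewrite RInt_lin, RInt_lin, RInt_const in H by (apply ex_RInt_cont; intro; cont_tac).
  unfold scal in H; simpl in H; unfold mult in H; simpl in H.
  assert (E : RInt h 0 (2 * PI) = m * (2 * PI)) by (toR; unfold m; field; lra).
  rewrite E in *; replace ((m * (2 * PI)) ^ 2 / (2 * PI)) with (m ^ 2 * (2 * PI))
    by (field; lra).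
  nra.
Qed.

(** * Monotonicity and limits *)

Lemma increasing_is_lim (f : R -> R) (r M : R) :
  (forall s t, r <= s -> s <= t -> f s <= f t) -> (forall s, r <= s -> f s <= M) ->
  exists l : R, is_lim f p_infty l.
Proof.
  intros Hi HM.
  destruct (completeness (fun y => exists s, r <= s /\ y = f s)) as [l [Hub Hlub]].
  - exists M; intros y [s [Hs ->]]; apply HM, Hs.
  - exists (f r), r; split; [lra|reflexivity].
  - exists l; apply is_lim_spec; intro eps; pose proof (cond_pos eps) as He.
    assert (Hex : exists s, r <= s /\ l - eps < f s).
    { apply NNPP; intro Hno.
      assert (l <= l - eps); [|lra].
      apply Hlub; intros y [s [Hs ->]].
      destruct (Rle_lt_dec (f s) (l - eps)); [assumption|exfalso; eauto]. }
    destruct Hex as [s [Hs Hl]]; exists s; intros t Ht.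
    apply Rabs_lt_between'; split.
    + apply Rlt_le_trans with (f s); [assumption|apply Hi; lra].
    + apply Rle_lt_trans with l; [|lra].
      apply Hub; exists t; split; [lra|reflexivity].
Qed.

Lemma le_of_derive_le (f f' : R -> R) (s t : R) : s <= t ->
  (forall x, s <= x <= t -> is_derive f x (f' x)) ->
  (forall x, s <= x <= t -> 0 <= f' x) -> f s <= f t.
Proof.
  intros Hst Hd Hp.
  destruct (MVT_gen f s t f') as [x [Hx E]]; rewrite ?Rmin_left, ?Rmax_right in * by assumption.
  - intros; apply Hd; lra.
  - intros; apply continuity_pt_filterlim; eapply is_derive_continuous, Hd; assumption.
  - pose proof (Hp x Hx); nra.
Qed.

Lemma lt_of_derive_pos (f f' : R -> R) (s t : R) : s < t ->
  (forall x, s <= x <= t -> is_derive f x (f' x)) ->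
  (forall x, s <= x <= t -> 0 < f' x) -> f s < f t.
Proof.
  intros Hst Hd Hp.
  destruct (MVT_gen f s t f') as [x [Hx E]]; rewrite ?Rmin_left, ?Rmax_right in * by lra.
  - intros; apply Hd; lra.
  - intros; apply continuity_pt_filterlim; eapply is_derive_continuous, Hd; assumption.
  - pose proof (Hp x Hx); nra.
Qed.

Lemma is_lim_le_const (f : R -> R) (r l M : R) : is_lim f p_infty l ->
  (forall s, r < s -> f s <= M) -> l <= M.
Proof.
  intros Hl HM; destruct (Rle_lt_dec l M) as [|H]; [assumption|exfalso].
  apply is_lim_spec in Hl; destruct (Hl (mkposreal (l - M) ltac:(lra))) as [B HB].
  simpl in HB; pose proof (Rmax_l B r); pose proof (Rmax_r B r).
  specialize (HB (Rmax B r + 1) ltac:(lra)); specialize (HM (Rmax B r + 1) ltac:(lra)).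
  apply Rabs_lt_between' in HB; lra.
Qed.

Lemma is_lim_inv_bound (f : R -> R) (r M : R) : 0 < r ->
  (forall s, r < s -> Rabs (f s) <= M / s) -> is_lim f p_infty 0.
Proof.
  intros Hr H; apply is_lim_spec; intro eps; pose proof (cond_pos eps) as He.
  pose proof (Rabs_pos M) as HM; pose proof (Rle_abs M).
  assert (0 <= Rabs M / eps) by (apply Rmult_le_pos; [lra|apply Rlt_le; pos_tac]).
  exists (r + Rabs M / eps); intros s Hs; rewrite Rminus_0_r.
  eapply Rle_lt_trans; [apply H; lra|].
  assert (Hs' : Rabs M / eps < s) by lra.
  apply Rmult_lt_compat_r with (r := eps) in Hs'; [|assumption].
  replace (Rabs M / eps * eps) with (Rabs M) in Hs' by (field; lra).
  apply Rmult_lt_reg_r with s; [lra|].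
  replace (M / s * s) with M by (field; lra); lra.
Qed.

(** * Functions of two variables *)

Definition c2 (H : R -> R -> R) : Prop := forall s th, continuity_2d_pt H s th.

Definition smooth2 (F : R -> R -> R) : Prop := forall n s th, ex_diff_n F n s th.

Definition ds (F : R -> R -> R) (s th : R) : R := Derive (fun u => F u th) s.
Definition dt (F : R -> R -> R) (s th : R) : R := Derive (fun v => F s v) th.

Lemma smooth2_ds (F : R -> R -> R) : smooth2 F -> smooth2 (ds F).
Proof. intros H n s th; apply (ex_diff_n_deriv_aux1 F n s th), H. Qed.

Lemma smooth2_dt (F : R -> R -> R) : smooth2 F -> smooth2 (dt F).
Proof. intros H n s th; apply (ex_diff_n_deriv_aux2 F n s th), H. Qed.

Lemma smooth2_c2 (F : R -> R -> R) : smooth2 F -> c2 F.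
Proof. intros H s th; apply (H 0%nat s th). Qed.

Lemma smooth2_is_ds (F : R -> R -> R) (s th : R) : smooth2 F ->
  is_derive (fun u => F u th) s (ds F s th).
Proof. intro H; apply Derive_correct, (H 1%nat s th). Qed.

Lemma smooth2_is_dt (F : R -> R -> R) (s th : R) : smooth2 F ->
  is_derive (fun v => F s v) th (dt F s th).
Proof. intro H; apply Derive_correct, (H 1%nat s th). Qed.

Lemma c2_th (H : R -> R -> R) (s th : R) : c2 H -> continuous (H s) th.
Proof.
  intro Hc; apply continuity_pt_filterlim, continuity_pt_locally; intro eps.
  destruct (Hc s th eps) as [d Hd]; exists d; intros v Hv.
  apply Hd; [rewrite Rminus_eq_0, Rabs_R0; apply cond_pos|apply Hv].
Qed.

Lemma c2_plus (H K : R -> R -> R) : c2 H -> c2 K -> c2 (fun s th => H s th + K s th).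
Proof. intros h k s th; apply continuity_2d_pt_plus; [apply h|apply k]. Qed.

Lemma c2_minus (H K : R -> R -> R) : c2 H -> c2 K -> c2 (fun s th => H s th - K s th).
Proof. intros h k s th; apply continuity_2d_pt_minus; [apply h|apply k]. Qed.

Lemma c2_mult (H K : R -> R -> R) : c2 H -> c2 K -> c2 (fun s th => H s th * K s th).
Proof. intros h k s th; apply continuity_2d_pt_mult; [apply h|apply k]. Qed.

Lemma c2_fst (f : R -> R) : (forall s, continuous f s) -> c2 (fun s _ => f s).
Proof.
  intros Hf s th; apply (continuity_1d_2d_pt_comp f (fun u _ => u)).
  - apply continuity_pt_filterlim, Hf.
  - apply continuity_2d_pt_id1.
Qed.

Lemma c2_ex_RInt (H : R -> R -> R) (s a b : R) : c2 H -> ex_RInt (H s) a b.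
Proof. intro Hc; apply ex_RInt_cont; intro th; apply c2_th, Hc. Qed.

Lemma c2_RInt_continuous (H : R -> R -> R) (a b s : R) : a < b -> c2 H ->
  continuous (fun s => RInt (H s) a b) s.
Proof.
  intros Hab Hc; apply continuity_pt_filterlim, continuity_pt_locally; intro eps.
  assert (He : 0 < eps / (2 * (b - a)))
    by (apply Rdiv_lt_0_compat; [apply cond_pos|lra]).
  destruct (uniform_continuity_2d_1d' H a b s (fun x _ => Hc s x) (mkposreal _ He))
    as [d Hd]; simpl in Hd.
  exists d; intros u Hu; apply Rabs_lt_between' in Hu.
  replace (RInt (H u) a b - RInt (H s) a b)
    with (RInt (fun th => 1 * H u th + (- 1) * H s th) a b)
    by (rewrite RInt_lin by (apply c2_ex_RInt, Hc); toR; ring).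
  apply Rle_lt_trans with ((b - a) * (eps / (2 * (b - a)))).
  - apply abs_RInt_le_const; [lra| |].
    + apply ex_RInt_cont; intro th.
      pose proof (c2_th H u th Hc); pose proof (c2_th H s th Hc); cont_tac.
    + intros th Hth; replace (1 * H u th + -1 * H s th) with (H u th - H s th) by ring.
      pose proof (cond_pos d); apply Rlt_le, Hd; try lra.
      rewrite Rminus_eq_0, Rabs_R0; assumption.
  - replace ((b - a) * (eps / (2 * (b - a)))) with (eps / 2) by (field; lra).
    pose proof (cond_pos eps); lra.
Qed.

Lemma is_derive_RInt_c2 (H Hs : R -> R -> R) (a b s : R) : a <= b ->
  (forall s th, is_derive (fun u => H u th) s (Hs s th)) -> c2 H -> c2 Hs ->
  is_derive (fun s => RInt (H s) a b) s (RInt (Hs s) a b).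
Proof.
  intros Hab Hd HH HHs.
  assert (E : forall s th, Derive (fun u => H u th) s = Hs s th)
    by (intros; apply is_derive_unique, Hd).
  rewrite (RInt_ext (Hs s) (fun t => Derive (fun u => H u t) s))
    by (intros; symmetry; apply E).
  apply (is_derive_RInt_param H a b s).
  - exists (mkposreal 1 Rlt_0_1); intros y _ t _; eexists; apply Hd.
  - intros t _; apply continuity_2d_pt_ext with Hs; [intros; symmetry; apply E|apply HHs].
  - exists (mkposreal 1 Rlt_0_1); intros y _; apply c2_ex_RInt, HH.
Qed.

(** Sums of two products of functions of one variable are stable under both partial
    derivatives, hence the induction on the order. *)
Lemma ex_diff_n_sum_prod (n : nat) (al be ga de : R -> R) (s th : R) :
  smooth al -> smooth be -> smooth ga -> smooth de ->
  ex_diff_n (fun s th => al s * be th + ga s * de th) n s th.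
Proof.
  revert al be ga de s th; induction n as [|n IH]; intros al be ga de s th Ha Hb Hg Hd.
  all: assert (Hc : continuity_2d_pt (fun s th => al s * be th + ga s * de th) s th)
    by (apply continuity_2d_pt_plus; apply continuity_2d_pt_mult;
        (apply (continuity_1d_2d_pt_comp _ (fun u _ => u));
           [apply continuity_pt_filterlim, smooth_continuous; assumption
           |apply continuity_2d_pt_id1]) ||
        (apply (continuity_1d_2d_pt_comp _ (fun _ v => v));
           [apply continuity_pt_filterlim, smooth_continuous; assumption
           |apply continuity_2d_pt_id2])).
  - split; [exact Hc|exact I].
  - assert (Ds : forall s th, is_derive (fun z => al z * be th + ga z * de th) s
                   (Derive al s * be th + Derive ga s * de th)).
    { intros x y; pose proof (smooth_is_derive al x Ha); pose proof (smooth_is_derive ga x Hg).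
      evar_last; [der|ring]. }
    assert (Dt : forall s th, is_derive (fun z => al s * be z + ga s * de z) th
                   (al s * Derive be th + ga s * Derive de th)).
    { intros x y; pose proof (smooth_is_derive be y Hb); pose proof (smooth_is_derive de y Hd).
      evar_last; [der|ring]. }
    split; [exact Hc|split; [eexists; apply Ds|split; [eexists; apply Dt|split]]].
    + replace (fun u v => Derive (fun z => al z * be v + ga z * de v) u)
        with (fun u v => Derive al u * be v + Derive ga u * de v).
      * apply IH; try apply smooth_Derive; assumption.
      * apply functional_extensionality; intro x; apply functional_extensionality; intro y.
        symmetry; apply is_derive_unique, Ds.
    + replace (fun u v => Derive (fun z => al u * be z + ga u * de z) v)
        with (fun u v => al u * Derive be v + ga u * Derive de v).
      * apply IH; try apply smooth_Derive; assumption.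
      * apply functional_extensionality; intro x; apply functional_extensionality; intro y.
        symmetry; apply is_derive_unique, Dt.
Qed.

Lemma ex_diff_n_scal (n : nat) (k : R) (F : R -> R -> R) (s th : R) :
  ex_diff_n F n s th -> ex_diff_n (fun u v => k * F u v) n s th.
Proof.
  revert F s th; induction n as [|n IH]; intros F s th HF.
  - destruct HF as [HF _]; split; [|exact I].
    apply (continuity_2d_pt_mult (fun _ _ => k) F); [apply continuity_2d_pt_const|exact HF].
  - destruct HF as [HF [H1 [H2 [H3 H4]]]].
    split; [apply (continuity_2d_pt_mult (fun _ _ => k) F);
      [apply continuity_2d_pt_const|exact HF]|].
    split; [apply (ex_derive_scal (fun z => F z th)), H1|].
    split; [apply (ex_derive_scal (fun z => F s z)), H2|split].
    + replace (fun u v => Derive (fun z => k * F z v) u)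
        with (fun u v => k * Derive (fun z => F z v) u); [apply IH, H3|].
      apply functional_extensionality; intro u; apply functional_extensionality; intro v.
      symmetry; apply Derive_scal.
    + replace (fun u v => Derive (fun z => k * F u z) v)
        with (fun u v => k * Derive (fun z => F u z) v); [apply IH, H4|].
      apply functional_extensionality; intro u; apply functional_extensionality; intro v.
      symmetry; apply Derive_scal.
Qed.

Lemma closed_union (D E : R * R -> Prop) : closed D -> closed E ->
  closed (fun x => D x \/ E x).
Proof.
  intros HD HE x Hx; apply NNPP; intro Hno; apply Hno; left; apply HD; intro LD.
  apply Hno; right; apply HE; intro LE; apply Hx.
  generalize (filter_and _ _ LD LE); apply filter_imp; tauto.
Qed.

Lemma closed_box (l1 h1 l2 h2 : R) :
  closed (fun x : R * R => (l1 <= fst x /\ fst x <= h1) /\ (l2 <= snd x /\ snd x <= h2)).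
Proof.
  repeat apply closed_and.
  - apply (closed_comp (fun x : R * R => fst x) (fun u => l1 <= u));
      [intros [? ?]; apply continuous_fst|apply closed_ge].
  - apply (closed_comp (fun x : R * R => fst x) (fun u => u <= h1));
      [intros [? ?]; apply continuous_fst|apply closed_le].
  - apply (closed_comp (fun x : R * R => snd x) (fun u => l2 <= u));
      [intros [? ?]; apply continuous_snd|apply closed_ge].
  - apply (closed_comp (fun x : R * R => snd x) (fun u => u <= h2));
      [intros [? ?]; apply continuous_snd|apply closed_le].
Qed.

Lemma lin_comb_two (m : nat) (al be : R) (e : nat -> pt -> R) (p : pt) :
  lin_comb (S (S m)) (fun i => match i with 0%nat => al | 1%nat => be | _ => 0 end) e p
  = al * e 0%nat p + be * e 1%nat p.
Proof.
  induction m as [|m IH]; [simpl; ring|].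
  remember (S (S m)) as k; simpl lin_comb; rewrite IH; subst k; ring.
Qed.

(** * Curvature of hyperbolic space *)

Lemma Derive_inv_pow (n : nat) (x : R) : x <> 0 ->
  Derive (fun t => / t ^ S n) x = - INR (S n) / x ^ S (S n).
Proof.
  intro Hx; apply is_derive_unique; evar_last.
  - apply is_derive_inv; [apply is_derive_pow, is_derive_idR|].
    apply pow_nonzero; assumption.
  - change (Init.Nat.pred (S n)) with n; simpl pow; field;
      repeat split; try assumption; apply pow_nonzero; assumption.
Qed.

Lemma partial_hyp_metric (l i j : idx) (p : pt) : coord p i3 <> 0 ->
  partial l (hyp_metric i j) p =
  if idx_eqb i j then (if idx_eqb l i3 then - 2 / coord p i3 ^ 3 else 0) else 0.
Proof.
  intro Hp; unfold partial, hyp_metric.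
  destruct (idx_eqb i j); [|apply Derive_const].
  destruct l; simpl idx_eqb; cbv iota.
  - apply (Derive_const (/ coord p i3 ^ 2)).
  - apply (Derive_const (/ coord p i3 ^ 2)).
  - apply (Derive_inv_pow 1 _ Hp).
Qed.

(** The Christoffel symbols of the half-space, as functions of the height [z]. *)
Definition chr (k i j : idx) (z : R) : R :=
  - / z * ((if idx_eqb k i then if idx_eqb j i3 then 1 else 0 else 0)
           + (if idx_eqb k j then if idx_eqb i i3 then 1 else 0 else 0)
           - (if idx_eqb i j then if idx_eqb k i3 then 1 else 0 else 0)).

(** The formula also holds on the plane [z = 0], where both sides vanish: this makes it an
    identity between functions on the whole of R^3, which can be differentiated. *)
Lemma christoffel_hyp (k i j : idx) (p : pt) :
  christoffel k i j p = chr k i j (coord p i3).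
Proof.
  destruct (Req_dec (coord p i3) 0) as [H0|H0].
  - unfold christoffel, sum3, hyp_metric_inv, chr; rewrite H0, Rinv_0.
    destruct k; simpl; ring.
  - unfold christoffel, sum3; rewrite !partial_hyp_metric by assumption.
    unfold hyp_metric_inv, chr.
    destruct k, i, j; simpl idx_eqb; cbv iota; field; assumption.
Qed.

Lemma partial_christoffel (l k i j : idx) (p : pt) : coord p i3 <> 0 ->
  partial l (christoffel k i j) p =
  if idx_eqb l i3 then - / coord p i3 * chr k i j (coord p i3) else 0.
Proof.
  intro Hp; unfold partial.
  rewrite (Derive_ext _ (fun t => chr k i j (coord (upd p l t) i3)))
    by (intro; apply christoffel_hyp).
  destruct l; simpl idx_eqb; cbv iota.
  - apply (Derive_const (chr k i j (coord p i3))).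
  - apply (Derive_const (chr k i j (coord p i3))).
  - simpl coord; unfold chr.
    set (c := _ + _ - _); clearbody c; apply is_derive_unique.
    change (snd p) with (coord p i3); auto_derive; [assumption|]; field; assumption.
Qed.

Lemma ricci_hyp (p : pt) (v w : idx -> R) : coord p i3 <> 0 ->
  ricci p v w = - 2 * hyp_inner p v w.
Proof.
  intro Hp.
  assert (H : forall j k, ricci_coef j k p = - 2 * hyp_metric j k p).
  { intros j k; unfold ricci_coef, sum3.
    rewrite !partial_christoffel, !christoffel_hyp by assumption.
    unfold chr, hyp_metric.
    destruct j, k; simpl idx_eqb; cbv iota; field; assumption. }
  unfold ricci, hyp_inner, sum3; rewrite !H; ring.
Qed.

(** * Surfaces of revolution with unit speed profile *)

Section Revolution.

Variables r z r1 z1 r2 z2 : R -> R.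
Hypothesis dr : forall s, is_derive r s (r1 s).
Hypothesis dz : forall s, is_derive z s (z1 s).
Hypothesis dr1 : forall s, is_derive r1 s (r2 s).
Hypothesis dz1 : forall s, is_derive z1 s (z2 s).
Hypothesis z_pos : forall s, 0 < z s.
Hypothesis r_pos : forall s, 0 < r s.
Hypothesis unit_speed : forall s, r1 s ^ 2 + z1 s ^ 2 = z s ^ 2.

Let X : surf := fun s th => (r s * cos th, r s * sin th, z s).

Let t_s (s th : R) (i : idx) : R :=
  match i with i1 => r1 s * cos th | i2 => r1 s * sin th | i3 => z1 s end.
Let t_th (s th : R) (i : idx) : R :=
  match i with i1 => - (r s * sin th) | i2 => r s * cos th | i3 => 0 end.

Lemma rev_tangent_s (s th : R) (i : idx) : tangent X Ps s th i = t_s s th i.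
Proof.
  unfold tangent, par_deriv, X; destruct i; simpl; apply is_derive_unique.
  - pose proof (is_derive_scal_l r s (r1 s) (cos th) (dr s)) as H; exact H.
  - pose proof (is_derive_scal_l r s (r1 s) (sin th) (dr s)) as H; exact H.
  - apply dz.
Qed.

Lemma rev_tangent_th (s th : R) (i : idx) : tangent X Pth s th i = t_th s th i.
Proof.
  unfold tangent, par_deriv, X; destruct i; simpl; apply is_derive_unique;
    auto_derive; trivial; ring.
Qed.

Lemma rev_first_ss (s th : R) : first_form X Ps Ps s th = 1.
Proof.
  unfold first_form, hyp_inner, sum3; rewrite !rev_tangent_s.
  unfold hyp_metric; simpl.
  pose proof (z_pos s); pose proof (unit_speed s) as E.
  pose proof (sin2_cos2 th) as T; unfold Rsqr in T.
  transitivity ((r1 s ^ 2 * (sin th * sin th + cos th * cos th) + z1 s ^ 2) / z s ^ 2);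
    [field; lra|rewrite T, Rmult_1_r, E; field; lra].
Qed.

Lemma rev_first_sth (s th : R) : first_form X Ps Pth s th = 0.
Proof.
  unfold first_form, hyp_inner, sum3; rewrite !rev_tangent_s, !rev_tangent_th.
  unfold hyp_metric; simpl; ring.
Qed.

Lemma rev_first_ths (s th : R) : first_form X Pth Ps s th = 0.
Proof.
  unfold first_form, hyp_inner, sum3; rewrite !rev_tangent_s, !rev_tangent_th.
  unfold hyp_metric; simpl; ring.
Qed.

Lemma rev_first_thth (s th : R) : first_form X Pth Pth s th = r s ^ 2 / z s ^ 2.
Proof.
  unfold first_form, hyp_inner, sum3; rewrite !rev_tangent_th.
  unfold hyp_metric; simpl.
  pose proof (z_pos s).
  pose proof (sin2_cos2 th) as T; unfold Rsqr in T.
  transitivity (r s ^ 2 * (sin th * sin th + cos th * cos th) / z s ^ 2);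
    [field; lra|rewrite T; field; lra].
Qed.

Lemma rev_first_det (s th : R) : first_form_det X s th = (r s / z s) ^ 2.
Proof.
  unfold first_form_det.
  rewrite rev_first_ss, rev_first_sth, rev_first_thth.
  pose proof (z_pos s); field; lra.
Qed.

Lemma rev_sqrt_det (s th : R) : sqrt (first_form_det X s th) = r s / z s.
Proof.
  rewrite rev_first_det; apply sqrt_pow2, Rlt_le, Rdiv_lt_0_compat; auto.
Qed.

Lemma rev_first_inv (al be : par) (s th : R) : first_form_inv X al be s th =
  match al, be with Ps, Ps => 1 | Pth, Pth => (z s / r s) ^ 2 | _, _ => 0 end.
Proof.
  unfold first_form_inv.
  rewrite rev_first_det, rev_first_ss, rev_first_sth, rev_first_ths, rev_first_thth.
  pose proof (z_pos s); pose proof (r_pos s); destruct al, be; field; lra.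
Qed.

Let N (s th : R) (i : idx) : R :=
  match i with i1 => - z1 s * cos th | i2 => - z1 s * sin th | i3 => r1 s end.

Lemma rev_normal (s th : R) (i : idx) :
  normal X s th i = z s ^ 2 * r s * N s th i.
Proof.
  unfold normal, sum3, cross; rewrite !rev_tangent_s, !rev_tangent_th.
  unfold hyp_metric_inv, N; pose proof (sin2_cos2 th) as T; unfold Rsqr in T.
  destruct i; simpl; try ring.
  transitivity (z s ^ 2 * r s * r1 s * (sin th * sin th + cos th * cos th));
    [ring|rewrite T; ring].
Qed.

Lemma rev_N_norm (s th : R) : hyp_inner (X s th) (N s th) (N s th) = 1.
Proof.
  unfold hyp_inner, sum3, hyp_metric, N; simpl.
  pose proof (z_pos s); pose proof (unit_speed s) as E.
  pose proof (sin2_cos2 th) as T; unfold Rsqr in T.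
  transitivity ((r1 s ^ 2 + z1 s ^ 2 * (sin th * sin th + cos th * cos th)) / z s ^ 2);
    [field; lra|rewrite T, Rmult_1_r, E; field; lra].
Qed.

Lemma rev_unit_normal (s th : R) (i : idx) : unit_normal X s th i = N s th i.
Proof.
  unfold unit_normal.
  replace (hyp_inner (X s th) (normal X s th) (normal X s th))
    with ((z s ^ 2 * r s) ^ 2).
  - rewrite sqrt_pow2, rev_normal.
    + pose proof (z_pos s); pose proof (r_pos s); field; lra.
    + apply Rmult_le_pos; [apply pow2_ge_0|apply Rlt_le, r_pos].
  - transitivity ((z s ^ 2 * r s) ^ 2 * hyp_inner (X s th) (N s th) (N s th)).
    + rewrite rev_N_norm; ring.
    + unfold hyp_inner, sum3; rewrite !rev_normal; ring.
Qed.

Lemma rev_ricci (s th : R) :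
  ricci (X s th) (unit_normal X s th) (unit_normal X s th) = - 2.
Proof.
  rewrite ricci_hyp by (simpl; apply Rgt_not_eq, z_pos).
  replace (unit_normal X s th) with (N s th)
    by (apply functional_extensionality; intro; symmetry; apply rev_unit_normal).
  rewrite rev_N_norm; ring.
Qed.

Lemma rev_second_form (al be : par) (s th : R) : second_form X al be s th =
  match al, be with
  | Ps, Ps => (- z1 s * (r2 s - 2 * r1 s * z1 s / z s)
               + r1 s * (z2 s + (r1 s ^ 2 - z1 s ^ 2) / z s)) / z s ^ 2
  | Pth, Pth => (z1 s + r s * r1 s / z s) * r s / z s ^ 2
  | _, _ => 0
  end.
Proof.
  assert (Ess : forall i, par_deriv Ps (fun u v => tangent X Ps u v i) s th =
            match i with i1 => r2 s * cos th | i2 => r2 s * sin th | i3 => z2 s end).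
  { intro i; simpl par_deriv.
    rewrite (Derive_ext _ (fun u => t_s u th i)) by (intro; apply rev_tangent_s).
    destruct i; simpl; apply is_derive_unique.
    - exact (is_derive_scal_l r1 s (r2 s) (cos th) (dr1 s)).
    - exact (is_derive_scal_l r1 s (r2 s) (sin th) (dr1 s)).
    - apply dz1. }
  assert (Est : forall i, par_deriv Ps (fun u v => tangent X Pth u v i) s th =
            match i with i1 => - (r1 s * sin th) | i2 => r1 s * cos th | i3 => 0 end).
  { intro i; simpl par_deriv.
    rewrite (Derive_ext _ (fun u => t_th u th i)) by (intro; apply rev_tangent_th).
    destruct i; simpl; apply is_derive_unique.
    - apply (is_derive_opp (fun u => r u * sin th)).
      exact (is_derive_scal_l r s (r1 s) (sin th) (dr s)).
    - exact (is_derive_scal_l r s (r1 s) (cos th) (dr s)).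
    - apply is_derive_cst. }
  assert (Ets : forall i, par_deriv Pth (fun u v => tangent X Ps u v i) s th =
            match i with i1 => - (r1 s * sin th) | i2 => r1 s * cos th | i3 => 0 end).
  { intro i; simpl par_deriv.
    rewrite (Derive_ext _ (fun v => t_s s v i)) by (intro; apply rev_tangent_s).
    destruct i; simpl; apply is_derive_unique; auto_derive; trivial; ring. }
  assert (Ett : forall i, par_deriv Pth (fun u v => tangent X Pth u v i) s th =
            match i with i1 => - (r s * cos th) | i2 => - (r s * sin th) | i3 => 0 end).
  { intro i; simpl par_deriv.
    rewrite (Derive_ext _ (fun v => t_th s v i)) by (intro; apply rev_tangent_th).
    destruct i; simpl; apply is_derive_unique; auto_derive; trivial; ring. }
  pose proof (sin2_cos2 th) as T; unfold Rsqr in T.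
  pose proof (z_pos s) as Hz.
  assert (Hc : cos th * cos th = 1 - sin th * sin th) by lra.
  unfold second_form, hyp_inner, sum3; rewrite !rev_unit_normal.
  unfold cov_deriv, sum3; rewrite !christoffel_hyp.
  unfold chr, hyp_metric; simpl coord.
  destruct al, be; rewrite ?Ess, ?Est, ?Ets, ?Ett, ?rev_tangent_s, ?rev_tangent_th;
    unfold N, t_s, t_th; simpl idx_eqb; cbv iota;
    field_simplify_eq; try lra;
    replace (cos th ^ 2) with (1 - sin th * sin th) by (simpl; lra);
    try (replace (cos th ^ 3) with (cos th * (1 - sin th * sin th))
      by (simpl; rewrite <- Hc; ring)); try ring.
Qed.

Lemma rev_second_norm2 (s th : R) : second_form_norm2 X s th =
  second_form X Ps Ps s th ^ 2 + ((z1 s + r s * r1 s / z s) / r s) ^ 2.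
Proof.
  unfold second_form_norm2, sum2; rewrite !rev_first_inv.
  rewrite (rev_second_form Ps Pth), (rev_second_form Pth Ps), (rev_second_form Pth Pth).
  pose proof (z_pos s); pose proof (r_pos s); field; lra.
Qed.

End Revolution.

(** * Hyperbolic functions *)

Lemma is_derive_cosh (x : R) : is_derive cosh x (sinh x).
Proof. apply is_derive_Reals, derivable_pt_lim_cosh. Qed.

Lemma is_derive_sinh (x : R) : is_derive sinh x (cosh x).
Proof. apply is_derive_Reals, derivable_pt_lim_sinh. Qed.

#[export] Hint Resolve is_derive_cosh is_derive_sinh : deriv.

Lemma cosh_sinh_sq (x : R) : cosh x ^ 2 - sinh x ^ 2 = 1.
Proof.
  unfold cosh, sinh.
  assert (H : exp x * exp (- x) = 1)
    by (rewrite <- exp_plus, Rplus_opp_r; apply exp_0).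
  nra.
Qed.

Lemma cosh_opp (x : R) : cosh (- x) = cosh x.
Proof. unfold cosh; rewrite Ropp_involutive; field. Qed.

Lemma sinh_opp (x : R) : sinh (- x) = - sinh x.
Proof. unfold sinh; rewrite Ropp_involutive; field. Qed.

Lemma sinh_pos (x : R) : 0 < x -> 0 < sinh x.
Proof.
  intro Hx; unfold sinh; assert (exp (- x) < exp x) by (apply exp_increasing; lra); lra.
Qed.

Lemma cosh_gt_1 (x : R) : 0 < x -> 1 < cosh x.
Proof.
  intro Hx; pose proof (sinh_pos x Hx); pose proof (cosh_sinh_sq x).
  pose proof (cosh_ge_1 x); nra.
Qed.

Lemma cosh_2 (x : R) : cosh (2 * x) = 2 * cosh x ^ 2 - 1.
Proof.
  assert (H : exp x * exp (- x) = 1)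
    by (rewrite <- exp_plus, Rplus_opp_r; apply exp_0).
  unfold cosh; replace (2 * x) with (x + x) by ring.
  rewrite Ropp_plus_distr, !exp_plus; nra.
Qed.

Lemma cosh_increasing (x y : R) : 0 <= x -> x < y -> cosh x < cosh y.
Proof.
  intros Hx Hxy; unfold cosh.
  assert (H : exp x * exp (- x) = 1)
    by (rewrite <- exp_plus, Rplus_opp_r; apply exp_0).
  assert (H' : exp y * exp (- y) = 1)
    by (rewrite <- exp_plus, Rplus_opp_r; apply exp_0).
  assert (exp x < exp y) by (apply exp_increasing; assumption).
  assert (1 <= exp x).
  { destruct (Req_dec x 0) as [->|]; [rewrite exp_0; lra|].
    rewrite <- exp_0; apply Rlt_le, exp_increasing; lra. }
  pose proof (exp_pos (- x)); pose proof (exp_pos (- y)).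
  assert (exp (- x) <= 1) by nra.
  assert (exp (- y) < 1) by nra.
  assert (exp (- x) - exp (- y) = (exp y - exp x) * (exp (- x) * exp (- y))) by nra.
  assert (exp (- x) * exp (- y) < 1) by nra.
  nra.
Qed.

Lemma sinh_ge (s : R) : 0 <= s -> s <= sinh s.
Proof.
  intro Hs.
  assert (H : sinh 0 - 0 <= sinh s - s).
  { apply (le_of_derive_le (fun s => sinh s - s) (fun s => cosh s - 1)); [assumption| |].
    - intros x _; der.
    - intros x _; pose proof (cosh_ge_1 x); lra. }
  rewrite sinh_0 in H; lra.
Qed.

(** * The geometry of the catenoids *)

Section Catenoid.

Variable a : R.
Hypothesis a_pos : 0 < a.

Local Notation c := (cosh (2 * a)).
Local Notation sn := (sinh (2 * a)).
Local Notation X := (Y0 a).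

(** [sinh (y0 a s)]; as [s] is the arc length of the profile, this is both the length of
    the circle of parameter [s] divided by 2 pi and the area density of (s, th). *)
Definition rad (s : R) : R := sqrt ((cosh (2 * a) * cosh (2 * s) - 1) / 2).

(** [cosh (y0 a s)] *)
Definition crad (s : R) : R := sqrt ((cosh (2 * a) * cosh (2 * s) + 1) / 2).

(** The derivative of [rad ^ 2 / 2]. *)
Definition slope (s : R) : R := cosh (2 * a) * sinh (2 * s) / 2.

(** The coefficient of order zero of the Jacobi operator, - (Ric (N, N) + |A|^2). *)
Definition pot (s : R) : R := 2 - sinh (2 * a) ^ 2 / (2 * rad s ^ 4).

Local Notation g := rad.
Local Notation p := crad.
Local Notation D := slope.
Local Notation q := pot.

Lemma c_gt_1 : 1 < c.
Proof. apply cosh_gt_1; lra. Qed.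

Lemma c_pos : 0 < c.
Proof. pose proof c_gt_1; lra. Qed.

Lemma sn_pos : 0 < sn.
Proof. apply sinh_pos; lra. Qed.

Lemma c_sn : c ^ 2 = sn ^ 2 + 1.
Proof. pose proof (cosh_sinh_sq (2 * a)); lra. Qed.

Lemma C_ge (s : R) : c <= c * cosh (2 * s).
Proof. pose proof c_gt_1; pose proof (cosh_ge_1 (2 * s)); nra. Qed.

Lemma g_pos (s : R) : 0 < g s.
Proof. pose proof c_gt_1; pose proof (C_ge s); apply sqrt_lt_R0; lra. Qed.

Lemma p_pos (s : R) : 0 < p s.
Proof. pose proof c_gt_1; pose proof (C_ge s); apply sqrt_lt_R0; lra. Qed.

Lemma g_sq (s : R) : 2 * g s ^ 2 = c * cosh (2 * s) - 1.
Proof.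
  pose proof c_gt_1; pose proof (C_ge s).
  unfold rad; rewrite pow2_sqrt by lra; lra.
Qed.

Lemma p_sq (s : R) : 2 * p s ^ 2 = c * cosh (2 * s) + 1.
Proof.
  pose proof c_gt_1; pose proof (C_ge s).
  unfold crad; rewrite pow2_sqrt by lra; lra.
Qed.

Lemma p_g (s : R) : p s ^ 2 = 1 + g s ^ 2.
Proof. pose proof (g_sq s); pose proof (p_sq s); lra. Qed.

Lemma C_pg (s : R) : c * cosh (2 * s) = p s ^ 2 + g s ^ 2.
Proof. pose proof (g_sq s); pose proof (p_sq s); lra. Qed.

Lemma D_sq (s : R) : D s ^ 2 = p s ^ 2 * g s ^ 2 - sn ^ 2 / 4.
Proof.
  pose proof (g_sq s); pose proof (p_sq s); pose proof c_sn.
  pose proof (cosh_sinh_sq (2 * s)) as E.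
  replace (p s ^ 2) with ((c * cosh (2 * s) + 1) / 2) by lra.
  replace (g s ^ 2) with ((c * cosh (2 * s) - 1) / 2) by lra.
  unfold slope; replace (sn ^ 2) with (c ^ 2 - 1) by lra.
  replace ((c * sinh (2 * s) / 2) ^ 2) with (c ^ 2 * sinh (2 * s) ^ 2 / 4) by field.
  replace (sinh (2 * s) ^ 2) with (cosh (2 * s) ^ 2 - 1) by lra.
  field.
Qed.

#[local] Hint Resolve g_pos p_pos c_pos sn_pos : pos.

Lemma is_derive_g (s : R) : is_derive g s (D s / g s).
Proof.
  pose proof c_gt_1; pose proof (C_ge s).
  unfold rad; evar_last; [der; lra|fold (g s); unfold slope; field; pos_tac].
Qed.

Lemma is_derive_p (s : R) : is_derive p s (D s / p s).
Proof.
  pose proof c_gt_1; pose proof (C_ge s).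
  unfold crad; evar_last; [der; lra|fold (p s); unfold slope; field; pos_tac].
Qed.

Lemma is_derive_D (s : R) : is_derive D s (p s ^ 2 + g s ^ 2).
Proof. rewrite <- C_pg; unfold slope; evar_last; [der|field]. Qed.

#[local] Hint Resolve is_derive_g is_derive_p is_derive_D : deriv.

Lemma smooth_g : smooth g.
Proof. unfold rad; smooth_tac; pose proof (C_ge x); pose proof c_gt_1; lra. Qed.

Lemma smooth_p : smooth p.
Proof. unfold crad; smooth_tac; pose proof (C_ge x); pose proof c_gt_1; lra. Qed.

Lemma smooth_D : smooth D.
Proof. unfold slope; smooth_tac. Qed.

Lemma smooth_pot : smooth q.
Proof. pose proof smooth_g; unfold pot; smooth_tac. Qed.

#[local] Hint Resolve smooth_g smooth_p smooth_D smooth_pot : smooth.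

Lemma g_cont (s : R) : continuous g s.
Proof. cont_tac. Qed.

Lemma g_even (s : R) : g (- s) = g s.
Proof. unfold rad; replace (2 * - s) with (- (2 * s)) by ring; rewrite cosh_opp; reflexivity. Qed.

Lemma D_odd (s : R) : D (- s) = - D s.
Proof. unfold slope; replace (2 * - s) with (- (2 * s)) by ring; rewrite sinh_opp; field. Qed.

Lemma D_pos (s : R) : 0 < s -> 0 < D s.
Proof.
  intro Hs; pose proof c_gt_1; pose proof (sinh_pos (2 * s) ltac:(lra)).
  unfold slope; nra.
Qed.

Lemma D_0 : D 0 = 0.
Proof. pose proof (D_odd 0) as H; rewrite Ropp_0 in H; lra. Qed.

Lemma sqrt2_J0 (t : R) : sqrt 2 * J0 a t = sn / (2 * p t ^ 2 * g t).
Proof.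
  pose proof (g_pos t).
  unfold J0; rewrite <- (p_sq t), <- (g_sq t).
  rewrite sqrt_mult, sqrt_pow2 by (try apply pow2_ge_0; lra); field; pos_tac.
Qed.

Lemma smooth_J0 : smooth (J0 a).
Proof.
  replace (J0 a) with (fun t => / sqrt 2 * (sn / (2 * p t ^ 2 * g t))); [smooth_tac|].
  apply functional_extensionality; intro t; rewrite <- sqrt2_J0; field; pos_tac.
Qed.

Lemma is_derive_RInt_smooth (f : R -> R) (s : R) : smooth f ->
  is_derive (fun s => RInt f 0 s) s (f s).
Proof.
  intro Hf; apply (is_derive_RInt f (fun s => RInt f 0 s) 0 s).
  - exists (mkposreal 1 Rlt_0_1); intros y _.
    apply (RInt_correct (V := R_CompleteNormedModule)), ex_RInt_cont.
    intro; apply smooth_continuous, Hf.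
  - apply smooth_continuous, Hf.
Qed.

Lemma is_derive_Lambda0 (s : R) :
  is_derive (Lambda0 a) s (sn / (2 * p s ^ 2 * g s)).
Proof.
  rewrite <- sqrt2_J0; unfold Lambda0.
  apply (is_derive_scal (fun s => RInt (J0 a) 0 s)).
  apply is_derive_RInt_smooth, smooth_J0.
Qed.

Lemma smooth_Lambda0 : smooth (Lambda0 a).
Proof.
  apply smooth_of_derive with (fun s => sqrt 2 * J0 a s).
  - intro s; rewrite sqrt2_J0; apply is_derive_Lambda0.
  - pose proof smooth_J0; smooth_tac.
Qed.

Lemma Lambda0_increasing (s t : R) : s < t -> Lambda0 a s < Lambda0 a t.
Proof.
  intro Hst.
  destruct (MVT_gen (Lambda0 a) s t (fun s => sn / (2 * p s ^ 2 * g s))) as [x [_ E]].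
  - intros; apply is_derive_Lambda0.
  - intros; apply continuity_pt_filterlim, smooth_continuous, smooth_Lambda0.
  - assert (0 < sn / (2 * p x ^ 2 * g x)); [|nra].
    pose proof (g_pos x); pose proof (p_pos x); pose proof sn_pos.
    apply Rdiv_lt_0_compat; [assumption|].
    repeat apply Rmult_lt_0_compat; try lra; apply pow_lt; assumption.
Qed.

Lemma cosh_y0 (s : R) : cosh (y0 a s) = p s.
Proof.
  destruct (y0_spec a s a_pos) as [H1 H2].
  pose proof (cosh_ge_1 (y0 a s)).
  unfold crad; rewrite <- H2, cosh_2.
  replace ((2 * cosh (y0 a s) ^ 2 - 1 + 1) / 2) with (cosh (y0 a s) ^ 2) by field.
  symmetry; apply sqrt_pow2; lra.
Qed.

Lemma sinh_y0 (s : R) : sinh (y0 a s) = g s.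
Proof.
  destruct (y0_spec a s a_pos) as [H1 H2].
  pose proof (sinh_pos (y0 a s) ltac:(lra)); pose proof (cosh_sinh_sq (y0 a s)).
  unfold rad; rewrite <- H2, cosh_2.
  replace ((2 * cosh (y0 a s) ^ 2 - 1 - 1) / 2) with (sinh (y0 a s) ^ 2) by lra.
  symmetry; apply sqrt_pow2; lra.
Qed.

Definition prof_r (s : R) : R := exp (Lambda0 a s) * (g s / p s).
Definition prof_z (s : R) : R := exp (Lambda0 a s) / p s.
Definition prof_r1 (s : R) : R :=
  exp (Lambda0 a s) * ((sn / 2 + D s / g s) / p s ^ 3).
Definition prof_z1 (s : R) : R :=
  exp (Lambda0 a s) * ((sn / (2 * g s) - D s) / p s ^ 3).

Lemma Y0_revolution :
  Y0 a = fun s th => (prof_r s * cos th, prof_r s * sin th, prof_z s).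
Proof.
  apply functional_extensionality; intro s; apply functional_extensionality; intro th.
  unfold Y0, prof_r, prof_z, tanh; rewrite cosh_y0, sinh_y0; reflexivity.
Qed.

Lemma prof_r_pos (s : R) : 0 < prof_r s.
Proof.
  apply Rmult_lt_0_compat; [apply exp_pos|].
  apply Rdiv_lt_0_compat; [apply g_pos|apply p_pos].
Qed.

Lemma prof_z_pos (s : R) : 0 < prof_z s.
Proof. apply Rdiv_lt_0_compat; [apply exp_pos|apply p_pos]. Qed.

#[local] Hint Resolve is_derive_Lambda0 is_derive_cosh is_derive_sinh : deriv.

Lemma is_derive_prof_r (s : R) : is_derive prof_r s (prof_r1 s).
Proof.
  unfold prof_r; evar_last; [der|].
  unfold prof_r1; set (L := exp _); clearbody L.
  transitivity (L * ((sn / 2 + D s * (p s ^ 2 - g s ^ 2) / g s) / p s ^ 3));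
    [field; pos_tac|rewrite p_g; field; pos_tac].
Qed.

Lemma is_derive_prof_z (s : R) : is_derive prof_z s (prof_z1 s).
Proof.
  unfold prof_z; evar_last; [der|].
  unfold prof_z1; set (L := exp _); clearbody L; field; pos_tac.
Qed.

Lemma prof_unit_speed (s : R) : prof_r1 s ^ 2 + prof_z1 s ^ 2 = prof_z s ^ 2.
Proof.
  pose proof (g_pos s); pose proof (p_pos s); pose proof (p_g s) as E.
  pose proof (D_sq s) as HD.
  unfold prof_r1, prof_z1, prof_z; set (L := exp _); clearbody L.
  transitivity (L ^ 2 * (sn ^ 2 / 4 + D s ^ 2) * (1 + g s ^ 2) / (g s ^ 2 * p s ^ 6));
    [field; lra|].
  rewrite HD, <- E; field; lra.
Qed.

Definition prof_r2 (s : R) : R :=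
  sn / (2 * p s ^ 2 * g s) * prof_r1 s + exp (Lambda0 a s) *
  (((p s ^ 2 + g s ^ 2) / g s - D s ^ 2 / g s ^ 3) / p s ^ 3
   - 3 * D s * (sn / 2 + D s / g s) / p s ^ 5).

Definition prof_z2 (s : R) : R :=
  sn / (2 * p s ^ 2 * g s) * prof_z1 s + exp (Lambda0 a s) *
  ((- sn * D s / (2 * g s ^ 3) - (p s ^ 2 + g s ^ 2)) / p s ^ 3
   - 3 * D s * (sn / (2 * g s) - D s) / p s ^ 5).

Lemma is_derive_prof_r1 (s : R) : is_derive prof_r1 s (prof_r2 s).
Proof.
  unfold prof_r1; evar_last; [der|].
  unfold prof_r2, prof_r1; set (L := exp _); clearbody L; simpl INR; simpl pred; field; pos_tac.
Qed.

Lemma is_derive_prof_z1 (s : R) : is_derive prof_z1 s (prof_z2 s).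
Proof.
  unfold prof_z1; evar_last; [der|].
  unfold prof_z2, prof_z1; set (L := exp _); clearbody L; simpl INR; simpl pred; field; pos_tac.
Qed.

Lemma Y0_sqrt_det (s th : R) : sqrt (first_form_det (Y0 a) s th) = g s.
Proof.
  rewrite Y0_revolution, (rev_sqrt_det prof_r prof_z prof_r1 prof_z1)
    by (apply is_derive_prof_r || apply is_derive_prof_z || apply prof_z_pos
        || apply prof_r_pos || apply prof_unit_speed).
  pose proof (p_pos s); pose proof (exp_pos (Lambda0 a s)).
  unfold prof_r, prof_z; field; lra.
Qed.

Lemma Y0_first_inv (al be : par) (s th : R) : first_form_inv (Y0 a) al be s th =
  match al, be with Ps, Ps => 1 | Pth, Pth => / g s ^ 2 | _, _ => 0 end.
Proof.
  rewrite Y0_revolution, (rev_first_inv prof_r prof_z prof_r1 prof_z1)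
    by (apply is_derive_prof_r || apply is_derive_prof_z || apply prof_z_pos
        || apply prof_r_pos || apply prof_unit_speed).
  pose proof (p_pos s); pose proof (g_pos s); pose proof (exp_pos (Lambda0 a s)).
  destruct al, be; try reflexivity.
  unfold prof_r, prof_z; field; lra.
Qed.

(** The Ricci curvature is -2 in all directions, and the principal curvatures are
    sinh (2 a) / (2 g^2) along the circles and the opposite along the profiles. *)
Lemma Y0_potential (s th : R) :
  ricci (Y0 a s th) (unit_normal (Y0 a) s th) (unit_normal (Y0 a) s th)
  + second_form_norm2 (Y0 a) s th = - pot s.
Proof.
  rewrite Y0_revolution.
  rewrite (rev_ricci prof_r prof_z prof_r1 prof_z1)
    by (apply is_derive_prof_r || apply is_derive_prof_z || apply prof_z_pos
        || apply prof_r_pos || apply prof_unit_speed).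
  rewrite (rev_second_norm2 prof_r prof_z prof_r1 prof_z1 prof_r2 prof_z2)
    by (apply is_derive_prof_r || apply is_derive_prof_z || apply prof_z_pos
        || apply prof_r_pos || apply prof_unit_speed
        || apply is_derive_prof_r1 || apply is_derive_prof_z1).
  rewrite (rev_second_form prof_r prof_z prof_r1 prof_z1 prof_r2 prof_z2)
    by (apply is_derive_prof_r || apply is_derive_prof_z || apply prof_z_pos
        || apply prof_r_pos || apply prof_unit_speed
        || apply is_derive_prof_r1 || apply is_derive_prof_z1).
  pose proof (p_pos s) as Hp; pose proof (g_pos s) as Hg; pose proof (p_g s) as E.
  pose proof (D_sq s) as HD.
  assert (Htt : (prof_z1 s + prof_r s * prof_r1 s / prof_z s) / prof_r s
                = sn / (2 * g s ^ 2)).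
  { unfold prof_r1, prof_z1, prof_r, prof_z.
    pose proof (exp_pos (Lambda0 a s)); set (L := exp _) in *; clearbody L.
    transitivity (sn * (1 + g s ^ 2) / (2 * g s ^ 2 * p s ^ 2)); [field; lra|].
    rewrite <- E; field; lra. }
  assert (Hss : (- prof_z1 s * (prof_r2 s - 2 * prof_r1 s * prof_z1 s / prof_z s)
     + prof_r1 s * (prof_z2 s + (prof_r1 s ^ 2 - prof_z1 s ^ 2) / prof_z s)) / prof_z s ^ 2
                = - sn / (2 * g s ^ 2)).
  { pose proof (prof_z_pos s).
    transitivity ((prof_r1 s * prof_z2 s - prof_z1 s * prof_r2 s
      + prof_r1 s * (prof_r1 s ^ 2 + prof_z1 s ^ 2) / prof_z s) / prof_z s ^ 2);
      [field; lra|].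
    rewrite prof_unit_speed.
    unfold prof_r2, prof_z2, prof_r1, prof_z1, prof_z.
    pose proof (exp_pos (Lambda0 a s)); set (L := exp _) in *; clearbody L.
    transitivity (- (D s / g s ^ 3) * (sn ^ 2 / 4 + D s ^ 2) / p s ^ 4
      - sn * (p s ^ 2 + g s ^ 2) / 2 * (1 + g s ^ 2) / (g s ^ 2 * p s ^ 4)
      + (sn / 2 + D s / g s) / p s ^ 2); [field; lra|].
    rewrite HD, <- E; field; lra. }
  rewrite Htt, Hss; unfold pot; field; lra.
Qed.

(** The radius [r] and the height [z] of a point of the profile satisfy
    r^2 + z^2 = exp (2 Lambda0 a s), and [Lambda0 a] is increasing. *)
Lemma Y0_inj (s th s' th' : R) : X s th = X s' th' ->
  s = s' /\ cos th = cos th' /\ sin th = sin th'.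
Proof.
  rewrite Y0_revolution; intro H; injection H as H1 H2 H3.
  pose proof (prof_r_pos s) as R1; pose proof (prof_r_pos s') as R2.
  assert (Hr : prof_r s = prof_r s').
  { assert (E : prof_r s ^ 2 = prof_r s' ^ 2); [|nra].
    pose proof (sin2_cos2 th) as T; pose proof (sin2_cos2 th') as T'; unfold Rsqr in *.
    transitivity ((prof_r s * cos th) ^ 2 + (prof_r s * sin th) ^ 2); [nra|].
    rewrite H1, H2; nra. }
  assert (Hs : s = s').
  { assert (E : forall u, prof_r u ^ 2 + prof_z u ^ 2 = exp (Lambda0 a u) ^ 2).
    { intro u; pose proof (p_pos u); pose proof (p_g u) as Eu.
      unfold prof_r, prof_z.
      transitivity (exp (Lambda0 a u) ^ 2 * (1 + g u ^ 2) / crad u ^ 2); [field; lra|].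
      rewrite <- Eu; field; lra. }
    assert (EL : exp (Lambda0 a s) = exp (Lambda0 a s')).
    { pose proof (exp_pos (Lambda0 a s)); pose proof (exp_pos (Lambda0 a s')).
      pose proof (E s) as E1; pose proof (E s') as E2; rewrite Hr, H3 in E1; nra. }
    apply exp_inv in EL.
    destruct (Rtotal_order s s') as [Hlt|[He|Hgt]]; [|assumption|].
    - pose proof (Lambda0_increasing s s' Hlt); lra.
    - pose proof (Lambda0_increasing s' s Hgt); lra. }
  rewrite Hr in H1, H2; split; [assumption|split].
  - apply Rmult_eq_reg_l with (prof_r s'); lra.
  - apply Rmult_eq_reg_l with (prof_r s'); lra.
Qed.

Lemma Y0_angle (s th th' : R) : cos th = cos th' -> sin th = sin th' -> X s th = X s th'.
Proof. intros Hc Hs; unfold Y0; rewrite Hc, Hs; reflexivity. Qed.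

Lemma Y0_periodic (s th : R) : X s (th + 2 * PI) = X s th.
Proof.
  apply Y0_angle;
    [rewrite cos_plus, cos_2PI, sin_2PI|rewrite sin_plus, cos_2PI, sin_2PI]; ring.
Qed.

(** * The Jacobi form as an energy *)

(** Multiplication by the area density puts the operator in divergence form. *)
Lemma jacobi_op_Y0 (F : R -> R -> R) (s th : R) : smooth2 F ->
  jacobi_op X F s th * sqrt (first_form_det X s th) =
  g s * q s * F s th - (D s / g s * ds F s th + g s * ds (ds F) s th)
  - dt (dt F) s th / g s.
Proof.
  intro HF; pose proof (g_pos s) as Hg.
  assert (E1 : par_deriv Ps (fun u v => sqrt (first_form_det X u v) *
      sum2 (fun be => first_form_inv X Ps be u v * par_deriv be F u v)) s th
      = D s / g s * ds F s th + g s * ds (ds F) s th).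
  { simpl par_deriv; rewrite (Derive_ext _ (fun u => g u * ds F u th)).
    - apply is_derive_unique, (Derive.is_derive_mult g (fun u => ds F u th)); [apply is_derive_g|].
      apply (smooth2_is_ds (ds F)), smooth2_ds, HF.
    - intro u; unfold sum2; rewrite Y0_sqrt_det, !Y0_first_inv.
      simpl par_deriv; unfold ds; ring. }
  assert (E2 : par_deriv Pth (fun u v => sqrt (first_form_det X u v) *
      sum2 (fun be => first_form_inv X Pth be u v * par_deriv be F u v)) s th
      = dt (dt F) s th / g s).
  { simpl par_deriv; rewrite (Derive_ext _ (fun v => / g s * dt F s v)).
    - apply is_derive_unique.
      replace (dt (dt F) s th / g s) with (/ g s * dt (dt F) s th) by (field; lra).
      apply (is_derive_scal (fun v => dt F s v)).
      apply (smooth2_is_dt (dt F)), smooth2_dt, HF.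
    - intro v; unfold sum2; rewrite Y0_sqrt_det, !Y0_first_inv.
      simpl par_deriv; unfold dt; field; lra. }
  unfold jacobi_op; rewrite Y0_potential.
  unfold laplacian; unfold sum2 at 1; rewrite E1, E2, Y0_sqrt_det.
  field; lra.
Qed.

(** The contribution of the circle of parameter [s] to the Jacobi form, integrated by parts. *)
Definition energy (F : R -> R -> R) (s : R) : R :=
  RInt (fun th => g s * ds F s th ^ 2 + dt F s th ^ 2 / g s + g s * q s * F s th ^ 2)
    0 (2 * PI).

Lemma c2_pow2 (H : R -> R -> R) : c2 H -> c2 (fun s th => H s th ^ 2).
Proof.
  intros h s th; apply continuity_2d_pt_ext with (fun s th => H s th * H s th);
    [intros; ring|apply c2_mult; assumption].
Qed.

Ltac c2_tac :=
  unfold Rdiv;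
  repeat lazymatch goal with
    | |- c2 (fun s th => @?H s th + @?K s th) => apply (c2_plus H K)
    | |- c2 (fun s th => @?H s th - @?K s th) => apply (c2_minus H K)
    | |- c2 (fun s th => @?H s th * @?K s th) => apply (c2_mult H K)
    | |- c2 (fun s th => @?H s th ^ 2) => apply (c2_pow2 H)
    | |- c2 (fun s th => ?H s th) => match goal with h : c2 H |- _ => exact h end
    | |- c2 (fun s th => @?f s) => apply (c2_fst f); intro; cont_tac
    end.

Lemma c2_energy_density (F : R -> R -> R) : smooth2 F ->
  c2 (fun s th => g s * ds F s th ^ 2 + dt F s th ^ 2 / g s + g s * q s * F s th ^ 2).
Proof.
  intro HF; pose proof (smooth2_c2 _ HF); pose proof (smooth2_c2 _ (smooth2_ds _ HF)).
  pose proof (smooth2_c2 _ (smooth2_dt _ HF)); c2_tac.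
Qed.

Lemma energy_continuous (F : R -> R -> R) (s : R) : smooth2 F -> continuous (energy F) s.
Proof.
  intro HF; pose proof PI_RGT_0.
  apply (c2_RInt_continuous _ 0 (2 * PI) s ltac:(lra) (c2_energy_density F HF)).
Qed.

Lemma dt_periodic (F : R -> R -> R) (s th : R) : smooth2 F ->
  (forall th, F s (th + 2 * PI) = F s th) -> dt F s (th + 2 * PI) = dt F s th.
Proof.
  intros HF Hp; rewrite <- (is_derive_unique _ _ _ (smooth2_is_dt F s th HF)); symmetry.
  apply is_derive_unique.
  apply is_derive_ext with (fun v => F s (v + 2 * PI)); [intro; apply Hp|].
  replace (dt F s (th + 2 * PI)) with (scal 1 (dt F s (th + 2 * PI)))
    by (unfold scal; simpl; unfold mult; simpl; ring).
  apply (is_derive_comp (F s) (fun v => v + 2 * PI)); [apply smooth2_is_dt, HF|].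
  evar_last; [der|ring].
Qed.

Section Wave.

Variable F : R -> R -> R.
Hypothesis F_smooth : smooth2 F.
Hypothesis F_periodic : forall s th, F s (th + 2 * PI) = F s th.

Let cF : c2 F := smooth2_c2 _ F_smooth.
Let cFs : c2 (ds F) := smooth2_c2 _ (smooth2_ds _ F_smooth).
Let cFt : c2 (dt F) := smooth2_c2 _ (smooth2_dt _ F_smooth).
Let cFss : c2 (ds (ds F)) := smooth2_c2 _ (smooth2_ds _ (smooth2_ds _ F_smooth)).
Let cFtt : c2 (dt (dt F)) := smooth2_c2 _ (smooth2_dt _ (smooth2_dt _ F_smooth)).

Let J (s th : R) : R := F s th * (g s * q s * F s th
  - (D s / g s * ds F s th + g s * ds (ds F) s th) - dt (dt F) s th / g s).

Lemma jacobi_density (s th : R) :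
  F s th * jacobi_op X F s th * sqrt (first_form_det X s th) = J s th.
Proof. rewrite Rmult_assoc, jacobi_op_Y0 by assumption; reflexivity. Qed.

Lemma c2_jacobi_density : c2 J.
Proof.
  unfold J; c2_tac.
Qed.

Lemma RInt_angular_parts (s : R) :
  RInt (fun th => F s th * dt (dt F) s th) 0 (2 * PI)
  = - RInt (fun th => dt F s th ^ 2) 0 (2 * PI).
Proof.
  pose proof PI_RGT_0 as Hpi.
  assert (C0 := fun th => c2_th F s th cF).
  assert (C1 := fun th => c2_th _ s th cFt).
  assert (C2 := fun th => c2_th _ s th cFtt).
  assert (E := RInt_FTC (fun th => F s th * dt F s th)
    (fun th => dt F s th * dt F s th + F s th * dt (dt F) s th) 0 (2 * PI) ltac:(lra)).
  assert (E' := RInt_lin (fun th => F s th * dt (dt F) s th) (fun th => dt F s th ^ 2)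
    1 1 0 (2 * PI)).
  rewrite (RInt_ext _ (fun th => dt F s th * dt F s th + F s th * dt (dt F) s th))
    in E' by (intros; simpl; ring).
  rewrite E in E'.
  - pose proof (F_periodic s 0) as P0.
    pose proof (dt_periodic F s 0 F_smooth (F_periodic s)) as P1.
    rewrite Rplus_0_l in P0, P1; rewrite P0, P1 in E'.
    specialize (E' ltac:(apply ex_RInt_cont; intro; cont_tac)
                   ltac:(apply ex_RInt_cont; intro; cont_tac)).
    toR; lra.
  - intros th _; apply (Derive.is_derive_mult (F s) (dt F s));
      [apply smooth2_is_dt, F_smooth|apply smooth2_is_dt, smooth2_dt, F_smooth].
  - intros th _; cont_tac.
Qed.

(** Integration by parts on a circle: the angular terms cancel by periodicity, the others
    leave the derivative of the integral of [g F F_s]. *)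
Lemma is_derive_boundary (s : R) :
  is_derive (fun s => RInt (fun th => g s * (F s th * ds F s th)) 0 (2 * PI)) s
    (energy F s - RInt (J s) 0 (2 * PI)).
Proof.
  pose proof PI_RGT_0 as Hpi; pose proof (g_pos s) as Hg.
  assert (C0 := fun th => c2_th F s th cF).
  assert (C1 := fun th => c2_th _ s th cFs).
  assert (C2 := fun th => c2_th _ s th cFss).
  assert (C3 := fun th => c2_th _ s th cFt).
  assert (C4 := fun th => c2_th _ s th cFtt).
  set (K := fun s th => D s / g s * (F s th * ds F s th)
    + g s * (ds F s th * ds F s th + F s th * ds (ds F) s th)).
  replace (energy F s - RInt (J s) 0 (2 * PI)) with (RInt (K s) 0 (2 * PI)).
  - apply (is_derive_RInt_c2 (fun s th => g s * (F s th * ds F s th)) K).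
    + lra.
    + intros u th; apply (Derive.is_derive_mult g (fun u => F u th * ds F u th));
        [apply is_derive_g|].
      apply (Derive.is_derive_mult (fun u => F u th) (fun u => ds F u th));
        [apply smooth2_is_ds, F_smooth|apply (smooth2_is_ds (ds F)), smooth2_ds, F_smooth].
    + c2_tac.
    + unfold K; c2_tac.
  - assert (EE : energy F s - RInt (J s) 0 (2 * PI)
      = RInt (fun th => 1 * K s th + / g s * (1 * (dt F s th ^ 2)
             + 1 * (F s th * dt (dt F) s th))) 0 (2 * PI)).
    { unfold energy; set (e := fun th => _).
      transitivity (RInt (fun th => 1 * e th + (-1) * J s th) 0 (2 * PI)).
      - rewrite RInt_lin; [toR; ring| |].
        + apply ex_RInt_cont; intro; unfold e; cont_tac.
        + apply c2_ex_RInt, c2_jacobi_density.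
      - apply RInt_ext; intros th _; unfold e, K, J.
        simpl; field; lra. }
    rewrite EE, RInt_lin, RInt_lin, RInt_angular_parts; [symmetry; toR; ring|..];
      apply ex_RInt_cont; intro; unfold K; cont_tac.
Qed.

Lemma RInt_jacobi_energy (x1 x2 : R) : x1 <= x2 ->
  (forall s th, s <= x1 \/ x2 <= s -> F s th = 0) ->
  RInt (fun s => RInt (J s) 0 (2 * PI)) x1 x2 = RInt (energy F) x1 x2.
Proof.
  intros H12 Hout; pose proof PI_RGT_0.
  assert (Hc : forall s, continuous (fun s => RInt (J s) 0 (2 * PI)) s)
    by (intro; apply c2_RInt_continuous; [lra|apply c2_jacobi_density]).
  assert (He := fun s => energy_continuous F s F_smooth).
  assert (E := RInt_FTC _ _ x1 x2 H12 (fun s _ => is_derive_boundary s)).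
  cbv beta in E; rewrite (RInt_eq_0 (fun th => g x2 * (F x2 th * ds F x2 th)) 0 (2 * PI)) in E.
  rewrite (RInt_eq_0 (fun th => g x1 * (F x1 th * ds F x1 th)) 0 (2 * PI)) in E.
  - assert (E' := RInt_lin (energy F) (fun s => RInt (J s) 0 (2 * PI)) 1 (-1) x1 x2
      ltac:(apply ex_RInt_cont, He) ltac:(apply ex_RInt_cont, Hc)).
    rewrite (RInt_ext _ (fun s => energy F s - RInt (J s) 0 (2 * PI))) in E'
      by (intros; simpl; ring).
    rewrite E in E'; [toR; lra|].
    intros s _; cont_tac; apply Hc.
  - intros t _; cbv beta; rewrite Hout by lra; ring.
  - intros t _; cbv beta; rewrite Hout by lra; ring.
Qed.

End Wave.

Lemma jacobi_form_energy (f : pt -> R) (x1 x2 : R) : x1 <= x2 ->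
  smooth2 (fun s th => f (X s th)) ->
  (forall s th, s <= x1 \/ x2 <= s -> f (X s th) = 0) ->
  jacobi_form X f = RInt (energy (fun s th => f (X s th))) x1 x2.
Proof.
  intros H12 HF Hout; pose proof PI_RGT_0.
  set (F := fun s th => f (X s th)) in *.
  assert (Hper : forall s th, F s (th + 2 * PI) = F s th)
    by (intros; unfold F; rewrite Y0_periodic; reflexivity).
  rewrite <- (RInt_jacobi_energy F HF Hper x1 x2 H12 Hout).
  unfold jacobi_form; rewrite (RInt_gen_compact _ x1 x2 H12).
  - apply RInt_ext; intros s _; apply RInt_ext; intros th _.
    apply (jacobi_density F HF).
  - intro s; eapply continuous_ext; [|apply c2_RInt_continuous].
    + intro u; apply RInt_ext; intros th _; symmetry; apply (jacobi_density F HF).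
    + lra.
    + apply c2_jacobi_density, HF.
  - intros s Hs; apply RInt_eq_0; intros th _.
    rewrite Hout by assumption; ring.
Qed.

(** * Test functions *)

Lemma test_function_wave (U : pt -> Prop) (f : pt -> R) : test_function X U f ->
  smooth2 (fun s th => f (X s th)) /\
  exists K : R * R -> Prop, closed K /\ bounded_set K /\
    (forall s th, K (s, th) -> U (X s th)) /\
    (forall s th, f (X s th) <> 0 -> exists t, K (s, t) /\ X s th = X s t) /\
    (forall p, f p <> 0 -> exists s th, p = X s th).
Proof.
  intros [Hs [K [H1 [H2 [H3 H4]]]]]; split; [exact Hs|].
  assert (Hn : forall p, f p <> 0 -> exists q, K q /\ p = X (fst q) (snd q)).
  { intros p Hp; apply NNPP; intro Hno; apply Hp, H4; intros q Hq E; apply Hno; eauto. }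
  exists K; repeat split; [assumption|assumption| | |].
  - intros s th HK; apply (H3 (s, th) HK).
  - intros s th Hf; destruct (Hn _ Hf) as [[s' t] [HK E]]; simpl in E.
    destruct (Y0_inj _ _ _ _ E) as [<- _]; exists t; split; assumption.
  - intros p Hp; destruct (Hn p Hp) as [[s t] [_ E]]; exists s, t; exact E.
Qed.

Lemma test_function_bounded (U : pt -> Prop) (f : pt -> R) : test_function X U f ->
  exists B, 0 < B /\ forall s th, s <= - B \/ B <= s -> f (X s th) = 0.
Proof.
  intro Hf; destruct (test_function_wave U f Hf) as [_ [K [_ [[B HB] [_ [HK _]]]]]].
  exists (Rabs B + 1); pose proof (Rabs_pos B); pose proof (Rle_abs B).
  split; [lra|intros s th Hs; apply NNPP; intro Hn].
  destruct (HK s th Hn) as [t [Ht _]]; destruct (HB _ Ht) as [Hb _]; simpl in Hb.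
  apply Rabs_le_between in Hb; lra.
Qed.

(** The function on the surface defined by a function of the parameters, through a choice
    of parameters for each point; the choice is harmless if [F s th] depends on [th] only
    through [cos th] and [sin th]. *)
Definition push (F : R -> R -> R) (p : pt) : R :=
  match excluded_middle_informative (exists q : R * R, p = X (fst q) (snd q)) with
  | left H => let q := proj1_sig (constructive_indefinite_description _ H) in F (fst q) (snd q)
  | right _ => 0
  end.

Lemma push_X (F : R -> R -> R) (s th : R) :
  (forall s th th', cos th = cos th' -> sin th = sin th' -> F s th = F s th') ->
  push F (X s th) = F s th.
Proof.
  intro HF; unfold push.
  destruct (excluded_middle_informative _) as [H|H].
  - destruct (constructive_indefinite_description _ H) as [[s' t] E]; simpl in *.
    destruct (Y0_inj _ _ _ _ E) as [<- [Hc Hs]]; symmetry; apply HF; assumption.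
  - exfalso; apply H; exists (s, th); reflexivity.
Qed.

Lemma push_test (U : pt -> Prop) (F : R -> R -> R) (K : R * R -> Prop) :
  (forall s th th', cos th = cos th' -> sin th = sin th' -> F s th = F s th') ->
  smooth2 F -> closed K -> bounded_set K ->
  (forall s th, K (s, th) -> U (X s th)) ->
  (forall s th, F s th <> 0 ->
     exists t, K (s, t) /\ cos t = cos th /\ sin t = sin th) ->
  test_function X U (push F).
Proof.
  intros HF Hs H1 H2 H3 H4; split.
  - intros n s th.
    replace (fun u v => push F (X u v)) with F; [apply Hs|].
    apply functional_extensionality; intro u; apply functional_extensionality; intro v.
    symmetry; apply push_X, HF.
  - exists K; split; [assumption|split; [assumption|split]].
    + intros [s th]; apply H3.
    + intros p Hp.
      destruct (classic (exists q : R * R, p = X (fst q) (snd q))) as [[[s th] E]|Hno].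
      * simpl in E; rewrite E, (push_X F s th HF); apply NNPP; intro Hn.
        destruct (H4 s th Hn) as [t [Ht [Ec Es]]].
        apply (Hp (s, t) Ht); rewrite E; simpl; apply Y0_angle; auto.
      * unfold push; destruct (excluded_middle_informative _); [contradiction|reflexivity].
Qed.

(** * Lower bounds for the energy *)

(** Rotation invariant Jacobi fields, with their derivative. *)
Definition jacobi_sol (u u1 : R -> R) : Prop :=
  (forall s, is_derive u s (u1 s)) /\
  (forall s, is_derive (fun s => g s * u1 s) s (g s * q s * u s)).

(** The logarithmic derivative, times [rad], of 1 / (cosh (y0 a s) sinh (y0 a s)). *)
Definition Tw (s : R) : R := - (D s * (p s ^ 2 + g s ^ 2)) / (p s ^ 2 * g s).

Definition Tw1 (s : R) : R :=
  - ((p s ^ 2 + g s ^ 2) ^ 2 + 4 * D s ^ 2) / (p s ^ 2 * g s)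
  + D s ^ 2 * (p s ^ 2 + g s ^ 2) * (2 * g s ^ 2 + p s ^ 2) / (p s ^ 4 * g s ^ 3).

Lemma is_derive_Tw (s : R) : is_derive Tw s (Tw1 s).
Proof. unfold Tw; evar_last; [der|simpl; unfold Tw1; field; pos_tac]. Qed.

(** This Riccati inequality says that 1 / (cosh y0 sinh y0) is a supersolution for the
    Fourier modes of order 1.  Multiplied by p^4 g^3 and expressed with G = g^2 and d = D^2,
    it reads d G (4 G + 1) <= G^2 (1 + G) (4 G + 3), where d <= p^2 g^2 = G (1 + G). *)
Lemma Tw_super (s : R) : Tw1 s + Tw s ^ 2 / g s <= g s * q s + / g s.
Proof.
  pose proof (g_pos s) as Hg; pose proof (p_pos s) as Hp.
  pose proof (D_sq s) as HD; pose proof (p_g s) as E.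
  set (G := g s ^ 2) in *; set (d := D s ^ 2) in *.
  assert (HG : 0 < G) by (apply pow_lt; assumption).
  assert (Hd : d <= G * (1 + G)) by (rewrite HD, E; pose proof (pow2_ge_0 sn); nra).
  assert (HS : sn ^ 2 = 4 * G * (1 + G) - 4 * d) by (rewrite HD, E; field).
  assert (Hgap : g s * q s + / g s - (Tw1 s + Tw s ^ 2 / g s)
     = G * (G * (1 + G) * (4 * G + 3) - d * (4 * G + 1)) / (p s ^ 4 * g s ^ 3)).
  { transitivity ((g s ^ 2 * 2 - sn ^ 2 / (2 * g s ^ 2) + 1) / g s
      + ((p s ^ 2 + g s ^ 2) ^ 2 + 4 * D s ^ 2) / (p s ^ 2 * g s)
      - D s ^ 2 * (p s ^ 2 + g s ^ 2) * (2 * g s ^ 2 + p s ^ 2) / (p s ^ 4 * g s ^ 3)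
      - D s ^ 2 * (p s ^ 2 + g s ^ 2) ^ 2 / (p s ^ 4 * g s ^ 3));
      [unfold pot, Tw1, Tw; field; lra|].
    fold G d; rewrite HS.
    replace (p s ^ 4) with ((1 + G) ^ 2) by (rewrite <- E; ring).
    replace (g s ^ 3) with (G * g s) by (unfold G; ring).
    rewrite E; field; lra. }
  assert (0 <= G * (G * (1 + G) * (4 * G + 3) - d * (4 * G + 1)) / (p s ^ 4 * g s ^ 3));
    [|lra].
  apply Rmult_le_pos; [|apply Rlt_le, Rinv_0_lt_compat, Rmult_lt_0_compat;
                         apply pow_lt; assumption].
  apply Rmult_le_pos; [lra|]; nra.
Qed.

Section Wave.

Variable F : R -> R -> R.
Hypothesis F_smooth : smooth2 F.
Hypothesis F_periodic : forall s th, F s (th + 2 * PI) = F s th.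

Definition circ (H K : R -> R -> R) (s : R) : R :=
  RInt (fun th => H s th * K s th) 0 (2 * PI).

Definition mean (H : R -> R -> R) (s : R) : R := RInt (H s) 0 (2 * PI).

Let cF : c2 F := smooth2_c2 _ F_smooth.
Let cFs : c2 (ds F) := smooth2_c2 _ (smooth2_ds _ F_smooth).
Let cFt : c2 (dt F) := smooth2_c2 _ (smooth2_dt _ F_smooth).

Lemma circ_continuous (H K : R -> R -> R) (s : R) : c2 H -> c2 K ->
  continuous (circ H K) s.
Proof.
  intros HH HK; pose proof PI_RGT_0.
  apply (c2_RInt_continuous (fun s th => H s th * K s th)); [lra|apply c2_mult; assumption].
Qed.

Lemma mean_continuous (H : R -> R -> R) (s : R) : c2 H -> continuous (mean H) s.
Proof. intro HH; pose proof PI_RGT_0; apply (c2_RInt_continuous H); [lra|assumption]. Qed.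

Lemma is_derive_circ (s : R) : is_derive (circ F F) s (2 * circ F (ds F) s).
Proof.
  pose proof PI_RGT_0.
  replace (2 * circ F (ds F) s)
    with (RInt (fun th => ds F s th * F s th + F s th * ds F s th) 0 (2 * PI)).
  - apply (is_derive_RInt_c2 (fun s th => F s th * F s th)
      (fun s th => ds F s th * F s th + F s th * ds F s th)).
    + lra.
    + intros u th; apply (Derive.is_derive_mult (fun u => F u th) (fun u => F u th));
        apply smooth2_is_ds, F_smooth.
    + apply c2_mult; apply cF.
    + apply c2_plus; apply c2_mult; (apply cF || apply cFs).
  - pose proof (c2_ex_RInt _ s 0 (2 * PI) (c2_mult _ _ cF cFs)) as He.
    transitivity (RInt (fun th => 1 * (F s th * ds F s th) + 1 * (F s th * ds F s th))
                    0 (2 * PI)).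
    + apply RInt_ext; intros; toR; ring.
    + rewrite RInt_lin by exact He; unfold circ; toR; ring.
Qed.

Lemma is_derive_mean (s : R) : is_derive (mean F) s (mean (ds F) s).
Proof.
  pose proof PI_RGT_0; apply (is_derive_RInt_c2 F (ds F)); [lra| |apply cF|apply cFs].
  intros; apply smooth2_is_ds, F_smooth.
Qed.

Lemma energy_circ (s : R) : energy F s =
  g s * circ (ds F) (ds F) s + / g s * circ (dt F) (dt F) s + g s * q s * circ F F s.
Proof.
  assert (C0 := fun th => c2_th F s th cF).
  assert (C1 := fun th => c2_th _ s th cFs).
  assert (C2 := fun th => c2_th _ s th cFt).
  unfold energy.
  transitivity (RInt (fun th => 1 * (g s * (ds F s th * ds F s th)
     + / g s * (dt F s th * dt F s th)) + g s * q s * (F s th * F s th)) 0 (2 * PI)).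
  - apply RInt_ext; intros; toR; simpl; unfold Rdiv; ring.
  - rewrite !RInt_lin by (apply ex_RInt_cont; intro; cont_tac).
    unfold circ; toR; ring.
Qed.

(** Cauchy-Schwarz for [ds F - x F] on a circle. *)
Lemma circ_quadratic (x s : R) :
  (mean (ds F) s - x * mean F s) ^ 2 / (2 * PI)
  <= circ (ds F) (ds F) s - 2 * x * circ F (ds F) s + x ^ 2 * circ F F s.
Proof.
  assert (C0 := fun th => c2_th F s th cF).
  assert (C1 := fun th => c2_th _ s th cFs).
  assert (H := RInt_2PI_cauchy_schwarz (fun th => 1 * ds F s th + (- x) * F s th)
    ltac:(intro; cont_tac)).
  rewrite RInt_lin in H by (apply ex_RInt_cont; intro; cont_tac).
  rewrite (RInt_ext (fun t => (1 * ds F s t + - x * F s t) * (1 * ds F s t + - x * F s t))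
    (fun th => 1 * (1 * (ds F s th * ds F s th) + (- 2 * x) * (F s th * ds F s th))
       + x ^ 2 * (F s th * F s th))) in H by (intros; simpl; ring).
  rewrite !RInt_lin in H by (apply ex_RInt_cont; intro; cont_tac).
  unfold mean, circ.
  replace (RInt (ds F s) 0 (2 * PI) - x * RInt (F s) 0 (2 * PI))
    with (1 * RInt (ds F s) 0 (2 * PI) + - x * RInt (F s) 0 (2 * PI)) by (toR; ring).
  lra.
Qed.

Lemma circ_wirtinger (s : R) :
  circ F F s - mean F s ^ 2 / (2 * PI) <= circ (dt F) (dt F) s.
Proof.
  assert (C2 := fun th => c2_th _ s th cFt).
  pose proof (wirtinger (F s) (dt F s) (fun t => smooth2_is_dt F s t F_smooth) C2
    (F_periodic s)) as H.
  unfold circ, mean.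
  rewrite (RInt_ext (fun th => F s th * F s th) (fun th => F s th ^ 2))
    by (intros; simpl; ring).
  rewrite (RInt_ext (fun th => dt F s th * dt F s th) (fun th => dt F s th ^ 2))
    by (intros; simpl; ring).
  exact H.
Qed.

Lemma circ_mean (s : R) : mean F s ^ 2 / (2 * PI) <= circ F F s.
Proof.
  apply (RInt_2PI_cauchy_schwarz (F s)); intro; apply c2_th, cF.
Qed.

Section Solution.

Variables (u u1 : R -> R) (x1 x2 : R).
Hypothesis u_sol : jacobi_sol u u1.
Hypothesis x12 : x1 <= x2.
Hypothesis u_pos : forall s, x1 <= s <= x2 -> 0 < u s.

Let T (s : R) : R := g s * u1 s / u s.

Lemma is_derive_riccati (s : R) : x1 <= s <= x2 ->
  is_derive T s (g s * q s - T s ^ 2 / g s).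
Proof.
  intro Hs; pose proof (u_pos s Hs); pose proof (g_pos s).
  destruct u_sol as [H1 H2]; unfold T; evar_last.
  - apply (is_derive_div (fun s => g s * u1 s) u); [apply H2|apply H1|lra].
  - field; lra.
Qed.

(** Completion of squares with two Riccati functions, [T] for the mean values of [F] on the
    circles and [Tw] for the rest, to which Wirtinger's inequality applies and provides the
    term [/ g] of the Riccati inequality for [Tw].  Only boundary terms remain. *)
Lemma energy_lower_bound :
  let b s := Tw s * (circ F F s - mean F s ^ 2 / (2 * PI)) + T s * (mean F s ^ 2 / (2 * PI))
  in b x2 - b x1 <= RInt (energy F) x1 x2.
Proof.
  intro b; pose proof PI_RGT_0 as Hpi.
  set (b1 := fun s =>
    (Tw1 s * (circ F F s - mean F s ^ 2 / (2 * PI))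
     + Tw s * (2 * circ F (ds F) s - 2 * mean F s * mean (ds F) s / (2 * PI)))
    + ((g s * q s - T s ^ 2 / g s) * (mean F s ^ 2 / (2 * PI))
       + T s * (2 * mean F s * mean (ds F) s / (2 * PI)))).
  assert (Hm2 : forall s, is_derive (fun s => mean F s ^ 2 / (2 * PI)) s
                  (2 * mean F s * mean (ds F) s / (2 * PI))).
  { intro s; replace (2 * mean F s * mean (ds F) s / (2 * PI))
      with ((INR 2 * mean (ds F) s * mean F s ^ Init.Nat.pred 2) * / (2 * PI))
      by (simpl; field; lra).
    apply (is_derive_scal_l (fun s => mean F s ^ 2) s _ (/ (2 * PI))).
    apply is_derive_pow, is_derive_mean. }
  assert (Hb : forall s, x1 <= s <= x2 -> is_derive b s (b1 s)).
  { intros s Hs; unfold b, b1.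
    pose proof (is_derive_riccati s Hs) as HT; pose proof (is_derive_circ s) as HA.
    apply is_derive_plusR;
      [apply (Derive.is_derive_mult Tw (fun s => circ F F s - mean F s ^ 2 / (2 * PI)))
      |apply (Derive.is_derive_mult T (fun s => mean F s ^ 2 / (2 * PI)))]; auto.
    - apply is_derive_Tw.
    - apply (is_derive_minusR (circ F F)); auto. }
  assert (Hc : forall s, x1 <= s <= x2 -> continuous b1 s).
  { intros s Hs.
    pose proof (is_derive_continuous _ _ _ (is_derive_riccati s Hs)) as c1.
    assert (c2' : continuous Tw s) by (unfold Tw; cont_tac).
    assert (c3 : continuous Tw1 s) by (unfold Tw1; cont_tac).
    pose proof (circ_continuous F F s cF cF) as c4.
    pose proof (circ_continuous F (ds F) s cF cFs) as c5.
    pose proof (mean_continuous F s cF) as c6.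
    pose proof (mean_continuous (ds F) s cFs) as c7.
    clearbody T; unfold b1; cont_tac. }
  rewrite <- (RInt_FTC b b1 x1 x2 x12 Hb Hc).
  apply RInt_le; [assumption| |apply ex_RInt_cont; intro; apply energy_continuous; assumption|].
  - apply (ex_RInt_continuous (V := R_CompleteNormedModule)).
    intros z Hz; rewrite Rmin_left, Rmax_right in Hz by assumption; apply Hc, Hz.
  - intros s Hs; rewrite energy_circ.
    pose proof (circ_quadratic (Tw s / g s) s) as Q.
    pose proof (circ_wirtinger s) as W; pose proof (circ_mean s) as M.
    pose proof (Tw_super s) as U; pose proof (g_pos s) as Hg.
    unfold b1.
    set (A := circ F F s) in *; set (B := circ F (ds F) s) in *.
    set (C := circ (ds F) (ds F) s) in *; set (W2 := circ (dt F) (dt F) s) in *.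
    set (m := mean F s) in *; set (m1 := mean (ds F) s) in *.
    set (t := Tw s) in *; set (t1 := Tw1 s) in *; set (y := T s) in *.
    set (gs := g s) in *; set (qs := q s) in *; clearbody A B C W2 m m1 t t1 y gs qs.
    assert (P1 : t1 * (A - m ^ 2 / (2 * PI))
                 <= (gs * qs + / gs - t ^ 2 / gs) * (A - m ^ 2 / (2 * PI)))
      by (apply Rmult_le_compat_r; lra).
    assert (P2 : / gs * (A - m ^ 2 / (2 * PI)) <= / gs * W2)
      by (apply Rmult_le_compat_l; [apply Rlt_le, Rinv_0_lt_compat|]; lra).
    assert (P3 : 0 <= gs * ((m1 - y / gs * m) ^ 2 / (2 * PI))).
    { apply Rmult_le_pos; [lra|]; apply Rmult_le_pos; [apply pow2_ge_0|].
      apply Rlt_le, Rinv_0_lt_compat; lra. }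
    apply Rmult_le_compat_l with (r := gs) in Q; [|lra].
    replace (gs * ((m1 - t / gs * m) ^ 2 / (2 * PI)))
      with (gs * (m1 ^ 2 / (2 * PI)) - t * (2 * m * m1 / (2 * PI))
            + t ^ 2 / gs * (m ^ 2 / (2 * PI))) in Q by (field; lra).
    replace (gs * (C - 2 * (t / gs) * B + (t / gs) ^ 2 * A))
      with (gs * C - 2 * t * B + t ^ 2 / gs * A) in Q by (field; lra).
    replace (gs * ((m1 - y / gs * m) ^ 2 / (2 * PI)))
      with (gs * (m1 ^ 2 / (2 * PI)) - y * (2 * m * m1 / (2 * PI))
            + y ^ 2 / gs * (m ^ 2 / (2 * PI))) in P3 by (field; lra).
    lra.
Qed.

End Solution.

(** If [u > 0] everywhere, the energy is, up to a derivative, the integral of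
    [g (F_s - F u' / u)^2 + F_th^2 / g].  Were this zero, [F / u] would not depend on [s],
    and [F] would vanish. *)
Lemma energy_pos (u u1 : R -> R) (x1 x2 s0 th0 : R) : jacobi_sol u u1 ->
  (forall s, 0 < u s) -> (forall s, continuous u1 s) -> x1 < x2 ->
  (forall s th, s <= x1 \/ x2 <= s -> F s th = 0) ->
  0 <= th0 <= 2 * PI -> F s0 th0 <> 0 ->
  0 < RInt (energy F) x1 x2.
Proof.
  intros u_sol Hu cu1 H12 Hout Hth0 Hne; pose proof PI_RGT_0 as Hpi.
  set (T := fun s => g s * u1 s / u s).
  assert (HT : forall s, is_derive T s (g s * q s - T s ^ 2 / g s)).
  { intro s; apply (is_derive_riccati u u1 s s u_sol); [|lra].
    intros; apply Hu. }
  set (b1 := fun s => (g s * q s - T s ^ 2 / g s) * circ F F s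
                      + T s * (2 * circ F (ds F) s)).
  assert (Hb : forall s, is_derive (fun s => T s * circ F F s) s (b1 s)).
  { intro s; apply (Derive.is_derive_mult T (circ F F)); [apply HT|apply is_derive_circ]. }
  assert (cT : forall s, continuous T s)
    by (intro s; eapply is_derive_continuous, HT).
  assert (cb1 : forall s, continuous b1 s).
  { intro s; pose proof (circ_continuous F F s cF cF).
    pose proof (circ_continuous F (ds F) s cF cFs).
    clearbody T; unfold b1; cont_tac. }
  assert (cE := fun s => energy_continuous F s F_smooth).
  assert (E := RInt_FTC _ _ x1 x2 (Rlt_le _ _ H12) (fun s _ => Hb s) (fun s _ => cb1 s)).
  cbv beta in E.
  assert (Z : forall s, s <= x1 \/ x2 <= s -> circ F F s = 0).
  { intros s Hs; apply RInt_eq_0; intros th _; rewrite Hout by assumption; ring. }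
  rewrite !Z in E by lra.
  assert (E' := RInt_lin (energy F) b1 1 (-1) x1 x2
    ltac:(apply ex_RInt_cont, cE) ltac:(apply ex_RInt_cont, cb1)).
  rewrite E in E'.
  replace (RInt (energy F) x1 x2)
    with (RInt (fun s => 1 * energy F s + -1 * b1 s) x1 x2) by (toR; lra).
  assert (Hrem : forall s, 1 * energy F s + -1 * b1 s =
     g s * (circ (ds F) (ds F) s - 2 * (u1 s / u s) * circ F (ds F) s
            + (u1 s / u s) ^ 2 * circ F F s) + / g s * circ (dt F) (dt F) s).
  { intro s; rewrite energy_circ; unfold b1, T.
    pose proof (g_pos s); pose proof (Hu s); field; lra. }
  assert (Hqf : forall s, circ (ds F) (ds F) s - 2 * (u1 s / u s) * circ F (ds F) s
            + (u1 s / u s) ^ 2 * circ F F s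
     = RInt (fun th => (ds F s th - u1 s / u s * F s th) ^ 2) 0 (2 * PI)).
  { intro s; assert (C0 := fun th => c2_th F s th cF).
    assert (C1 := fun th => c2_th _ s th cFs).
    rewrite (RInt_ext (fun th => (ds F s th - u1 s / u s * F s th) ^ 2)
      (fun th => 1 * (1 * (ds F s th * ds F s th) + (- 2 * (u1 s / u s))
         * (F s th * ds F s th)) + (u1 s / u s) ^ 2 * (F s th * F s th)))
      by (intros; toR; simpl; ring).
    rewrite !RInt_lin by (apply ex_RInt_cont; intro; cont_tac).
    unfold circ; toR; ring. }
  assert (Ht2 : forall s, 0 <= / g s * circ (dt F) (dt F) s).
  { intro s; apply Rmult_le_pos; [apply Rlt_le, Rinv_0_lt_compat, g_pos|].
    apply RInt_nonneg; [lra| |intros; nra].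
    intro th; pose proof (c2_th _ s th cFt); cont_tac. }
  assert (Hq0 : forall s, 0 <= RInt (fun th => (ds F s th - u1 s / u s * F s th) ^ 2)
                          0 (2 * PI)).
  { intro s; apply RInt_nonneg; [lra| |intros; apply pow2_ge_0].
    intro th; pose proof (c2_th F s th cF); pose proof (c2_th _ s th cFs); cont_tac. }
  assert (Hex : exists s, x1 <= s <= x2 /\
            ds F s th0 - u1 s / u s * F s th0 <> 0).
  { apply NNPP; intro Hno; apply Hne.
    assert (Hall : forall s, ds F s th0 = u1 s / u s * F s th0).
    { intro s; destruct (Rle_lt_dec x1 s) as [H1|H1]; [destruct (Rle_lt_dec s x2) as [H2|H2]|].
      - apply NNPP; intro Hn; apply Hno; exists s; split; [lra|]; intro Hz; apply Hn; lra.
      - rewrite Hout, Rmult_0_r by lra; apply is_derive_unique.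
        apply is_derive_ext_loc with (fun _ => 0); [|apply is_derive_cst].
        exists (mkposreal (s - x2) ltac:(lra)); intros y Hy.
        apply Rabs_lt_between' in Hy; simpl in Hy; symmetry; apply Hout; lra.
      - rewrite Hout, Rmult_0_r by lra; apply is_derive_unique.
        apply is_derive_ext_loc with (fun _ => 0); [|apply is_derive_cst].
        exists (mkposreal (x1 - s) ltac:(lra)); intros y Hy.
        apply Rabs_lt_between' in Hy; simpl in Hy; symmetry; apply Hout; lra. }
    assert (Hd : forall s, is_derive (fun s => F s th0 / u s) s 0).
    { intro s; pose proof (Hu s); evar_last.
      - apply is_derive_div; [apply smooth2_is_ds, F_smooth|apply (proj1 u_sol)|lra].
      - rewrite Hall; field; lra. }
    assert (Hz : F s0 th0 / u s0 = 0).
    { destruct (Rle_lt_dec s0 x1) as [H1|H1]; [rewrite Hout by lra; unfold Rdiv; ring|].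
      transitivity (F x1 th0 / u x1); [|rewrite Hout by lra; unfold Rdiv; ring].
      symmetry; apply (eq_is_derive (fun s => F s th0 / u s)); [|assumption].
      intros; apply Hd. }
    pose proof (Hu s0); apply Rmult_eq_reg_r with (/ u s0); [|apply Rinv_neq_0_compat; lra].
    rewrite Rmult_0_l; exact Hz. }
  destruct Hex as [s [Hs Hns]].
  apply (RInt_pos _ x1 x2 s).
  - assumption.
  - intro y; cont_tac.
  - intros y _; rewrite Hrem, Hqf.
    apply Rplus_le_le_0_compat; [|apply Ht2].
    apply Rmult_le_pos; [apply Rlt_le, g_pos|apply Hq0].
  - assumption.
  - rewrite Hrem, Hqf; apply Rplus_lt_le_0_compat; [|apply Ht2].
    apply Rmult_lt_0_compat; [apply g_pos|].
    apply (RInt_pos _ 0 (2 * PI) th0).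
    + lra.
    + intro th; pose proof (c2_th F s th cF); pose proof (c2_th _ s th cFs); cont_tac.
    + intros; apply pow2_ge_0.
    + assumption.
    + apply pow2_gt_0, Hns.
Qed.

End Wave.

(** * Rotation invariant Jacobi fields *)

Lemma D_sq_g (s : R) : D s ^ 2 = g s ^ 2 * (1 + g s ^ 2) - (c ^ 2 - 1) / 4.
Proof. rewrite D_sq, p_g, c_sn; field. Qed.

Lemma is_derive_D_g (s : R) : is_derive D s (1 + 2 * g s ^ 2).
Proof.
  replace (1 + 2 * g s ^ 2) with (p s ^ 2 + g s ^ 2) by (rewrite p_g; ring).
  apply is_derive_D.
Qed.

Lemma pot_g (s : R) : q s = 2 - (c ^ 2 - 1) / (2 * g s ^ 4).
Proof. unfold pot; rewrite c_sn; f_equal; f_equal; ring. Qed.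

(** The normal component of the translations along the axis. *)
Definition vfield (s : R) : R := D s / g s.
Definition vfield1 (s : R) : R := (1 + 2 * g s ^ 2) / g s - D s ^ 2 / g s ^ 3.

(** [sqrt 2 * I0 a], as an expression in [rad]. *)
Definition ldens (s : R) : R :=
  c / ((1 + g s ^ 2) * g s)
  - (c ^ 2 - 1) * (1 + 2 * g s ^ 2) * (1 + 3 * g s ^ 2) / (4 * c * (1 + g s ^ 2) ^ 2 * g s ^ 3).

(** The derivative of [Lambda0] with respect to [a]. *)
Definition lint (s : R) : R := RInt ldens 0 s.

(** - cosh (y0) (d Lambda0 / ds) (d y0 / da) *)
Definition bfield (s : R) : R :=
  - ((c ^ 2 - 1) * (1 + 2 * g s ^ 2)) / (4 * c * ((1 + g s ^ 2) * g s ^ 2)).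
Definition bfield1 (s : R) : R :=
  - ((c ^ 2 - 1) * (4 * D s)) / (4 * c * ((1 + g s ^ 2) * g s ^ 2))
  + (c ^ 2 - 1) * (1 + 2 * g s ^ 2) * (2 * D s * (1 + 2 * g s ^ 2))
    / (4 * c * ((1 + g s ^ 2) * g s ^ 2) ^ 2).

(** The normal component of the derivative of [Y0] with respect to [a]. *)
Definition efield (s : R) : R := vfield s * lint s + bfield s.
Definition efield1 (s : R) : R := vfield1 s * lint s + vfield s * ldens s + bfield1 s.

Lemma sqrt2_I0 (t : R) : sqrt 2 * I0 a t = ldens t.
Proof.
  pose proof (g_pos t) as Hg; pose proof (p_pos t) as Hp.
  pose proof c_gt_1 as Hc; pose proof (C_ge t) as HC.
  pose proof (g_sq t) as EG.
  assert (H2 : 0 < sqrt 2) by (apply sqrt_lt_R0; lra).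
  assert (Hk := cosh_ge_1 (2 * t)).
  assert (Esq : sqrt (c * cosh (2 * t) - 1) = sqrt 2 * g t).
  { rewrite <- EG, sqrt_mult, sqrt_pow2 by (try apply pow2_ge_0; lra); reflexivity. }
  assert (EC : c * cosh (2 * t) = 1 + 2 * g t ^ 2) by lra.
  unfold I0; erewrite is_derive_unique.
  2:{ unfold J0; der. }
  cbv beta; rewrite Esq.
  unfold ldens; replace (cosh (2 * t)) with ((1 + 2 * g t ^ 2) / c) by (rewrite <- EC; field; lra).
  replace (c * ((1 + 2 * g t ^ 2) / c)) with (1 + 2 * g t ^ 2) by (field; lra).
  pose proof (sqrt_sqrt 2 ltac:(lra)) as E2.
  pose proof c_sn as ES.
  set (r2 := sqrt 2) in *; set (G := g t) in *; clearbody r2 G.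
  assert (HG2 : 0 < 1 + G ^ 2) by (pose proof (pow2_ge_0 G); lra).
  rewrite ES; field_simplify_eq; [|pos_tac].
  replace (r2 ^ 2) with 2 by (rewrite <- E2; ring); ring.
Qed.

Lemma smooth_ldens : smooth ldens.
Proof. unfold ldens; smooth_tac. Qed.

#[local] Hint Resolve smooth_ldens : smooth.

Lemma is_derive_lint (s : R) : is_derive lint s (ldens s).
Proof. apply is_derive_RInt_smooth, smooth_ldens. Qed.

#[local] Hint Resolve is_derive_lint : deriv.

Lemma lint_0 : lint 0 = 0.
Proof. unfold lint; rewrite RInt_point; reflexivity. Qed.

Lemma lint_odd (s : R) : lint (- s) = - lint s.
Proof.
  assert (Hd : forall t, is_derive (fun t => lint (- t) + lint t) t 0).
  { intro t; evar_last.
    - apply is_derive_plusR; [apply (is_derive_compR lint (fun t => - t)); der|der].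
    - unfold ldens; rewrite g_even; ring. }
  assert (H : forall t, lint (- t) + lint t = 0); [|specialize (H s); lra].
  assert (H0 : lint (- 0) + lint 0 = 0) by (rewrite Ropp_0, lint_0; ring).
  intro t; destruct (Rtotal_order t 0) as [Ht|[->|Ht]]; [|assumption|].
  - rewrite <- H0; apply (eq_is_derive (fun t => lint (- t) + lint t)); auto.
  - rewrite <- H0; symmetry; apply (eq_is_derive (fun t => lint (- t) + lint t)); auto.
Qed.

Lemma is_derive_vfield (s : R) : is_derive vfield s (vfield1 s).
Proof.
  pose proof (g_pos s); unfold vfield; evar_last.
  - apply is_derive_div; [apply is_derive_D_g|apply is_derive_g|lra].
  - unfold vfield1; field; lra.
Qed.

#[local] Hint Resolve is_derive_vfield : deriv.

Lemma is_derive_bfield (s : R) : is_derive bfield s (bfield1 s).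
Proof. unfold bfield; evar_last; [der|simpl; unfold bfield1; field; pos_tac]. Qed.

#[local] Hint Resolve is_derive_bfield : deriv.

Lemma is_derive_efield (s : R) : is_derive efield s (efield1 s).
Proof. unfold efield; evar_last; [der|unfold efield1; ring]. Qed.

#[local] Hint Resolve is_derive_efield : deriv.

Lemma vfield_sol : jacobi_sol vfield vfield1.
Proof.
  split; [apply is_derive_vfield|intro s].
  pose proof (g_pos s).
  apply is_derive_ext with (fun s => 1 + 2 * g s ^ 2 - D s ^ 2 / g s ^ 2).
  { intro t; pose proof (g_pos t); unfold vfield1; toR; field; lra. }
  evar_last; [der|].
  simpl pred; simpl INR; rewrite pot_g, p_g; unfold vfield.
    field_simplify_eq; [|lra].
    replace (D s ^ 3) with (D s * D s ^ 2) by ring; rewrite D_sq_g; field.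
Qed.

(** The terms of [rad * efield1] which do not contain [lint]. *)
Lemma efield_rest (s : R) : D s * ldens s + g s * bfield1 s
  = D s / (c * (1 + g s ^ 2) * g s)
    + (c ^ 2 - 1) * (1 + 2 * g s ^ 2) * D s / (4 * c * (1 + g s ^ 2) * g s ^ 3).
Proof.
  unfold ldens, bfield1; field; pos_tac.
Qed.

Lemma efield_sol : jacobi_sol efield efield1.
Proof.
  split; [apply is_derive_efield|intro s].
  apply is_derive_ext with (fun s => g s * vfield1 s * lint s
    + (D s / (c * (1 + g s ^ 2) * g s)
    + (c ^ 2 - 1) * (1 + 2 * g s ^ 2) * D s / (4 * c * (1 + g s ^ 2) * g s ^ 3))).
  { intro t; rewrite <- efield_rest; pose proof (g_pos t).
    unfold efield1; toR; unfold vfield; field; lra. }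
  evar_last.
  - apply is_derive_plusR; [apply (Derive.is_derive_mult _ lint s);
      [apply vfield_sol|apply is_derive_lint]|der].
  - simpl pred; simpl INR; rewrite pot_g, p_g; unfold efield, vfield, vfield1, bfield, ldens.
    set (L := lint s); clearbody L.
    field_simplify_eq; [|pos_tac].
    replace (D s ^ 2) with (g s ^ 2 * (1 + g s ^ 2) - (c ^ 2 - 1) / 4)
      by (symmetry; apply D_sq_g).
    field.
Qed.

(** As for any two solutions of (g u')' = g q u, this expression is constant; its sign makes
    the quotient of the two fields monotone. *)
Lemma wronskian (s : R) : g s * (efield1 s * vfield s - efield s * vfield1 s) = c.
Proof.
  unfold efield, efield1, vfield, vfield1, bfield, bfield1, ldens.
  set (L := lint s); clearbody L.
  field_simplify_eq; [|pos_tac].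
  replace (D s ^ 2) with (g s ^ 2 * (1 + g s ^ 2) - (c ^ 2 - 1) / 4)
    by (symmetry; apply D_sq_g).
  field.
Qed.

Lemma vfield_odd (s : R) : vfield (- s) = - vfield s.
Proof.
  pose proof (g_pos s).
  unfold vfield; rewrite g_even, D_odd; field; lra.
Qed.

Lemma efield_even (s : R) : efield (- s) = efield s.
Proof.
  unfold efield; rewrite vfield_odd, lint_odd; unfold bfield; rewrite g_even; ring.
Qed.

Lemma vfield_pos (s : R) : 0 < s -> 0 < vfield s.
Proof.
  intro Hs; apply Rdiv_lt_0_compat; [apply D_pos|apply g_pos]; assumption.
Qed.

Lemma efield_0 : efield 0 < 0.
Proof.
  unfold efield; rewrite lint_0, Rmult_0_r, Rplus_0_l.
  pose proof c_gt_1.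
  unfold bfield; rewrite Rdiv_opp_l; apply Ropp_lt_gt_0_contravar.
  pos_tac.
Qed.

Lemma smooth_vfield : smooth vfield.
Proof. unfold vfield; smooth_tac. Qed.

Lemma smooth_lint : smooth lint.
Proof. apply smooth_of_derive with ldens; [apply is_derive_lint|apply smooth_ldens]. Qed.

#[local] Hint Resolve smooth_vfield smooth_lint : smooth.

Lemma smooth_efield : smooth efield.
Proof. unfold efield, bfield; smooth_tac. Qed.

#[local] Hint Resolve smooth_efield : smooth.

(** * Behaviour of the Jacobi fields at infinity *)

Local Notation v := vfield.
Local Notation v1 := vfield1.
Local Notation e := efield.
Local Notation e1 := efield1.

Lemma g_ge (s : R) : 0 <= s -> s <= g s.
Proof.
  intro Hs; pose proof (g_pos s); pose proof (g_sq s) as E.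
  pose proof c_gt_1; pose proof (cosh_ge_1 (2 * s)).
  pose proof (cosh_2 s) as E2; pose proof (cosh_sinh_sq s); pose proof (sinh_ge s Hs).
  assert (s ^ 2 <= g s ^ 2) by nra; nra.
Qed.

Lemma v_sq (s : R) : v s ^ 2 = 1 + g s ^ 2 - (c ^ 2 - 1) / (4 * g s ^ 2).
Proof.
  pose proof (g_pos s); unfold vfield.
  replace ((D s / g s) ^ 2) with (D s ^ 2 / g s ^ 2) by (field; lra).
  rewrite D_sq_g; field; lra.
Qed.

Lemma v_ge_g (s : R) : c <= s -> g s <= v s.
Proof.
  intro Hs; pose proof c_gt_1; pose proof (g_ge s ltac:(lra)).
  pose proof (vfield_pos s ltac:(lra)); pose proof (v_sq s) as E.
  assert ((c ^ 2 - 1) / (4 * g s ^ 2) <= 1); [|nra].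
  apply Rmult_le_reg_r with (4 * g s ^ 2); [pos_tac|].
  replace ((c ^ 2 - 1) / (4 * g s ^ 2) * (4 * g s ^ 2)) with (c ^ 2 - 1) by (field; lra).
  nra.
Qed.

Lemma v_le (s : R) : v s ^ 2 <= 1 + g s ^ 2.
Proof.
  pose proof c_gt_1; rewrite v_sq.
  assert (0 < (c ^ 2 - 1) / (4 * g s ^ 2)) by pos_tac; lra.
Qed.

Lemma ldens_bound (s : R) : Rabs (ldens s) <= 3 * c / g s ^ 3.
Proof.
  pose proof (g_pos s); pose proof c_gt_1; unfold ldens.
  set (G := g s) in *; clearbody G.
  assert (H1 : 0 <= c / ((1 + G ^ 2) * G) <= c / G ^ 3).
  { split; [apply Rlt_le; pos_tac|].
    apply Rmult_le_compat_l; [lra|]; apply Rinv_le_contravar; [pos_tac|nra]. }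
  assert (H2 : 0 <= (c ^ 2 - 1) * (1 + 2 * G ^ 2) * (1 + 3 * G ^ 2)
                    / (4 * c * (1 + G ^ 2) ^ 2 * G ^ 3) <= 2 * c / G ^ 3).
  { split; [apply Rlt_le; pos_tac|].
    replace (2 * c / G ^ 3)
      with (8 * c ^ 2 * (1 + G ^ 2) ^ 2 / (4 * c * (1 + G ^ 2) ^ 2 * G ^ 3))
      by (field; pos_tac).
    apply Rmult_le_compat_r; [apply Rlt_le; pos_tac|].
    replace (8 * c ^ 2 * (1 + G ^ 2) ^ 2) with (c ^ 2 * (8 * (1 + G ^ 2) ^ 2)) by ring.
    rewrite Rmult_assoc.
    apply Rmult_le_compat; nra. }
  replace (3 * c / G ^ 3) with (c / G ^ 3 + 2 * c / G ^ 3) by (field; lra).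
  apply Rabs_le_between; lra.
Qed.

Lemma is_derive_inv_g3 (k s : R) :
  is_derive (fun s => k / g s ^ 3) s (- (3 * k * v s / g s ^ 4)).
Proof. evar_last; [der|simpl; unfold vfield; field; pos_tac]. Qed.

#[local] Hint Resolve is_derive_inv_g3 : deriv.

Lemma inv_g3_le (k s : R) : 0 <= k -> c <= s -> 0 <= k / g s ^ 3 <= k / s.
Proof.
  intros Hk Hs; pose proof c_gt_1; pose proof (g_ge s ltac:(lra)).
  split; [apply Rmult_le_pos; [assumption|apply Rlt_le; pos_tac]|].
  apply Rmult_le_compat_l; [assumption|]; apply Rinv_le_contravar; [lra|].
  assert (s ^ 3 <= g s ^ 3) by (apply pow_incr; lra).
  assert (s <= s ^ 3) by nra; lra.
Qed.

(** For large [s], [ldens] is bounded by 3 c / g^3, which is at most minus the derivative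
    of c / g^3, so that lint - c / g^3 increases and lint + c / g^3 decreases. *)
Lemma lint_lim : exists l : R, is_lim lint p_infty l.
Proof.
  pose proof c_gt_1 as Hc.
  assert (Hv : forall s, c <= s -> 3 * c / g s ^ 3 <= 3 * c * v s / g s ^ 4).
  { intros s Hs; pose proof (v_ge_g s Hs); pose proof (g_pos s).
    replace (3 * c / g s ^ 3) with (3 * c * g s / g s ^ 4) by (field; lra).
    apply Rmult_le_compat_r; [apply Rlt_le; pos_tac|nra]. }
  destruct (increasing_is_lim (fun s => lint s - c / g s ^ 3) c
             (lint c + c / g c ^ 3)) as [l Hl].
  - intros s t Hs Hst.
    apply (le_of_derive_le (fun s => lint s - c / g s ^ 3)
      (fun s => ldens s - - (3 * c * v s / g s ^ 4)));
      [assumption| |].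
    + intros x _; apply is_derive_minusR; [apply is_derive_lint|apply is_derive_inv_g3].
    + intros x Hx; pose proof (ldens_bound x) as H; pose proof (Hv x ltac:(lra)).
      apply Rabs_le_between in H; lra.
  - intros s Hs.
    assert (H : - (lint c + c / g c ^ 3) <= - (lint s + c / g s ^ 3)).
    { apply (le_of_derive_le (fun s => - (lint s + c / g s ^ 3))
        (fun s => - (ldens s + - (3 * c * v s / g s ^ 4)))); [assumption| |].
      - intros x _; apply is_derive_oppR, is_derive_plusR;
          [apply is_derive_lint|apply is_derive_inv_g3].
      - intros x Hx; pose proof (ldens_bound x) as H; pose proof (Hv x ltac:(lra)).
        apply Rabs_le_between in H; lra. }
    pose proof (inv_g3_le c s ltac:(lra) Hs); lra.
  - exists l; apply is_lim_ext with (fun s => (lint s - c / g s ^ 3) + c / g s ^ 3);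
      [intro; ring|].
    replace (Finite l) with (Finite (l + 0)) by (f_equal; ring).
    apply (is_lim_plus' _ _ _ l 0 Hl).
    apply is_lim_inv_bound with c c; [lra|].
    intros s Hs; pose proof (inv_g3_le c s ltac:(lra) ltac:(lra)).
    rewrite Rabs_pos_eq; lra.
Qed.

Lemma lint_lim_E0 : is_lim lint p_infty (sqrt 2 * E0 a).
Proof.
  destruct lint_lim as [l Hl].
  assert (H2 : 0 < sqrt 2) by (apply sqrt_lt_R0; lra).
  replace (sqrt 2 * E0 a) with l; [assumption|].
  assert (EI : I0 a = fun t => / sqrt 2 * ldens t).
  { apply functional_extensionality; intro t; rewrite <- sqrt2_I0; field; lra. }
  assert (E : E0 a = / sqrt 2 * l); [|rewrite E; field; lra].
  unfold E0; apply is_RInt_gen_unique; rewrite EI.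
  assert (Hl' : is_lim (fun s => / sqrt 2 * lint s) p_infty (/ sqrt 2 * l))
    by (apply (is_lim_scal_l lint (/ sqrt 2) p_infty l Hl)).
  intros P HP; unfold filtermapi.
  apply Filter_prod with (fun x => x = 0) (fun s => P (/ sqrt 2 * lint s)).
  - reflexivity.
  - exact (Hl' P HP).
  - intros x y -> Hy; exists (/ sqrt 2 * lint y); split; [|assumption].
    apply (is_RInt_scal ldens).
    apply (RInt_correct (V := R_CompleteNormedModule)), ex_RInt_cont.
    intro; apply smooth_continuous, smooth_ldens.
Qed.

Definition ratio (s : R) : R := e s / v s.

Lemma is_derive_ratio (s : R) : 0 < s -> is_derive ratio s (c / (g s * v s ^ 2)).
Proof.
  intro Hs; pose proof (vfield_pos s Hs); pose proof (g_pos s).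
  unfold ratio; evar_last.
  - apply is_derive_div; [apply is_derive_efield|apply is_derive_vfield|lra].
  - rewrite <- (wronskian s); field; lra.
Qed.

Lemma ratio_increasing (s t : R) : 0 < s -> s < t -> ratio s < ratio t.
Proof.
  intros Hs Hst; apply (lt_of_derive_pos ratio (fun s => c / (g s * v s ^ 2)));
    [assumption|intros; apply is_derive_ratio; lra|].
  intros x Hx; pose proof (vfield_pos x ltac:(lra)).
  pos_tac.
Qed.

Lemma ratio_lim : is_lim ratio p_infty (sqrt 2 * E0 a).
Proof.
  pose proof c_gt_1 as Hc.
  apply is_lim_ext_loc with (fun s => lint s + bfield s / v s).
  - exists 0; intros s Hs; pose proof (vfield_pos s Hs).
    unfold ratio, efield; field; lra.
  - replace (Finite (sqrt 2 * E0 a)) with (Finite (sqrt 2 * E0 a + 0)) by (f_equal; ring).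
    apply (is_lim_plus' _ _ _ _ 0 lint_lim_E0).
    apply is_lim_inv_bound with c c; [lra|].
    intros s Hs; pose proof (inv_g3_le c s ltac:(lra) ltac:(lra)) as [_ H3].
    eapply Rle_trans; [|exact H3].
    pose proof (v_ge_g s ltac:(lra)) as Hv; pose proof (g_pos s) as Hg.
    unfold bfield; set (G := g s) in *; set (V := v s) in *; clearbody G V.
    replace (- ((c ^ 2 - 1) * (1 + 2 * G ^ 2)) / (4 * c * ((1 + G ^ 2) * G ^ 2)) / V)
      with (- ((c ^ 2 - 1) * (1 + 2 * G ^ 2) / (4 * c * ((1 + G ^ 2) * G ^ 2) * V)))
      by (field; pos_tac).
    rewrite Rabs_Ropp, Rabs_pos_eq by (apply Rlt_le; pos_tac).
    apply Rle_trans with (c ^ 2 * (4 * (1 + G ^ 2)) / (4 * c * ((1 + G ^ 2) * G ^ 2) * G)).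
    + apply Rmult_le_compat; [apply Rlt_le; pos_tac|apply Rlt_le; pos_tac| |].
      * apply Rmult_le_compat; nra.
      * apply Rinv_le_contravar; [pos_tac|].
        apply Rmult_le_compat_l; [apply Rlt_le; pos_tac|assumption].
    + right; field; pos_tac.
Qed.

Lemma ratio_lt_lim (s : R) : 0 < s -> ratio s < sqrt 2 * E0 a.
Proof.
  intro Hs; apply Rlt_le_trans with (ratio (s + 1)); [apply ratio_increasing; lra|].
  apply Ropp_le_cancel, (is_lim_le_const (fun s => - ratio s) (s + 1));
    [apply (is_lim_opp ratio p_infty (sqrt 2 * E0 a)), ratio_lim|].
  intros t Ht; apply Ropp_le_contravar, Rlt_le, ratio_increasing; lra.
Qed.

(** The derivative c / (g v^2) of the quotient is smaller than minus that of c / (3 g^3). *)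
Lemma ratio_tail (s : R) : c <= s -> sqrt 2 * E0 a - ratio s <= c / (3 * g s ^ 3).
Proof.
  intro Hs; pose proof c_gt_1 as Hc; pose proof (g_pos s).
  replace (c / (3 * g s ^ 3)) with (c / 3 / g s ^ 3) by (field; lra).
  assert (H0 : forall t, s <= t -> - (ratio s + c / 3 / g s ^ 3)
                               <= - (ratio t + c / 3 / g t ^ 3)).
  { intros t Ht.
    apply (le_of_derive_le (fun t => - (ratio t + c / 3 / g t ^ 3)) (fun t =>
      - (c / (g t * v t ^ 2) + - (3 * (c / 3) * v t / g t ^ 4)))); [assumption| |].
    - intros x Hx; apply is_derive_oppR, is_derive_plusR;
        [apply is_derive_ratio; lra|apply is_derive_inv_g3].
    - intros x Hx; pose proof (v_ge_g x ltac:(lra)); pose proof (g_pos x).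
      assert (c / (g x * v x ^ 2) <= 3 * (c / 3) * v x / g x ^ 4); [|lra].
      replace (c / (g x * v x ^ 2)) with (c * g x ^ 3 / (g x ^ 4 * v x ^ 2)) by (field; lra).
      replace (3 * (c / 3) * v x / g x ^ 4) with (c * v x ^ 3 / (g x ^ 4 * v x ^ 2))
        by (field; lra).
      apply Rmult_le_compat_r; [apply Rlt_le; pos_tac|].
      apply Rmult_le_compat_l; [lra|apply pow_incr; lra]. }
  assert (H1 : is_lim (fun t => ratio t + c / 3 / g t ^ 3) p_infty (sqrt 2 * E0 a)).
  { replace (Finite (sqrt 2 * E0 a)) with (Finite (sqrt 2 * E0 a + 0)) by (f_equal; ring).
    apply (is_lim_plus' _ _ _ _ 0 ratio_lim).
    apply is_lim_inv_bound with c (c / 3); [lra|].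
    intros t Ht; pose proof (inv_g3_le (c / 3) t ltac:(lra) ltac:(lra)).
    rewrite Rabs_pos_eq; lra. }
  pose proof (is_lim_le_const _ s _ (ratio s + c / 3 / g s ^ 3) H1) as H2.
  enough (sqrt 2 * E0 a <= ratio s + c / 3 / g s ^ 3) by lra.
  apply H2; intros t Ht; specialize (H0 t ltac:(lra)); lra.
Qed.

Lemma efield_ratio (s : R) : 0 < s -> e s = v s * ratio s.
Proof. intro Hs; pose proof (vfield_pos s Hs); unfold ratio; field; lra. Qed.

Lemma efield_neg (s : R) : E0 a <= 0 -> e s < 0.
Proof.
  intro HE; assert (H2 : 0 < sqrt 2) by (apply sqrt_lt_R0; lra).
  assert (Hp : forall s, 0 < s -> e s < 0).
  { intros t Ht; rewrite efield_ratio by assumption.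
    assert (sqrt 2 * E0 a <= 0) by nra.
    pose proof (vfield_pos t Ht); pose proof (ratio_lt_lim t Ht).
    assert (ratio t < 0) by lra; nra. }
  destruct (Rtotal_order s 0) as [Hs|[->|Hs]].
  - rewrite <- efield_even; apply Hp; lra.
  - apply efield_0.
  - apply Hp, Hs.
Qed.

Section PositiveE0.

Hypothesis E0_pos : 0 < E0 a.

Let w : R := sqrt 2 * E0 a.

Lemma w_pos : 0 < w.
Proof. apply Rmult_lt_0_compat; [apply sqrt_lt_R0; lra|assumption]. Qed.

Lemma efield_zero : exists z, 0 < z /\ e z = 0 /\ forall s, - z < s < z -> e s < 0.
Proof.
  pose proof w_pos as Hw.
  assert (Hs : exists s, 0 < s /\ 0 < e s).
  { pose proof ratio_lim as H; apply is_lim_spec in H.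
    destruct (H (mkposreal _ Hw)) as [B HB]; simpl in HB; fold w in HB.
    pose proof (Rmax_l B 0); pose proof (Rmax_r B 0).
    exists (Rmax B 0 + 1); split; [lra|].
    specialize (HB (Rmax B 0 + 1) ltac:(lra)); apply Rabs_lt_between' in HB.
    rewrite efield_ratio by lra.
    apply Rmult_lt_0_compat; [apply vfield_pos; lra|lra]. }
  destruct Hs as [s1 [Hs1 He1]].
  assert (Hcont : continuity e).
  { intro s; apply continuity_pt_filterlim, smooth_continuous, smooth_efield. }
  destruct (IVT e 0 s1 Hcont Hs1 efield_0 He1) as [z [Hz Ez]].
  assert (Hz0 : 0 < z).
  { destruct (Req_dec z 0) as [E|]; [|lra].
    pose proof efield_0; rewrite E in Ez; lra. }
  exists z; split; [assumption|split; [assumption|]].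
  assert (Hr : ratio z = 0) by (unfold ratio; rewrite Ez; unfold Rdiv; ring).
  assert (Hp : forall s, 0 < s < z -> e s < 0).
  { intros s Hs; rewrite efield_ratio by lra.
    pose proof (vfield_pos s ltac:(lra)).
    pose proof (ratio_increasing s z ltac:(lra) ltac:(lra)); nra. }
  intros s Hs; destruct (Rtotal_order s 0) as [H|[->|H]].
  - rewrite <- efield_even; apply Hp; lra.
  - apply efield_0.
  - apply Hp; lra.
Qed.

(** The Jacobi field which decays at the end [s -> +oo]. *)
Definition ufield (s : R) : R := w * v s - e s.
Definition ufield1 (s : R) : R := w * v1 s - e1 s.

Lemma ufield_sol : jacobi_sol ufield ufield1.
Proof.
  destruct vfield_sol as [_ V2]; destruct efield_sol as [_ W2].
  split; intro s.
  - unfold ufield; evar_last; [der|unfold ufield1; ring].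
  - apply is_derive_ext with (fun s => w * (g s * v1 s) - g s * e1 s);
      [intro; unfold ufield1; toR; ring|].
    evar_last; [apply is_derive_minusR; [apply is_derive_scal, V2|apply W2]|].
    unfold ufield; ring.
Qed.

Lemma smooth_ufield : smooth ufield.
Proof.
  unfold ufield; smooth_tac.
Qed.

(** By parity u (- s) = - v s (ratio s + w), where [ratio + w] is increasing on s > 0, is
    positive at [z] because [ratio z = 0], and is negative near 0. *)
Lemma ufield_zero (z : R) : 0 < z -> e z = 0 -> exists l, 0 < l < z /\ ufield (- l) = 0 /\
  forall s, - l < s -> 0 < ufield s.
Proof.
  intros Hz Ez; pose proof w_pos as Hw.
  set (k := fun s => e s + w * v s).
  assert (Hk : forall s, ufield (- s) = - k s).
  { intro s; unfold ufield, k; rewrite vfield_odd, efield_even; ring. }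
  assert (Hcont : continuity k).
  { intro s; apply continuity_pt_filterlim.
    change (continuous (fun s => e s + w * v s) s); cont_tac. }
  assert (V0 : v 0 = 0) by (unfold vfield; rewrite D_0; unfold Rdiv; ring).
  assert (K0 : k 0 < 0) by (unfold k; rewrite V0; pose proof efield_0; lra).
  assert (Kz : 0 < k z)
    by (unfold k; rewrite Ez; pose proof (vfield_pos z Hz); nra).
  destruct (IVT k 0 z Hcont Hz K0 Kz) as [l [Hl El]].
  assert (Hl1 : l <> 0) by (intro E; rewrite E in El; lra).
  assert (Hl2 : l <> z) by (intro E; rewrite E in El; lra).
  exists l; split; [lra|split; [rewrite Hk, El; ring|]].
  intros s Hs; destruct (Rtotal_order s 0) as [H|[->|H]].
  - replace s with (- - s) by ring; rewrite Hk.
    assert (H1 : k (- s) = v (- s) * (ratio (- s) + w))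
      by (unfold k; rewrite efield_ratio by lra; ring).
    assert (H2 : k l = v l * (ratio l + w))
      by (unfold k; rewrite efield_ratio by lra; ring).
    pose proof (vfield_pos (- s) ltac:(lra)).
    pose proof (vfield_pos l ltac:(lra)).
    pose proof (ratio_increasing (- s) l ltac:(lra) ltac:(lra)).
    assert (ratio l + w = 0) by (apply Rmult_eq_reg_l with (v l); lra).
    rewrite H1; assert (ratio (- s) + w < 0) by lra; nra.
  - unfold ufield; rewrite V0; pose proof efield_0; lra.
  - unfold ufield; rewrite efield_ratio by lra.
    pose proof (vfield_pos s H); pose proof (ratio_lt_lim s H) as H1; fold w in H1; nra.
Qed.

(** Since u = v (w - ratio), with v = O(g) and w - ratio = O(1 / g^3). *)
Lemma ufield_decay : exists M, forall s, c <= s -> g s * ufield s ^ 2 <= M / s.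
Proof.
  exists (c ^ 2); intros s Hs; pose proof c_gt_1 as Hc.
  pose proof (g_ge s ltac:(lra)) as Hgs.
  pose proof (ratio_lt_lim s ltac:(lra)) as R1; pose proof (ratio_tail s Hs) as R2.
  fold w in R1, R2.
  assert (E : ufield s = v s * (w - ratio s))
    by (unfold ufield; rewrite efield_ratio by lra; ring).
  rewrite E; pose proof (v_le s) as Hv.
  assert (Hq : (w - ratio s) ^ 2 <= (c / (3 * g s ^ 3)) ^ 2) by (apply pow_incr; lra).
  apply Rle_trans with (g s * ((9 * g s ^ 2) * (c / (3 * g s ^ 3)) ^ 2)).
  - apply Rmult_le_compat_l; [lra|].
    replace ((v s * (w - ratio s)) ^ 2) with (v s ^ 2 * (w - ratio s) ^ 2) by ring.
    apply Rmult_le_compat; [apply pow2_ge_0|apply pow2_ge_0|nra|assumption].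
  - replace (g s * (9 * g s ^ 2 * (c / (3 * g s ^ 3)) ^ 2)) with (c ^ 2 / g s ^ 3)
      by (field; lra).
    apply inv_g3_le; nra.
Qed.

End PositiveE0.

(** * The sign of E0 for large and for small values of the parameter *)

Lemma ldens_eq (s : R) : ldens s =
  (4 * g s ^ 2 + 4 * g s ^ 4 - (c ^ 2 - 1) * (1 + g s ^ 2 + 2 * g s ^ 4))
  / (4 * c * (1 + g s ^ 2) ^ 2 * g s ^ 3).
Proof.
  unfold ldens; field; pos_tac.
Qed.

(** The integrand itself is nonpositive. *)
Lemma E0_neg : 3 <= c -> E0 a <= 0.
Proof.
  intro Hc; assert (H2 : 0 < sqrt 2) by (apply sqrt_lt_R0; lra).
  assert (H : sqrt 2 * E0 a <= 0); [|nra].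
  apply (is_lim_le_const lint 0); [apply lint_lim_E0|].
  intros s Hs; apply Ropp_le_cancel; rewrite <- lint_0.
  apply (le_of_derive_le (fun s => - lint s) (fun s => - ldens s)); [lra| |].
  - intros x _; der.
  - intros x _; rewrite ldens_eq; pose proof (g_pos x) as Hg.
    set (G := g x) in *; clearbody G.
    rewrite <- Rdiv_opp_l; apply Rmult_le_pos; [|apply Rlt_le; pos_tac].
    assert (0 < G ^ 2) by pos_tac; assert (0 < G ^ 4) by pos_tac.
    assert (8 * (1 + G ^ 2 + 2 * G ^ 4) <= (c ^ 2 - 1) * (1 + G ^ 2 + 2 * G ^ 4))
      by (apply Rmult_le_compat_r; nra).
    lra.
Qed.

Lemma g_sinh (s : R) : g s ^ 2 = (c - 1) / 2 + c * sinh s ^ 2.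
Proof.
  pose proof (g_sq s) as E; rewrite (cosh_2 s) in E.
  pose proof (cosh_sinh_sq s).
  replace (cosh s ^ 2) with (1 + sinh s ^ 2) in E by lra; lra.
Qed.

(** With [h = c sinh^2 s] and [c = 1 + n], the numerator of [ldens] is
    (4 h - n^2) (1 + g^2) - 2 (c^2 - 1) g^4.  The terms of order [n] cancel at [s = 0], so
    that for small [n] it is negative only if [h < 2 n^2], on an interval of length O(n). *)
Lemma ldens_numerator (s : R) :
  4 * g s ^ 2 + 4 * g s ^ 4 - (c ^ 2 - 1) * (1 + g s ^ 2 + 2 * g s ^ 4)
  = (4 * (c * sinh s ^ 2) - (c - 1) ^ 2) * (1 + g s ^ 2) - 2 * (c ^ 2 - 1) * g s ^ 4.
Proof.
  replace (g s ^ 4) with (g s ^ 2 * g s ^ 2) by ring; rewrite g_sinh; field.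
Qed.

Lemma ldens_lower_far (s : R) : c - 1 <= / 6 -> 0 <= s -> 3 / 2 * (c - 1) <= s ->
  s ^ 2 / (8 * (1 + g s ^ 2) ^ 3) <= ldens s.
Proof.
  intros Hc Hs0 Hs; rewrite ldens_eq, ldens_numerator.
  pose proof c_gt_1 as Hc1; pose proof (g_pos s) as Hg.
  pose proof (sinh_ge s Hs0) as Hsh; pose proof (g_sinh s) as E.
  set (h := c * sinh s ^ 2) in *.
  assert (Hh : s ^ 2 <= h) by (unfold h; nra).
  set (n := c - 1) in *; assert (En : c = 1 + n) by (unfold n; ring).
  assert (Hn : 0 < n) by (unfold n; lra).
  assert (Hhn : 2 * n ^ 2 <= h) by nra.
  set (G := g s) in *; clearbody G h n; rewrite En.
  assert (Hnum : h * (1 + G ^ 2)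
    <= (4 * h - n ^ 2) * (1 + G ^ 2) - 2 * ((1 + n) ^ 2 - 1) * G ^ 4).
  { replace (G ^ 4) with (G ^ 2 * (n / 2 + h)) by (rewrite <- E; ring).
    assert (0 < G ^ 2) by pos_tac; set (K := G ^ 2) in *; clearbody K.
    assert (2 * ((1 + n) ^ 2 - 1) <= 6 * n) by nra.
    assert (6 * n * (n / 2 + h) <= 5 / 2 * h) by nra.
    assert (2 * ((1 + n) ^ 2 - 1) * (n / 2 + h) <= 5 / 2 * h) by nra.
    nra. }
  apply Rle_trans with (h * (1 + G ^ 2) / (8 * (1 + G ^ 2) ^ 4)).
  - replace (h * (1 + G ^ 2) / (8 * (1 + G ^ 2) ^ 4)) with (h / (8 * (1 + G ^ 2) ^ 3))
      by (field; nra).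
    apply Rmult_le_compat_r; [apply Rlt_le; pos_tac|assumption].
  - apply Rmult_le_compat; [nra|apply Rlt_le; pos_tac|assumption|].
    apply Rinv_le_contravar; [pos_tac|].
    assert (HG3 : G ^ 3 <= (1 + G ^ 2) ^ 2).
    { assert (0 < G ^ 2) by pos_tac; assert (G <= 1 + G ^ 2) by nra.
      replace (G ^ 3) with (G ^ 2 * G) by ring; nra. }
    replace (8 * (1 + G ^ 2) ^ 4) with (8 * (1 + G ^ 2) ^ 2 * (1 + G ^ 2) ^ 2) by ring.
    apply Rmult_le_compat; [apply Rlt_le; pos_tac|apply Rlt_le; pos_tac| |assumption].
    apply Rmult_le_compat_r; [apply Rlt_le; pos_tac|lra].
Qed.

Lemma ldens_lower_near (s : R) : c - 1 <= / 6 -> 0 <= s -> - (3 / 2) <= ldens s.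
Proof.
  intros Hc Hs0.
  pose proof c_gt_1 as Hc1; pose proof (g_pos s) as Hg.
  pose proof (g_sinh s) as E; pose proof (ldens_numerator s) as N.
  rewrite ldens_eq, N; clear N.
  set (h := c * sinh s ^ 2) in *.
  assert (Hh : 0 <= h) by (pose proof (pow2_ge_0 (sinh s)); unfold h; nra).
  set (n := c - 1) in *; assert (En : c = 1 + n) by (unfold n; ring).
  assert (Hn : 0 < n) by (unfold n; lra).
  set (G := g s) in *; clearbody G h n; rewrite En.
  assert (HG : n <= G) by nra.
  assert (HG3 : n ^ 2 / 2 <= G ^ 3).
  { replace (G ^ 3) with (G ^ 2 * G) by ring; rewrite E; nra. }
  assert (Hnum : - (3 * n ^ 2) * (1 + G ^ 2)
    <= (4 * h - n ^ 2) * (1 + G ^ 2) - 2 * ((1 + n) ^ 2 - 1) * G ^ 4).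
  { replace (G ^ 4) with (G ^ 2 * (n / 2 + h)) by (rewrite <- E; ring).
    assert (0 < G ^ 2) by pos_tac; set (K := G ^ 2) in *; clearbody K.
    assert (2 * ((1 + n) ^ 2 - 1) <= 5 * n) by nra.
    assert (2 * ((1 + n) ^ 2 - 1) * (n / 2 + h) <= 5 / 2 * n ^ 2 + h) by nra.
    assert (0 <= h * K) by nra.
    assert (0 <= n ^ 2 * K) by (apply Rmult_le_pos; [apply pow2_ge_0|lra]).
    nra. }
  set (den := 4 * (1 + n) * (1 + G ^ 2) ^ 2 * G ^ 3).
  assert (Hden : 0 < den) by (unfold den; pos_tac).
  apply Rmult_le_reg_r with den; [assumption|].
  match goal with |- _ <= ?x / _ * _ => replace (x / den * den) with x by (field; lra) end.
  eapply Rle_trans; [|exact Hnum].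
  assert (H : 2 * n ^ 2 * (1 + G ^ 2) <= den); [|lra].
  unfold den; replace (2 * n ^ 2 * (1 + G ^ 2)) with (4 * (1 + G ^ 2) * (n ^ 2 / 2)) by field.
  apply Rmult_le_compat; [apply Rlt_le; pos_tac|nra| |assumption].
  assert (0 < G ^ 2) by pos_tac; set (K := G ^ 2) in *; clearbody K; nra.
Qed.

(** The integrand [ldens] is at least -3/2 on an interval of length 3/2 (c - 1), nonnegative
    beyond it, and at least [k] on [1, 2]. *)
Lemma E0_pos_small (k : R) : c - 1 <= / 6 -> k = / (8 * (1 + cosh 4) ^ 3) ->
  9 / 4 * (c - 1) < k -> 0 < E0 a.
Proof.
  intros Hc Hk Hlt; pose proof c_gt_1 as Hc1.
  assert (H2 : 0 < sqrt 2) by (apply sqrt_lt_R0; lra).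
  set (d := 3 / 2 * (c - 1)).
  assert (Hd : 0 <= d <= 1) by (unfold d; lra).
  assert (Hfar0 : forall s, d <= s -> 0 <= ldens s).
  { intros s Hs; eapply Rle_trans; [|apply ldens_lower_far; unfold d in *; lra].
    apply Rmult_le_pos; [apply pow2_ge_0|apply Rlt_le; pose proof (pow2_ge_0 (g s)); pos_tac]. }
  assert (L1 : lint 0 + 3 / 2 * 0 <= lint d + 3 / 2 * d).
  { apply (le_of_derive_le (fun s => lint s + 3 / 2 * s)
      (fun s => ldens s + 3 / 2)); [lra| |].
    - intros x _; evar_last; [der|field].
    - intros x Hx; pose proof (ldens_lower_near x Hc ltac:(lra)); lra. }
  assert (L2 : lint d <= lint 1).
  { apply (le_of_derive_le lint ldens); [lra| |].
    - intros; apply is_derive_lint.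
    - intros; apply Hfar0; lra. }
  assert (L3 : lint 1 - k * 1 <= lint 2 - k * 2).
  { apply (le_of_derive_le (fun s => lint s - k * s) (fun s => ldens s - k)); [lra| |].
    - intros x _; evar_last; [der|field].
    - intros x Hx.
      pose proof (ldens_lower_far x Hc ltac:(lra) ltac:(unfold d in *; lra)) as H.
      assert (k <= x ^ 2 / (8 * (1 + g x ^ 2) ^ 3)); [|lra].
      pose proof (pow2_ge_0 (g x)).
      rewrite Hk, <- (Rmult_1_l (/ _)); apply Rmult_le_compat;
        [lra|apply Rlt_le; pose proof (cosh_ge_1 4); pos_tac|nra|].
      apply Rinv_le_contravar; [pos_tac|].
      apply Rmult_le_compat_l; [lra|apply pow_incr; split; [lra|]].
      assert (g x ^ 2 <= cosh 4); [|lra].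
      pose proof (g_sq x).
      assert (cosh (2 * x) <= cosh 4).
      { destruct (Req_dec x 2) as [->|]; [right; f_equal; ring|].
        apply Rlt_le, cosh_increasing; lra. }
      nra. }
  assert (L4 : forall s, 2 < s -> lint 2 <= lint s).
  { intros s Hs; apply (le_of_derive_le lint ldens); [lra| |].
    - intros; apply is_derive_lint.
    - intros; apply Hfar0; lra. }
  rewrite lint_0 in L1.
  assert (Hpos : k - 3 / 2 * d <= sqrt 2 * E0 a).
  { apply Ropp_le_cancel, (is_lim_le_const (fun s => - lint s) 2).
    - apply (is_lim_opp lint p_infty (sqrt 2 * E0 a)), lint_lim_E0.
    - intros s Hs; specialize (L4 s Hs); lra. }
  unfold d in Hpos; apply Rmult_lt_reg_l with (sqrt 2); lra.
Qed.

(** * Rotation invariant domains *)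

Lemma band_X (I : R -> Prop) (s th : R) : band X I (X s th) <-> I s.
Proof.
  split.
  - intros [s' [th' [HI [_ E]]]].
    destruct (Y0_inj _ _ _ _ E) as [-> _]; assumption.
  - intro HI; destruct (angle_representative 0 th) as [t [Ht [Hc Hs]]].
    exists s, t; split; [assumption|split; [lra|]].
    apply Y0_angle; auto.
Qed.

Lemma band_point (I : R -> Prop) (p : pt) : band X I p -> exists s th, I s /\ p = X s th.
Proof. intros [s [th [H1 [_ H2]]]]; exists s, th; auto. Qed.

Lemma whole_X (s th : R) : whole X (X s th).
Proof. apply band_X; exact I. Qed.

Lemma band_open_in (I : R -> Prop) : open I -> open_in X (band X I).
Proof.
  intro HI; split.
  - intros p Hp; destruct (band_point I p Hp) as [s [th [_ ->]]]; apply whole_X.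
  - intros [s th] H; simpl in H; apply band_X in H.
    destruct (HI s H) as [eps Heps]; exists eps; intros [s' th'] [B1 _].
    apply band_X, Heps, B1.
Qed.

Lemma open_in_inter (U V : pt -> Prop) : open_in X U -> open_in X V ->
  open_in X (fun p => U p /\ V p).
Proof.
  intros [U1 U2] [V1 V2]; split; [intros p [Hp _]; apply U1, Hp|].
  apply (open_and _ _ U2 V2).
Qed.

Lemma locally_segment (P : R * R -> Prop) (s1 th1 s2 th2 t : R) :
  locally (s1 + t * (s2 - s1), th1 + t * (th2 - th1)) P ->
  locally t (fun t => P (s1 + t * (s2 - s1), th1 + t * (th2 - th1))).
Proof.
  intros [eps He]; set (M := Rabs (s2 - s1) + Rabs (th2 - th1) + 1).
  pose proof (Rabs_pos (s2 - s1)); pose proof (Rabs_pos (th2 - th1)).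
  pose proof (cond_pos eps) as Heps.
  assert (HM : 0 < M) by (unfold M; lra).
  assert (Hd : 0 < eps / M) by (apply Rdiv_lt_0_compat; assumption).
  exists (mkposreal _ Hd); intros t' Ht; apply He.
  change (Rabs (t' - t) < eps / M) in Ht.
  apply Rmult_lt_compat_r with (r := M) in Ht; [|assumption].
  replace (eps / M * M) with (pos eps) in Ht by (field; lra).
  split.
  - change (Rabs (s1 + t' * (s2 - s1) - (s1 + t * (s2 - s1))) < eps).
    replace (s1 + t' * (s2 - s1) - (s1 + t * (s2 - s1))) with ((t' - t) * (s2 - s1)) by ring.
    rewrite Rabs_mult; unfold M in Ht; nra.
  - change (Rabs (th1 + t' * (th2 - th1) - (th1 + t * (th2 - th1))) < eps).
    replace (th1 + t' * (th2 - th1) - (th1 + t * (th2 - th1)))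
      with ((t' - t) * (th2 - th1)) by ring.
    rewrite Rabs_mult; unfold M in Ht; nra.
Qed.

(** A band over an interval is connected: along the image of a segment, the indicator
    function of one of two complementary open sets is locally constant. *)
Lemma band_open_domain (I : R -> Prop) (m : R) : open I -> I m ->
  (forall s1 s2 s, I s1 -> I s2 -> s1 <= s <= s2 -> I s) -> open_domain X (band X I).
Proof.
  intros HI Hm Hconv; split; [apply band_open_in, HI|split].
  - exists (X m 0); apply band_X, Hm.
  - intros U V [_ HU] [_ HV] Huv Hdis [pu Hpu] [pv Hpv].
    destruct (band_point I pu (proj2 (Huv pu) (or_introl Hpu))) as [s1 [t1 [I1 E1]]].
    destruct (band_point I pv (proj2 (Huv pv) (or_intror Hpv))) as [s2 [t2 [I2 E2]]].
    set (y := fun t => X (s1 + t * (s2 - s1)) (t1 + t * (t2 - t1))).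
    assert (Hy : forall t, 0 <= t <= 1 -> U (y t) \/ V (y t)).
    { intros t Ht; apply Huv; refine (proj2 (band_X I _ _) _).
      destruct (Rle_lt_dec s1 s2); [apply (Hconv s1 s2)|apply (Hconv s2 s1)];
        try assumption; nra. }
    set (h := fun t => if excluded_middle_informative (U (y t)) then 0 else 1).
    assert (Hd : forall t, 0 <= t <= 1 -> is_derive h t 0).
    { intros t Ht; destruct (Hy t Ht) as [H|H].
      - apply is_derive_ext_loc with (fun _ => 0); [|apply is_derive_cst].
        pose proof (locally_segment _ s1 t1 s2 t2 t
          (HU (s1 + t * (s2 - s1), t1 + t * (t2 - t1)) H)) as L.
        revert L; apply filter_imp; intros x Hx; unfold h.
        destruct (excluded_middle_informative (U (y x))); [reflexivity|contradiction].
      - apply is_derive_ext_loc with (fun _ => 1); [|apply is_derive_cst].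
        pose proof (locally_segment _ s1 t1 s2 t2 t
          (HV (s1 + t * (s2 - s1), t1 + t * (t2 - t1)) H)) as L.
        revert L; apply filter_imp; intros x Hx; unfold h.
        destruct (excluded_middle_informative (U (y x))) as [Hux|]; [|reflexivity].
        exfalso; apply (Hdis _ (conj Hux Hx)). }
    assert (E : h 0 = h 1) by (apply (eq_is_derive h 0 1); [exact Hd|lra]).
    unfold h in E.
    assert (y0E : y 0 = pu) by (unfold y; rewrite E1; f_equal; ring).
    assert (y1E : y 1 = pv) by (unfold y; rewrite E2; f_equal; ring).
    rewrite y0E, y1E in E.
    destruct (excluded_middle_informative (U pu)); [|contradiction].
    destruct (excluded_middle_informative (U pv)) as [H|]; [|lra].
    apply (Hdis pv (conj H Hpv)).
Qed.

Lemma rotation_X (phi s th : R) : rotation phi (X s th) = X s (th + phi).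
Proof.
  unfold rotation, Y0, coord; simpl; rewrite cos_plus, sin_plus; f_equal; f_equal; ring.
Qed.

Lemma band_rotation_invariant (I : R -> Prop) : rotation_invariant (band X I).
Proof.
  intros phi p Hp; destruct (band_point I p Hp) as [s [th [HI ->]]].
  rewrite rotation_X; apply band_X, HI.
Qed.

(** Leaving a band within a connected set, one meets its boundary. *)
Lemma larger_domain_boundary (I O B : R -> Prop) (U : pt -> Prop) (m : R) :
  open I -> open O -> I m -> (forall s, ~ (I s /\ O s)) ->
  (forall s, I s \/ O s \/ B s) ->
  open_domain X U -> strictly_larger U (band X I) ->
  exists s th, B s /\ U (X s th).
Proof.
  intros HI HO Hm Hdis Hcov [Uo [_ Uc]] [Hsub [p [Up Np]]].
  apply NNPP; intro Hno.
  apply (Uc (band X I) (fun p => U p /\ band X O p)).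
  - apply band_open_in, HI.
  - apply open_in_inter; [assumption|apply band_open_in, HO].
  - intro x; split.
    + intro Ux; destruct (band_point _ x (proj1 Uo x Ux)) as [s [th [_ ->]]].
      destruct (Hcov s) as [Hs|[Hs|Hs]].
      * left; apply band_X, Hs.
      * right; split; [assumption|apply band_X, Hs].
      * exfalso; apply Hno; exists s, th; auto.
    + intros [Hx|[Hx _]]; [apply Hsub|]; assumption.
  - intros x [H1 [_ H2]]; destruct (band_point I x H1) as [s [th [Hs ->]]].
    apply band_X in H2; apply (Hdis s (conj Hs H2)).
  - exists (X m 0); apply band_X, Hm.
  - exists p; split; [assumption|].
    destruct (band_point _ p (proj1 Uo p Up)) as [s [th [_ ->]]].
    apply band_X; destruct (Hcov s) as [Hs|[Hs|Hs]].
    + exfalso; apply Np, band_X, Hs.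
    + assumption.
    + exfalso; apply Hno; exists s, th; auto.
Qed.

(** * Weak stability *)

(** Each point of the line [s = al] is the centre of a box which misses [K]; by compactness
    one size of boxes is enough for the bounded range of the angle. *)
Lemma compact_avoids_circle (K : R * R -> Prop) (al : R) : closed K -> bounded_set K ->
  (forall th, ~ K (al, th)) ->
  exists d, 0 < d /\ forall s th, K (s, th) -> d <= Rabs (s - al).
Proof.
  intros HK [B HB] Hal.
  assert (Hloc : forall th, exists d : posreal, forall y, ball (al, th) d y -> ~ K y).
  { intro th; apply NNPP; intro Hno; apply (Hal th), HK; intros [d Hd].
    apply Hno; exists d; exact Hd. }
  set (delta := fun th => proj1_sig (constructive_indefinite_description _ (Hloc th))).
  assert (Hdelta : forall th y, ball (al, th) (delta th) y -> ~ K y)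
    by (intro th; apply (proj2_sig (constructive_indefinite_description _ (Hloc th)))).
  destruct (compactness_value_1d (- B) B delta) as [d Hd].
  exists d; split; [apply cond_pos|].
  intros s th Hs; destruct (Rle_lt_dec d (Rabs (s - al))) as [|Hlt]; [assumption|exfalso].
  destruct (HB _ Hs) as [_ Hb]; simpl in Hb; apply Rabs_le_between in Hb.
  apply (Hd th Hb); intros [t [_ [H1 H2]]].
  apply (Hdelta t (s, th)); [|assumption].
  split; [change (Rabs (s - al) < delta t); lra|exact H1].
Qed.

Lemma test_function_gap (I : R -> Prop) (f : pt -> R) (al : R) :
  test_function X (band X I) f -> ~ I al ->
  exists d, 0 < d /\ forall s th, Rabs (s - al) < d -> f (X s th) = 0.
Proof.
  intros Hf Hal; destruct (test_function_wave _ f Hf) as [_ [K [H1 [H2 [H3 [H4 _]]]]]].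
  destruct (compact_avoids_circle K al H1 H2) as [d [Hd HdK]].
  - intros th HK; apply Hal, (band_X I al th), H3, HK.
  - exists d; split; [assumption|intros s th Hs].
    apply NNPP; intro Hn; destruct (H4 s th Hn) as [t [Ht _]].
    specialize (HdK s t Ht); lra.
Qed.

Lemma test_function_band (I : R -> Prop) (f : pt -> R) (s th : R) :
  test_function X (band X I) f -> ~ I s -> f (X s th) = 0.
Proof.
  intros Hf Hs; destruct (test_function_gap I f s Hf Hs) as [d [Hd H]].
  apply H; rewrite Rminus_eq_0, Rabs_R0; assumption.
Qed.

Lemma jacobi_form_ge_0 (f : pt -> R) (u u1 : R -> R) (x1 x2 : R) :
  smooth2 (fun s th => f (X s th)) -> jacobi_sol u u1 -> x1 <= x2 ->
  (forall s, x1 <= s <= x2 -> 0 < u s) ->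
  (forall s th, s <= x1 \/ x2 <= s -> f (X s th) = 0) ->
  0 <= jacobi_form X f.
Proof.
  intros Hs Hu H12 Hpos Hout.
  rewrite (jacobi_form_energy f x1 x2 H12 Hs Hout).
  set (F := fun s th => f (X s th)) in *.
  assert (Hper : forall s th, F s (th + 2 * PI) = F s th)
    by (intros; unfold F; rewrite Y0_periodic; reflexivity).
  pose proof (energy_lower_bound F Hs Hper u u1 x1 x2 Hu H12 Hpos) as H.
  assert (Z : forall s, s <= x1 \/ x2 <= s -> circ F F s = 0 /\ mean F s = 0).
  { intros s H0; split; apply RInt_eq_0; intros; unfold F; rewrite Hout by assumption;
      ring. }
  cbv beta zeta in H; destruct (Z x1) as [Z1 Z2]; [lra|]; destruct (Z x2) as [Z3 Z4]; [lra|].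
  rewrite Z1, Z2, Z3, Z4 in H; unfold Rdiv in H; lra.
Qed.

Lemma band_weakly_stable_finite (u u1 : R -> R) (al be : R) : jacobi_sol u u1 ->
  (forall s, al < s < be -> 0 < u s) -> al < be ->
  weakly_stable X (band X (fun s => al < s < be)).
Proof.
  intros Hu Hpos Hab f Hf.
  destruct (test_function_gap _ f al Hf ltac:(lra)) as [d1 [Hd1 H1]].
  destruct (test_function_gap _ f be Hf ltac:(lra)) as [d2 [Hd2 H2]].
  set (r := Rmin (Rmin (d1 / 2) (d2 / 2)) ((be - al) / 3)).
  assert (Hr : 0 < r) by (repeat apply Rmin_pos; lra).
  assert (Hr1 : r <= d1 / 2) by (eapply Rle_trans; [apply Rmin_l|apply Rmin_l]).
  assert (Hr2 : r <= d2 / 2) by (eapply Rle_trans; [apply Rmin_l|apply Rmin_r]).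
  assert (Hr3 : r <= (be - al) / 3) by apply Rmin_r.
  apply (jacobi_form_ge_0 f u u1 (al + r) (be - r) (proj1 Hf) Hu); [lra| |].
  - intros s Hs; apply Hpos; lra.
  - intros s th [Hs|Hs].
    + destruct (Rle_lt_dec s al); [apply (test_function_band _ f s th Hf); lra|].
      apply H1, Rabs_lt_between'; lra.
    + destruct (Rle_lt_dec be s); [apply (test_function_band _ f s th Hf); lra|].
      apply H2, Rabs_lt_between'; lra.
Qed.

Lemma band_weakly_stable_infinite (u u1 : R -> R) (al : R) : jacobi_sol u u1 ->
  (forall s, al < s -> 0 < u s) ->
  weakly_stable X (band X (fun s => al < s)).
Proof.
  intros Hu Hpos f Hf.
  destruct (test_function_gap _ f al Hf ltac:(lra)) as [d [Hd H1]].
  destruct (test_function_bounded _ f Hf) as [B [HB H2]].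
  set (x2 := Rmax B (al + d)).
  assert (Hx : B <= x2 /\ al + d <= x2) by (split; [apply Rmax_l|apply Rmax_r]).
  apply (jacobi_form_ge_0 f u u1 (al + d / 2) x2 (proj1 Hf) Hu); [lra| |].
  - intros s Hs; apply Hpos; lra.
  - intros s th [Hs|Hs]; [|apply H2; lra].
    destruct (Rle_lt_dec s al); [apply (test_function_band _ f s th Hf); lra|].
    apply H1, Rabs_lt_between'; lra.
Qed.

Lemma whole_stable (u u1 : R -> R) : jacobi_sol u u1 -> (forall s, 0 < u s) ->
  (forall s, continuous u1 s) -> stable X (whole X).
Proof.
  intros Hu Hpos Hc f Hf [p Hp].
  destruct (test_function_wave _ f Hf) as [Hs [_ [_ [_ [_ [_ Hpt]]]]]].
  destruct (Hpt p Hp) as [s [th ->]].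
  destruct (test_function_bounded _ f Hf) as [B [HB Hout]].
  rewrite (jacobi_form_energy f (- B) B ltac:(lra) Hs Hout).
  set (F := fun s th => f (X s th)) in *.
  destruct (angle_representative 0 th) as [t [Ht [Ec Es]]].
  apply (energy_pos F Hs u u1 (- B) B s t); try assumption; [lra|lra|].
  unfold F; rewrite (Y0_angle s t th Ec Es); assumption.
Qed.

(** The condition that the mean value of [f] on the waist circle vanishes has codimension 1:
    on each half, [f] is compared with a Jacobi field which is positive on that half. *)
Lemma jacobi_form_ge_0_waist (f : pt -> R) (u u1 : R -> R) :
  test_function X (whole X) f -> jacobi_sol u u1 -> (forall s, 0 <= s -> 0 < u s) ->
  mean (fun s th => f (X s th)) 0 = 0 -> 0 <= jacobi_form X f.
Proof.
  intros Hf Hu Hpos Hmean.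
  destruct (test_function_wave _ f Hf) as [Hs _].
  destruct (test_function_bounded _ f Hf) as [B [HB Hout]].
  rewrite (jacobi_form_energy f (- B) B ltac:(lra) Hs Hout).
  set (F := fun s th => f (X s th)) in *.
  assert (Hper : forall s th, F s (th + 2 * PI) = F s th)
    by (intros; unfold F; rewrite Y0_periodic; reflexivity).
  assert (Hu' : jacobi_sol (fun s => u (- s)) (fun s => - u1 (- s))).
  { destruct Hu as [U1 U2]; split; intro s.
    - specialize (U1 (- s)); evar_last; [apply (is_derive_compR u (fun s => - s)); der|ring].
    - apply is_derive_ext with (fun s => - (rad (- s) * u1 (- s))).
      { intro t; rewrite g_even; toR; ring. }
      assert (Eq : pot (- s) = pot s) by (unfold pot; rewrite g_even; reflexivity).
      specialize (U2 (- s)); rewrite Eq, g_even in U2.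
      evar_last; [apply is_derive_oppR;
        apply (is_derive_compR (fun s => rad s * u1 s) (fun s => - s)); [exact U2|der]|ring]. }
  pose proof (energy_lower_bound F Hs Hper u u1 0 B Hu ltac:(lra)
    ltac:(intros; apply Hpos; lra)) as H1.
  pose proof (energy_lower_bound F Hs Hper _ _ (- B) 0 Hu' ltac:(lra)
    ltac:(intros; apply Hpos; lra)) as H2.
  cbv beta zeta in H1, H2; rewrite Hmean in H1, H2.
  assert (Z : forall s, s <= - B \/ B <= s -> circ F F s = 0 /\ mean F s = 0).
  { intros s H0; split; apply RInt_eq_0; intros; unfold F; rewrite Hout by assumption;
      ring. }
  destruct (Z B) as [Z1 Z2]; [lra|]; destruct (Z (- B)) as [Z3 Z4]; [lra|].
  rewrite Z1, Z2 in H1; rewrite Z3, Z4 in H2.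
  rewrite <- (RInt_ChaslesR (energy F) (- B) 0 B)
    by (intro; apply energy_continuous; assumption).
  unfold Rdiv in *; lra.
Qed.

(** * Instability *)

Definition cutoff_energy (u chi : R -> R) (y1 y2 : R) : R :=
  RInt (fun s => g s * u s ^ 2 * Derive chi s ^ 2) y1 y2.

(** Near an end [p] where [u] vanishes, cutting off at scale [del] costs
    O(del^2) * O(1 / del^2) * O(del); the derivative of the cutoff function approximates
    [sg] times the Dirac mass at [p]. *)
Lemma finite_end_cutoff (u u1 Phi : R -> R) (p sg eps : R) : sg = 1 \/ sg = - 1 ->
  (forall s, is_derive u s (u1 s)) -> (forall s, continuous u1 s) -> u p = 0 ->
  (forall s, continuous Phi s) -> 0 < eps ->
  exists d0, 0 < d0 /\ forall del, 0 < del < d0 ->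
    forall y1 y2, y1 <= p - 2 * del -> p + 2 * del <= y2 ->
    cutoff_energy u (fun s => step (sg / del * (s - p))) y1 y2 <= eps /\
    Rabs (RInt (fun s => Derive (fun s => step (sg / del * (s - p))) s * Phi s) y1 y2
          - sg * Phi p) <= eps.
Proof.
  intros Hsg Hu Hu1 Hup HPhi Heps.
  destruct Derive_step_bounded as [M [HM HMb]].
  destruct (continuous_bounded u1 (p - 1) (p + 1) ltac:(lra) (fun x _ => Hu1 x)) as [Cu HCu].
  destruct (continuous_bounded g (p - 1) (p + 1) ltac:(lra) (fun x _ => g_cont x))
    as [Cg HCg].
  assert (Cu0 : 0 <= Cu)
    by (eapply Rle_trans; [apply Rabs_pos|apply (HCu p); lra]).
  assert (Cg0 : 0 <= Cg)
    by (eapply Rle_trans; [apply Rabs_pos|apply (HCg p); lra]).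
  assert (Hub : forall s, Rabs (s - p) <= 1 -> Rabs (u s) <= Cu * Rabs (s - p)).
  { intros s Hs; replace (u s) with (u s - u p) by lra.
    apply (bounded_variation u u1 Cu p s).
    intros t Ht; split; [apply Hu|apply HCu].
    assert (H : Rabs (t - p) <= 1) by lra; apply Rabs_le_between in H; lra. }
  assert (HcP : continuity_pt Phi p) by (apply continuity_pt_filterlim, HPhi).
  assert (HeM : 0 < eps / (4 * M)) by pos_tac.
  destruct (proj1 (continuity_pt_locally Phi p) HcP (mkposreal _ HeM)) as [dP HdP];
    simpl in HdP.
  pose proof (cond_pos dP) as HdP0.
  set (C := Cg * (Cu * 2) ^ 2 * M ^ 2 + 1).
  assert (HC : 0 < C).
  { unfold C; assert (0 <= Cg * (Cu * 2) ^ 2 * M ^ 2); [|lra].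
    apply Rmult_le_pos; [apply Rmult_le_pos; [assumption|]|]; apply pow2_ge_0. }
  assert (HeC : 0 < eps / (4 * C)) by pos_tac.
  exists (Rmin (Rmin (1 / 2) (dP / 2)) (eps / (4 * C))); split;
    [repeat apply Rmin_pos; lra|].
  intros del [Hdel Hd0] y1 y2 Hy1 Hy2.
  assert (D1 : del < 1 / 2)
    by (eapply Rlt_le_trans; [exact Hd0|eapply Rle_trans; [apply Rmin_l|apply Rmin_l]]).
  assert (D2 : del < dP / 2)
    by (eapply Rlt_le_trans; [exact Hd0|eapply Rle_trans; [apply Rmin_l|apply Rmin_r]]).
  assert (D3 : del < eps / (4 * C)) by (eapply Rlt_le_trans; [exact Hd0|apply Rmin_r]).
  set (chi := fun s => step (sg / del * (s - p))).
  assert (Hchi : smooth chi) by (unfold chi; smooth_tac).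
  assert (Hder : forall s, Derive chi s = sg / del * Derive step (sg / del * (s - p)))
    by (intro s; apply (Derive_affine_comp step), smooth_step).
  assert (Hb : forall s, Rabs (Derive chi s) <= M / del).
  { intro s; rewrite Hder, Rabs_mult; unfold Rdiv; rewrite Rabs_mult.
    assert (E : Rabs sg = 1)
      by (unfold Rabs; destruct Hsg as [-> | ->]; destruct (Rcase_abs _); lra).
    rewrite E, Rabs_pos_eq by (apply Rlt_le; pos_tac).
    rewrite Rmult_1_l, Rmult_comm; apply Rmult_le_compat_r; [apply Rlt_le; pos_tac|apply HMb]. }
  (* the transition takes place for s between p + sg * del and p + 2 * sg * del *)
  set (lo := Rmin (p + sg * del) (p + 2 * sg * del)).
  set (hi := Rmax (p + sg * del) (p + 2 * sg * del)).
  assert (Hlohi : hi - lo = del /\ p - 2 * del <= lo /\ hi <= p + 2 * del).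
  { unfold lo, hi; destruct Hsg as [-> | ->].
    - rewrite Rmin_left, Rmax_right by lra; lra.
    - rewrite Rmin_right, Rmax_left by lra; lra. }
  assert (Hz : forall s, s <= lo \/ hi <= s -> Derive chi s = 0).
  { intros s Hs.
    rewrite Hder, Derive_step_out; [ring|].
    assert (Hdd : 0 < / del) by pos_tac.
    assert (Hid : / del * del = 1) by (field; lra).
    unfold lo, hi in Hs; destruct Hsg as [-> | ->].
    - rewrite Rmin_left, Rmax_right in Hs by lra; destruct Hs; [left|right];
        unfold Rdiv; nra.
    - rewrite Rmin_right, Rmax_left in Hs by lra; destruct Hs; [right|left];
        unfold Rdiv; nra. }
  assert (Hcu : forall s, continuous u s) by (intro; eapply is_derive_continuous, Hu).
  split.
  - unfold cutoff_energy.
    eapply Rle_trans; [apply Rle_abs|].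
    apply Rle_trans with ((hi - lo) * (Cg * (Cu * (2 * del)) ^ 2 * (M / del) ^ 2)).
    + apply RInt_bound; try lra.
      * intro s; cont_tac.
      * intros s Hs; rewrite Hz by assumption; ring.
      * intros s Hs; rewrite !Rabs_mult, <- !RPow_abs.
        assert (Hs' : Rabs (s - p) <= 2 * del) by (apply Rabs_le_between; lra).
        apply Rmult_le_compat; [apply Rmult_le_pos; [apply Rabs_pos|apply pow2_ge_0]
          |apply pow2_ge_0| |apply pow_incr; split; [apply Rabs_pos|apply Hb]].
        apply Rmult_le_compat; [apply Rabs_pos|apply pow2_ge_0| |].
        -- apply HCg; apply Rabs_le_between in Hs'; lra.
        -- apply pow_incr; split; [apply Rabs_pos|].
           eapply Rle_trans; [apply Hub; lra|apply Rmult_le_compat_l; lra].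
    + rewrite (proj1 Hlohi).
      replace (del * (Cg * (Cu * (2 * del)) ^ 2 * (M / del) ^ 2))
        with (del * (Cg * (Cu * 2) ^ 2 * M ^ 2)) by (field; lra).
      apply Rle_trans with (del * (4 * C)).
      * apply Rmult_le_compat_l; [lra|unfold C in *; lra].
      * apply Rmult_lt_compat_r with (r := 4 * C) in D3; [|lra].
        replace (eps / (4 * C) * (4 * C)) with eps in D3 by (field; lra); lra.
  - assert (Etot : RInt (Derive chi) y1 y2 = sg).
    { rewrite (RInt_FTC chi) by (lra || (intros; apply smooth_is_derive, Hchi)
        || (intros; cont_tac)).
      assert (Hid : / del * del = 1) by (field; lra).
      assert (Hdd : 0 < / del) by pos_tac.
      unfold chi; destruct Hsg as [-> | ->].
      - rewrite step_1, step_0 by (unfold Rdiv; nra); toR; ring.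
      - rewrite step_0, step_1 by (unfold Rdiv; nra); toR; ring. }
    replace (RInt (fun s => Derive chi s * Phi s) y1 y2 - sg * Phi p)
      with (RInt (fun s => 1 * (Derive chi s * Phi s) + (- Phi p) * Derive chi s) y1 y2).
    2:{ rewrite RInt_lin, Etot by (apply ex_RInt_cont; intro; cont_tac); toR; ring. }
    apply Rle_trans with ((hi - lo) * (M / del * (eps / (4 * M)))).
    + apply RInt_bound; try lra.
      * intro s; cont_tac.
      * intros s Hs; rewrite Hz by assumption; ring.
      * intros s Hs.
        replace (1 * (Derive chi s * Phi s) + - Phi p * Derive chi s)
          with (Derive chi s * (Phi s - Phi p)) by ring.
        rewrite Rabs_mult; apply Rmult_le_compat; try apply Rabs_pos; [apply Hb|].
        apply Rlt_le, HdP; apply Rabs_lt_between'; lra.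
    + rewrite (proj1 Hlohi).
      replace (del * (M / del * (eps / (4 * M)))) with (eps / 4) by (field; lra); lra.
Qed.

(** The cutoff takes place on an interval of length 1, and costs as much as g u^2 there. *)
Lemma infinite_end_cutoff (u : R -> R) (M0 s0 eps : R) :
  (forall s, continuous u s) -> 0 < s0 ->
  (forall s, s0 <= s -> g s * u s ^ 2 <= M0 / s) -> 0 < eps ->
  exists r, s0 <= r /\ forall y1 y2, y1 <= r -> r + 1 <= y2 ->
    cutoff_energy u (fun s => step (- 1 * (s - (r + 2)))) y1 y2 <= eps.
Proof.
  intros Hu Hs0 Hdecay Heps.
  destruct Derive_step_bounded as [M [HM HMb]].
  assert (HM0 : 0 <= M0).
  { pose proof (Hdecay s0 ltac:(lra)) as H.
    assert (0 <= g s0 * u s0 ^ 2)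
      by (apply Rmult_le_pos; [apply Rlt_le, g_pos|apply pow2_ge_0]).
    assert (0 <= M0 / s0 * s0) by (apply Rmult_le_pos; lra).
    replace (M0 / s0 * s0) with M0 in H1 by (field; lra); assumption. }
  set (r := s0 + M0 * M ^ 2 / eps).
  assert (Hq : 0 <= M0 * M ^ 2 / eps).
  { apply Rmult_le_pos; [apply Rmult_le_pos; [assumption|apply pow2_ge_0]|].
    apply Rlt_le; pos_tac. }
  exists r; split; [unfold r; lra|intros y1 y2 Hy1 Hy2].
  assert (Hr : 0 < r) by (unfold r; lra).
  set (chi := fun s => step (- 1 * (s - (r + 2)))).
  assert (Hchi : smooth chi) by (unfold chi; smooth_tac).
  assert (Hder : forall s, Derive chi s = - 1 * Derive step (- 1 * (s - (r + 2))))
    by (intro s; apply (Derive_affine_comp step), smooth_step).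
  unfold cutoff_energy; eapply Rle_trans; [apply Rle_abs|].
  apply Rle_trans with ((r + 1 - r) * (M0 / r * M ^ 2)).
  - apply RInt_bound; try lra.
    + intro s; cont_tac.
    + intros s Hs.
      rewrite Hder, Derive_step_out by lra; ring.
    + intros s Hs; rewrite Rabs_mult, <- RPow_abs.
      apply Rmult_le_compat; [apply Rabs_pos|apply pow2_ge_0| |].
      * rewrite Rabs_pos_eq by (apply Rmult_le_pos;
          [apply Rlt_le, g_pos|apply pow2_ge_0]).
        eapply Rle_trans; [apply Hdecay; unfold r in *; lra|].
        apply Rmult_le_compat_l; [assumption|apply Rinv_le_contravar; lra].
      * apply pow_incr; split; [apply Rabs_pos|].
        rewrite Hder, Rabs_mult, (Rabs_left (- 1)) by lra.
        pose proof (HMb (- 1 * (s - (r + 2)))); lra.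
  - replace ((r + 1 - r) * (M0 / r * M ^ 2)) with (M0 * M ^ 2 / r) by (field; lra).
    apply Rmult_le_reg_r with r; [assumption|].
    replace (M0 * M ^ 2 / r * r) with (M0 * M ^ 2) by (field; lra).
    unfold r; rewrite Rmult_plus_distr_l.
    replace (eps * (M0 * M ^ 2 / eps)) with (M0 * M ^ 2) by (field; lra).
    nra.
Qed.

(** As [phi] does not depend on the angle, the mixed term only sees the mean value of
    [be]. *)
Lemma energy_sum_prod (phi b be : R -> R) (s : R) : smooth phi -> smooth b -> smooth be ->
  energy (fun s th => phi s * 1 + b s * be th) s =
  2 * PI * (g s * Derive phi s ^ 2 + g s * q s * phi s ^ 2)
  + (2 * RInt be 0 (2 * PI)) * (g s * Derive phi s * Derive b s + g s * q s * phi s * b s)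
  + (RInt (fun th => be th ^ 2) 0 (2 * PI) * (g s * Derive b s ^ 2 + g s * q s * b s ^ 2)
     + RInt (fun th => Derive be th ^ 2) 0 (2 * PI) * (b s ^ 2 / g s)).
Proof.
  intros Hp Hb Hbe; unfold energy.
  assert (Es : forall th, ds (fun s th => phi s * 1 + b s * be th) s th
                 = Derive phi s + Derive b s * be th).
  { intro th; apply is_derive_unique.
    pose proof (smooth_is_derive phi s Hp); pose proof (smooth_is_derive b s Hb).
    evar_last; [der|ring]. }
  assert (Et : forall th, dt (fun s th => phi s * 1 + b s * be th) s th
                 = b s * Derive be th).
  { intro th; apply is_derive_unique.
    pose proof (smooth_is_derive be th Hbe); evar_last; [der|ring]. }
  set (p1 := Derive phi s) in *; set (b1 := Derive b s) in *.
  transitivity (RInt (fun th => 1 * (1 * ((g s * p1 ^ 2 + g s * q s * phi s ^ 2) * 1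
      + 2 * (g s * p1 * b1 + g s * q s * phi s * b s) * be th)
      + (g s * b1 ^ 2 + g s * q s * b s ^ 2) * be th ^ 2)
      + (b s ^ 2 / g s) * Derive be th ^ 2) 0 (2 * PI)).
  - apply RInt_ext; intros th _; rewrite Es, Et; toR; unfold Rdiv; ring.
  - rewrite RInt_lin, RInt_lin, (RInt_lin (fun _ => 1) be), RInt_const
      by (apply ex_RInt_cont; intro; cont_tac).
    unfold scal; simpl; unfold mult; simpl; toR; unfold Rdiv; ring.
Qed.

Lemma jacobi_sol_continuous (u u1 : R -> R) (s : R) : smooth u ->
  jacobi_sol u u1 -> continuous u1 s.
Proof.
  intros Hu [H1 _]; apply continuous_ext with (Derive u).
  - intro t; apply is_derive_unique, H1.
  - apply smooth_continuous, smooth_Derive, Hu.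
Qed.

(** Integration by parts for the bilinear form on a rotation invariant function [chi * u],
    with [u] a Jacobi field: only the terms containing the derivative of [chi] survive. *)
Lemma cutoff_form (u u1 chi b : R -> R) (y1 y2 : R) : y1 <= y2 ->
  jacobi_sol u u1 -> (forall s, continuous u1 s) -> smooth chi -> smooth b ->
  chi y1 * b y1 = 0 -> chi y2 * b y2 = 0 ->
  RInt (fun s => g s * Derive (fun s => chi s * u s) s * Derive b s
                 + g s * q s * (chi s * u s) * b s) y1 y2
  = RInt (fun s => Derive chi s * (g s * (u s * Derive b s - u1 s * b s))) y1 y2.
Proof.
  intros Hy [U1 U2] Hu1 Hchi Hb Z1 Z2.
  assert (Hcu : forall s, continuous u s) by (intro; eapply is_derive_continuous, U1).
  assert (Hd : forall s, is_derive (fun s => (g s * u1 s) * (chi s * b s)) s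
    ((g s * q s * u s) * (chi s * b s)
     + (g s * u1 s) * (Derive chi s * b s + chi s * Derive b s))).
  { intro s; apply (Derive.is_derive_mult (fun s => g s * u1 s) (fun s => chi s * b s));
      [apply U2|].
    apply (Derive.is_derive_mult chi b); apply smooth_is_derive; assumption. }
  assert (E := RInt_FTC _ _ y1 y2 Hy (fun s _ => Hd s) ltac:(intros; cont_tac)).
  cbv beta in E; rewrite Z1, Z2, !Rmult_0_r, Rminus_0_r in E.
  transitivity (RInt (fun s => 1 * (Derive chi s * (g s * (u s * Derive b s - u1 s * b s)))
    + 1 * ((g s * q s * u s) * (chi s * b s)
     + (g s * u1 s) * (Derive chi s * b s + chi s * Derive b s))) y1 y2).
  - apply RInt_ext; intros s _.
    replace (Derive (fun s => chi s * u s) s) with (Derive chi s * u s + chi s * u1 s).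
    + toR; ring.
    + symmetry; apply is_derive_unique, (Derive.is_derive_mult chi u);
        [apply smooth_is_derive, Hchi|apply U1].
  - rewrite RInt_lin, E by (apply ex_RInt_cont; intro; cont_tac); toR; ring.
Qed.

Lemma cutoff_form_diag (u u1 chi : R -> R) (y1 y2 : R) : y1 <= y2 ->
  jacobi_sol u u1 -> smooth u -> smooth chi -> chi y1 = 0 -> chi y2 = 0 ->
  RInt (fun s => g s * Derive (fun s => chi s * u s) s ^ 2
                 + g s * q s * (chi s * u s) ^ 2) y1 y2
  = cutoff_energy u chi y1 y2.
Proof.
  intros Hy Hsol Hu Hchi Z1 Z2.
  assert (Hcu1 := fun s => jacobi_sol_continuous u u1 s Hu Hsol).
  assert (Hb : smooth (fun s => chi s * u s)) by (apply smooth_mult; assumption).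
  transitivity (RInt (fun s => g s * Derive (fun s => chi s * u s) s
      * Derive (fun s => chi s * u s) s
      + g s * q s * (chi s * u s) * (chi s * u s)) y1 y2).
  - apply RInt_ext; intros; toR; ring.
  - rewrite (cutoff_form u u1 chi (fun s => chi s * u s) y1 y2 Hy Hsol Hcu1 Hchi Hb)
      by (rewrite ?Z1, ?Z2; ring).
    apply RInt_ext; intros s _.
    replace (Derive (fun s => chi s * u s) s) with (Derive chi s * u s + chi s * u1 s).
    + toR; ring.
    + symmetry; apply is_derive_unique, (Derive.is_derive_mult chi u);
        [apply smooth_is_derive, Hchi|apply (proj1 Hsol)].
Qed.

(** From (x + y)^2 <= 2 x^2 + 2 y^2, as the cutoff functions are at most 1. *)
Lemma cutoff_energy_mult (u chi1 chi2 : R -> R) (y1 y2 : R) : y1 <= y2 ->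
  (forall s, continuous u s) -> smooth chi1 -> smooth chi2 ->
  (forall s, 0 <= chi1 s <= 1) -> (forall s, 0 <= chi2 s <= 1) ->
  cutoff_energy u (fun s => chi1 s * chi2 s) y1 y2
  <= 2 * cutoff_energy u chi1 y1 y2 + 2 * cutoff_energy u chi2 y1 y2.
Proof.
  intros Hy Hu S1 S2 B1 B2.
  assert (S : smooth (fun s => chi1 s * chi2 s)) by smooth_tac.
  unfold cutoff_energy; rewrite <- RInt_lin by (apply ex_RInt_cont; intro; cont_tac).
  apply RInt_le; [assumption|apply ex_RInt_cont; intro; cont_tac
                 |apply ex_RInt_cont; intro; cont_tac|].
  intros s _.
  assert (Ed : Derive (fun s => chi1 s * chi2 s) s
               = Derive chi1 s * chi2 s + chi1 s * Derive chi2 s)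
    by (apply is_derive_unique, (Derive.is_derive_mult chi1 chi2);
        apply smooth_is_derive; assumption).
  assert (Hgu : 0 <= g s * u s ^ 2)
    by (apply Rmult_le_pos; [apply Rlt_le, g_pos|apply pow2_ge_0]).
  specialize (B1 s); specialize (B2 s); rewrite Ed.
  set (m1 := Derive chi1 s); set (m2 := Derive chi2 s).
  assert ((m1 * chi2 s + chi1 s * m2) ^ 2 <= 2 * m1 ^ 2 + 2 * m2 ^ 2).
  { apply Rle_trans with (2 * (m1 * chi2 s) ^ 2 + 2 * (chi1 s * m2) ^ 2).
    - pose proof (pow2_ge_0 (m1 * chi2 s - chi1 s * m2)); nra.
    - rewrite !Rpow_mult_distr; pose proof (pow2_ge_0 m1); pose proof (pow2_ge_0 m2).
      assert (chi2 s ^ 2 <= 1) by nra; assert (chi1 s ^ 2 <= 1) by nra; nra. }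
  nra.
Qed.

(** The support lies in the union of two boxes: a whole annulus for [phi], and a rectangle
    around the point (p, th0) for the perturbation. *)
Lemma perturbed_test (U : pt -> Prop) (phi b : R -> R) (th0 rho lo hi p r : R) :
  smooth phi -> smooth b -> 0 < rho < PI ->
  (forall s, phi s <> 0 -> lo <= s <= hi) -> (forall s, b s <> 0 -> p - r <= s <= p + r) ->
  (forall s th, lo <= s <= hi -> U (X s th)) ->
  (forall s th, p - r <= s <= p + r -> th0 - rho <= th <= th0 + rho -> U (X s th)) ->
  let F := fun s th => phi s * 1 + b s * angle_bump th0 rho th in
  test_function X U (push F) /\ smooth2 F /\ (fun s th => push F (X s th)) = F.
Proof.
  intros Hphi Hb Hrho Sphi Sb HU1 HU2 F; pose proof PI_RGT_0.
  assert (HFext : forall s th th', cos th = cos th' -> sin th = sin th' -> F s th = F s th').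
  { intros s th th' Hc Hs; unfold F.
    rewrite (angle_bump_ext th0 rho th th' Hc Hs); reflexivity. }
  assert (HF : smooth2 F).
  { intros n s th; apply (ex_diff_n_sum_prod n phi (fun _ => 1) b); smooth_tac. }
  split; [|split; [exact HF|]].
  2:{ apply functional_extensionality; intro s; apply functional_extensionality; intro th.
      apply push_X; assumption. }
  apply (push_test U F (fun x : R * R =>
    (lo <= fst x /\ fst x <= hi) /\ (0 <= snd x /\ snd x <= 2 * PI)
    \/ (p - r <= fst x /\ fst x <= p + r) /\ (th0 - rho <= snd x /\ snd x <= th0 + rho))
    HFext HF).
  - apply closed_union; apply closed_box.
  - exists (Rabs lo + Rabs hi + Rabs p + Rabs th0 + 2 * PI + Rabs r + rho).
    assert (A : forall x, 0 <= Rabs x /\ x <= Rabs x /\ - x <= Rabs x).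
    { intro x; split; [apply Rabs_pos|split; [apply Rle_abs|]].
      rewrite <- Rabs_Ropp; apply Rle_abs. }
    pose proof (A lo); pose proof (A hi); pose proof (A p); pose proof (A th0).
    pose proof (A r).
    intros x [[Hx1 Hx2]|[Hx1 Hx2]]; split; apply Rabs_le_between; lra.
  - intros s th [[Hx1 _]|[Hx1 Hx2]]; simpl in *; [apply HU1|apply HU2]; assumption.
  - intros s th Hn; unfold F in Hn.
    destruct (Req_dec (phi s) 0) as [Ez|Ez].
    + assert (Hbn : b s <> 0 /\ angle_bump th0 rho th <> 0).
      { split; intro E; apply Hn; rewrite Ez, E; ring. }
      destruct Hbn as [Hbn1 Hbn2].
      destruct (angle_bump_support th0 rho th Hrho Hbn2) as [t [Ht Hcs]].
      exists t; split; [right|exact Hcs].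
      split; [exact (Sb s Hbn1)|]; apply Rabs_le_between in Ht; simpl; lra.
    + destruct (angle_representative 0 th) as [t [Ht Hcs]].
      exists t; split; [left|exact Hcs].
      split; [exact (Sphi s Ez)|simpl; lra].
Qed.

(** The linear term wins if [eps] is small and opposite in sign to [w], and [eta] is smaller
    still: [eps] is chosen in terms of [A2], then [eta] in terms of [eps]. *)
Lemma perturbation_scale (w kap A2 : R) : w <> 0 -> 0 < kap ->
  exists eps eta, 0 < eta /\ forall A0 A1, A0 <= 4 * eta -> Rabs (A1 - w) <= eta ->
    2 * PI * A0 + 2 * kap * eps * A1 + eps ^ 2 * A2 < 0.
Proof.
  intros Hw Hkap; pose proof PI_RGT_0 as Hpi.
  pose proof (pow2_gt_0 w Hw) as Hw2; pose proof (Rabs_pos_lt w Hw) as Hwa.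
  assert (HK : 0 < Rabs A2 + 1) by (pose proof (Rabs_pos A2); lra).
  set (tau := kap / (2 * (Rabs A2 + 1))).
  assert (Htau : 0 < tau) by (unfold tau; pos_tac).
  assert (HtauA : tau * A2 <= kap / 2).
  { apply Rle_trans with (tau * (Rabs A2 + 1)).
    - apply Rmult_le_compat_l; [lra|pose proof (Rle_abs A2); lra].
    - right; unfold tau; field; lra. }
  set (L := tau * kap * w ^ 2).
  assert (HL : 0 < L) by (unfold L; pos_tac).
  set (eta := Rmin (Rabs w / 2) (L / (32 * PI))).
  assert (Heta1 : eta <= Rabs w / 2) by apply Rmin_l.
  assert (Heta2 : 32 * PI * eta <= L).
  { apply Rle_trans with (32 * PI * (L / (32 * PI))).
    - apply Rmult_le_compat_l; [lra|apply Rmin_r].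
    - right; field; lra. }
  exists (- tau * w), eta; split; [apply Rmin_pos; pos_tac|intros A0 A1 H0 H1].
  assert (HwA : w ^ 2 / 2 <= w * A1).
  { assert (Hdev : Rabs (w * (A1 - w)) <= Rabs w * (Rabs w / 2))
      by (rewrite Rabs_mult; apply Rmult_le_compat_l; lra).
    replace (Rabs w * (Rabs w / 2)) with (Rabs w ^ 2 / 2) in Hdev by field.
    rewrite pow2_abs in Hdev; apply Rabs_le_between in Hdev; nra. }
  assert (HP0 : 2 * PI * A0 <= 2 * PI * (4 * eta)) by (apply Rmult_le_compat_l; lra).
  assert (HP1 : 2 * (tau * kap) * (w ^ 2 / 2) <= 2 * (tau * kap) * (w * A1))
    by (apply Rmult_le_compat_l; [apply Rlt_le; pos_tac|assumption]).
  assert (HP2 : tau * w ^ 2 * (tau * A2) <= tau * w ^ 2 * (kap / 2))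
    by (apply Rmult_le_compat_l; [apply Rlt_le; pos_tac|assumption]).
  replace (2 * kap * (- tau * w) * A1) with (- (2 * (tau * kap) * (w * A1))) by ring.
  replace ((- tau * w) ^ 2 * A2) with (tau * w ^ 2 * (tau * A2)) by ring.
  unfold L in *; lra.
Qed.

(** Let [u] be a Jacobi field vanishing at an end [p] of an interval [I], such that the cost
    of cutting off [u] at the other end is arbitrarily small.  The test functions
    [chi u + eps psi], with [psi] concentrated near a point of the circle [s = p], have
    energy [A0 + 2 eps A1 + eps^2 A2]; when [chi] tends to the indicator of [I], [A0] tends to
    0, and [A1] to a nonzero boundary term, because [u1 p <> 0].  The sign [sg] tells on which
    side of [p] the interval lies. *)
Lemma not_weakly_stable_beyond (u u1 : R -> R) (I : R -> Prop) (p sg rmax th0 : R)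
    (U : pt -> Prop) :
  sg = 1 \/ sg = - 1 -> 0 < rmax ->
  jacobi_sol u u1 -> smooth u -> u p = 0 -> u1 p <> 0 ->
  (forall eps, 0 < eps -> exists (chi : R -> R) (y Y : R), smooth chi /\ rmax <= y /\
     (forall s, Rabs (s - p) < rmax -> chi s = 1) /\
     (forall s, 0 <= chi s <= 1) /\
     (forall s, y <= sg * (s - p) -> chi s = 0) /\
     (forall s, 0 < sg * (s - p) <= y -> I s) /\
     (forall y1 y2, y1 <= - Y -> Y <= y2 -> cutoff_energy u chi y1 y2 <= eps)) ->
  open_in X U -> (forall x, band X I x -> U x) -> U (X p th0) ->
  ~ weakly_stable X U.
Proof.
  intros Hsg Hrmax Hsol Hu Hup Hu1p Hother [Usub Uopen] HIU Up Hws.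
  pose proof PI_RGT_0 as Hpi.
  assert (Hcu1 := fun s => jacobi_sol_continuous u u1 s Hu Hsol).
  destruct (Uopen (p, th0) Up) as [r1 Hr1]; pose proof (cond_pos r1) as Hr1p.
  set (r := Rmin (r1 / 2) rmax); set (rho := Rmin (r1 / 2) 1).
  assert (Hr : 0 < r /\ r <= r1 / 2 /\ r <= rmax)
    by (split; [apply Rmin_pos; lra|split; [apply Rmin_l|apply Rmin_r]]).
  assert (Hrho : 0 < rho /\ rho <= r1 / 2 /\ rho <= 1)
    by (split; [apply Rmin_pos; lra|split; [apply Rmin_l|apply Rmin_r]]).
  assert (Hrho' : 0 < rho < PI) by (pose proof PI2_1; lra).
  set (b := fun s => bump (/ r * (s - p))).
  assert (Hb : smooth b) by (unfold b; smooth_tac).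
  assert (Hb0 : 0 < b p) by (unfold b; rewrite Rminus_eq_0, Rmult_0_r; apply bump_0).
  assert (Hbout : forall s, r <= Rabs (s - p) -> b s = 0).
  { intros s Hs; apply bump_out; rewrite Rabs_mult, Rabs_inv, (Rabs_pos_eq r) by lra.
    apply Rmult_le_reg_l with r; [lra|]; rewrite <- Rmult_assoc, Rinv_r by lra; lra. }
  assert (Hbout' : forall s, r <= Rabs (s - p) -> Derive b s = 0).
  { intros s Hs; apply Derive_at_min; [assumption|].
    intro t; rewrite (Hbout s Hs); apply bump_ge_0. }
  set (be := angle_bump th0 rho).
  assert (Hbe : smooth be) by apply smooth_angle_bump.
  assert (Hcbe := fun th => smooth_continuous _ th Hbe).
  set (kap := RInt be 0 (2 * PI)).
  assert (Hkap : 0 < kap).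
  { destruct (angle_representative 0 th0) as [t [Ht [Ec Es]]].
    apply (RInt_pos be 0 (2 * PI) t); [lra|assumption|intros; apply flat_ge_0|lra|].
    unfold be; rewrite (angle_bump_ext th0 rho t th0 Ec Es); apply angle_bump_center, Hrho'. }
  assert (Hcu := fun s => smooth_continuous _ s Hu).
  set (Phi := fun s => g s * (u s * Derive b s - u1 s * b s)).
  assert (HPhi : forall s, continuous Phi s) by (intro; unfold Phi; cont_tac).
  assert (HPhiout : forall s, r <= Rabs (s - p) -> Phi s = 0)
    by (intros s Hs; unfold Phi; rewrite Hbout, Hbout' by assumption; ring).
  assert (Hw : sg * Phi p <> 0).
  { apply Rmult_integral_contrapositive_currified; [destruct Hsg as [-> | ->]; lra|].
    unfold Phi; rewrite Hup; pose proof (g_pos p).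
    replace (g p * (0 * Derive b p - u1 p * b p)) with (- (g p * u1 p * b p)) by ring.
    apply Ropp_neq_0_compat, Rmult_integral_contrapositive_currified; [|lra].
    apply Rmult_integral_contrapositive_currified; lra. }
  set (k2 := RInt (fun th => be th ^ 2) 0 (2 * PI)).
  set (k3 := RInt (fun th => Derive be th ^ 2) 0 (2 * PI)).
  set (h2 := fun s => k2 * (g s * Derive b s ^ 2 + g s * q s * b s ^ 2)
                      + k3 * (b s ^ 2 / g s)).
  assert (Hch2 : forall s, continuous h2 s) by (intro s; unfold h2; cont_tac).
  assert (Hfar : forall s, s <= p - r \/ p + r <= s -> r <= Rabs (s - p)).
  { intros s [Hs|Hs]; [rewrite Rabs_left1 by lra|rewrite Rabs_pos_eq by lra]; lra. }
  assert (Hh2out : forall s, s <= p - r \/ p + r <= s -> h2 s = 0).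
  { intros s Hs; unfold h2; rewrite Hbout, Hbout' by (apply Hfar, Hs).
    unfold Rdiv; ring. }
  destruct (perturbation_scale (sg * Phi p) kap (RInt h2 (p - r) (p + r)) Hw Hkap)
    as [eps [eta [Heta Hscale]]].
  destruct (Hother eta Heta) as [chi2 [y [Y [S2 [Hyr [C1 [C01 [C0 [CI CE]]]]]]]]].
  destruct (finite_end_cutoff u u1 Phi p sg eta Hsg (proj1 Hsol) Hcu1 Hup HPhi Heta)
    as [d0 [Hd0 Hcut]].
  set (del := Rmin (Rmin (d0 / 2) (rmax / 2)) 1).
  assert (Hdel : 0 < del /\ del < d0 /\ del < rmax /\ del <= 1).
  { assert (del <= d0 / 2) by (eapply Rle_trans; [apply Rmin_l|apply Rmin_l]).
    assert (del <= rmax / 2) by (eapply Rle_trans; [apply Rmin_l|apply Rmin_r]).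
    assert (del <= 1) by apply Rmin_r.
    split; [repeat apply Rmin_pos; lra|lra]. }
  set (chi1 := fun s => step (sg / del * (s - p))).
  assert (S1 : smooth chi1) by (unfold chi1; smooth_tac).
  set (chi := fun s => chi1 s * chi2 s).
  assert (Schi : smooth chi) by (apply smooth_mult; assumption).
  set (y2 := Rabs Y + y + Rabs p + r + 2); set (y1 := - y2).
  assert (Hy12 : y1 <= - Y /\ Y <= y2 /\ y1 <= p - r - y - 2 /\ p + r + y + 2 <= y2
                 /\ y1 <= y2).
  { pose proof (Rabs_pos Y); pose proof (Rle_abs Y); pose proof (Rabs_pos p).
    pose proof (Rle_abs p); pose proof (Rle_abs (- p)) as Hnp; rewrite Rabs_Ropp in Hnp.
    unfold y1, y2; lra. }
  clearbody y1 y2.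
  destruct (Hcut del ltac:(lra) y1 y2 ltac:(lra) ltac:(lra)) as [Hcut1 Hcut2].
  fold chi1 in Hcut1, Hcut2.
  specialize (CE y1 y2 ltac:(lra) ltac:(lra)).
  assert (Hchi1 : forall s, sg * (s - p) <= del -> chi1 s = 0).
  { intros s Hs; apply step_0.
    apply Rmult_le_reg_r with del; [lra|].
    replace (sg / del * (s - p) * del) with (sg * (s - p)) by (field; lra); lra. }
  assert (Hchi0 : forall s, chi s <> 0 -> del <= sg * (s - p) <= y).
  { intros s Hs; split.
    - destruct (Rle_lt_dec del (sg * (s - p))); [assumption|].
      exfalso; apply Hs; unfold chi; rewrite Hchi1 by lra; ring.
    - destruct (Rle_lt_dec (sg * (s - p)) y); [assumption|].
      exfalso; apply Hs; unfold chi; rewrite C0 by lra; ring. }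
  assert (Hchiout : forall s, s <= y1 \/ y2 <= s -> chi s = 0).
  { intros s Hs; destruct (Req_dec (chi s) 0) as [|Hn]; [assumption|exfalso].
    pose proof (Hchi0 s Hn) as Hb1.
    destruct Hsg as [Esg|Esg]; rewrite Esg in Hb1; lra. }
  set (phi := fun s => chi s * u s).
  assert (Hphi : smooth phi) by (apply smooth_mult; assumption).
  set (be' := fun s => eps * b s).
  assert (Hbe' : smooth be') by (unfold be'; smooth_tac).
  set (lo := Rmin (p + sg * del) (p + sg * y)).
  set (hi := Rmax (p + sg * del) (p + sg * y)).
  assert (Hlohi : forall s, lo <= s <= hi <-> del <= sg * (s - p) <= y).
  { intro s; unfold lo, hi; destruct Hsg as [Esg|Esg]; rewrite Esg.
    - rewrite Rmin_left, Rmax_right by lra; split; lra.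
    - rewrite Rmin_right, Rmax_left by lra; split; lra. }
  destruct (perturbed_test U phi be' th0 rho lo hi p r Hphi Hbe' Hrho')
    as [Htest [HF HFpush]].
  { intros s Hs; apply Hlohi, Hchi0; intro E; apply Hs; unfold phi; rewrite E; ring. }
  { intros s Hs; apply NNPP; intro Hn; apply Hs; unfold be'.
    rewrite Hbout by (apply Hfar; lra); ring. }
  { intros s th Hs; apply HIU, band_X, CI; apply Hlohi in Hs; lra. }
  { intros s th Hs Ht; apply (Hr1 (s, th)); split;
      [change (Rabs (s - p) < r1)|change (Rabs (th - th0) < r1)];
      apply Rabs_lt_between'; lra. }
  set (F := fun s th => phi s * 1 + be' s * angle_bump th0 rho th) in *.
  specialize (Hws _ Htest).
  rewrite (jacobi_form_energy (push F) y1 y2 ltac:(lra)), HFpush in Hws.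
  2:{ rewrite HFpush; exact HF. }
  2:{ intros s th Hs; change (push F (X s th)) with ((fun s th => push F (X s th)) s th).
      rewrite HFpush; unfold F, phi, be'.
      rewrite (Hchiout s Hs), (Hbout s ltac:(apply Hfar; lra)); ring. }
  assert (Hen : RInt (energy F) y1 y2 = 1 * (2 * PI * RInt (fun s =>
        g s * Derive phi s ^ 2 + g s * q s * phi s ^ 2) y1 y2
      + 2 * kap * eps * RInt (fun s => g s * Derive phi s * Derive b s
                                       + g s * q s * phi s * b s) y1 y2)
      + eps ^ 2 * RInt h2 y1 y2).
  { rewrite <- !RInt_lin by (apply ex_RInt_cont; intro s; pose proof (Hch2 s); cont_tac).
    apply RInt_ext; intros s _; unfold F; fold be; rewrite energy_sum_prod by assumption.
    replace (Derive be' s) with (eps * Derive b s) by (symmetry; apply Derive_scal).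
    fold kap k2 k3; unfold h2, be'; toR; unfold Rdiv; ring. }
  assert (HA0 : RInt (fun s => g s * Derive phi s ^ 2 + g s * q s * phi s ^ 2) y1 y2
                <= 4 * eta).
  { unfold phi.
    rewrite (cutoff_form_diag u u1 chi y1 y2 ltac:(lra) Hsol Hu Schi)
      by (apply Hchiout; lra).
    pose proof (cutoff_energy_mult u chi1 chi2 y1 y2 ltac:(lra) Hcu S1 S2
      (fun s => step_bounds _) C01); unfold chi; lra. }
  (* on the support of [b] the cutoff at the other end is equal to 1 *)
  assert (HA1 : RInt (fun s => g s * Derive phi s * Derive b s + g s * q s * phi s * b s) y1 y2
                = RInt (fun s => Derive chi1 s * Phi s) y1 y2).
  { unfold phi.
    rewrite (cutoff_form u u1 chi b y1 y2 ltac:(lra) Hsol Hcu1 Schi Hb)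
      by (rewrite Hchiout by lra; ring).
    apply RInt_ext; intros s _; fold (Phi s).
    destruct (Rle_lt_dec r (Rabs (s - p))) as [Hs|Hs];
      [rewrite (HPhiout s Hs); toR; ring|f_equal].
    apply Derive_ext_loc.
    assert (Hgap : 0 < r - Rabs (s - p)) by lra.
    exists (mkposreal _ Hgap); intros t Ht; change (Rabs (t - s) < r - Rabs (s - p)) in Ht.
    unfold chi; rewrite (C1 t); [ring|].
    replace (t - p) with ((t - s) + (s - p)) by ring.
    pose proof (Rabs_triang (t - s) (s - p)); lra. }
  rewrite Hen, HA1, (RInt_support h2 (p - r) (p + r) y1 y2) in Hws by (assumption || lra).
  pose proof (Hscale _ _ HA0 Hcut2); lra.
Qed.

(** * Stability and index of the catenoids *)

Lemma jacobi_sol_scal (k : R) (u u1 : R -> R) : jacobi_sol u u1 ->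
  jacobi_sol (fun s => k * u s) (fun s => k * u1 s).
Proof.
  intros [H1 H2]; split; intro s; [apply is_derive_scal, H1|].
  apply is_derive_ext with (fun s => k * (rad s * u1 s)); [intro; toR; ring|].
  replace (rad s * pot s * (k * u s)) with (k * (rad s * pot s * u s)) by ring.
  apply (is_derive_scal (fun s => rad s * u1 s)), H2.
Qed.

Lemma neg_efield_sol : jacobi_sol (fun s => - 1 * efield s) (fun s => - 1 * efield1 s).
Proof. apply jacobi_sol_scal, efield_sol. Qed.

Lemma stable_of_E0 : E0 a <= 0 -> catenoid_stable a.
Proof.
  intro HE; apply (whole_stable _ _ neg_efield_sol).
  - intro s; pose proof (efield_neg s HE); lra.
  - intro s; apply (jacobi_sol_continuous (fun s => - 1 * efield s)); [|apply neg_efield_sol].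
    smooth_tac.
Qed.

Lemma whole_weakly_stable_of_E0 : E0 a <= 0 -> weakly_stable X (whole X).
Proof.
  intros HE f Hf; destruct (test_function_bounded _ f Hf) as [B [HB Hout]].
  apply (jacobi_form_ge_0 f _ _ (- B) B (proj1 Hf) neg_efield_sol); [lra| |exact Hout].
  intros s _; pose proof (efield_neg s HE); lra.
Qed.

Lemma whole_open_domain : open_domain X (whole X).
Proof. apply (band_open_domain (fun _ => True) 0); auto using open_true. Qed.

Lemma not_weakly_stable_beyond_z (z th0 sg : R) (U : pt -> Prop) : 0 < z ->
  efield z = 0 -> sg = 1 \/ sg = - 1 ->
  open_in X U -> (forall x, band X (fun s => - z < s < z) x -> U x) ->
  U (X (- sg * z) th0) -> ~ weakly_stable X U.
Proof.
  intros Hz Ez Hsg HU Hsub HUp.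
  assert (Ep : efield (- sg * z) = 0).
  { destruct Hsg as [-> | ->]; [replace (- (1) * z) with (- z) by ring;
      rewrite efield_even|replace (- - 1 * z) with z by ring]; exact Ez. }
  apply (not_weakly_stable_beyond efield efield1 (fun s => - z < s < z)
    (- sg * z) sg z th0 U Hsg Hz efield_sol smooth_efield Ep);
    [| |exact HU|exact Hsub|exact HUp].
  - intro E1; pose proof (wronskian (- sg * z)) as W; rewrite Ep, E1 in W.
    pose proof c_gt_1; lra.
  - intros eps Heps.
    assert (Eq : efield (sg * z) = 0).
    { destruct Hsg as [-> | ->]; [replace (1 * z) with z by ring; exact Ez|].
      replace (- 1 * z) with (- z) by ring; rewrite efield_even; exact Ez. }
    assert (Hsg' : - sg = 1 \/ - sg = - 1) by (destruct Hsg as [-> | ->]; lra).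
    destruct (finite_end_cutoff efield efield1 (fun _ => 0) (sg * z) (- sg) eps
      Hsg' (is_derive_efield)
      (fun s => jacobi_sol_continuous _ _ s smooth_efield efield_sol)
      Eq (fun s => continuous_const 0 s) Heps) as [d0 [Hd0 Hcut]].
    set (del := Rmin (d0 / 2) (z / 2)).
    assert (Hdel : 0 < del) by (apply Rmin_pos; lra).
    assert (Hdel1 : del <= d0 / 2) by apply Rmin_l.
    assert (Hdel2 : del <= z / 2) by apply Rmin_r.
    (* [efield] also vanishes at the other end [sg * z] of the band *)
    exists (fun s => step (- sg / del * (s - sg * z))), (2 * z - del), (z + 2 * del).
    assert (Harg : forall s, - sg / del * (s - sg * z) = (z - sg * s) / del).
    { intro s; destruct Hsg as [-> | ->]; field; lra. }
    assert (Hdd : 0 < / del) by pos_tac.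
    assert (Hid : / del * del = 1) by (field; lra).
    split; [smooth_tac|repeat split; [lra|..]].
    + intros s Hs; apply step_1; rewrite Harg; apply Rabs_lt_between' in Hs.
      assert (2 * del <= z - sg * s) by (destruct Hsg as [Esg|Esg]; rewrite Esg in *; lra).
      unfold Rdiv; nra.
    + apply step_bounds.
    + apply step_bounds.
    + intros s Hs; apply step_0; rewrite Harg.
      assert (z - sg * s <= del) by (destruct Hsg as [Esg|Esg]; rewrite Esg in *; lra).
      unfold Rdiv; nra.
    + destruct Hsg as [Esg|Esg]; rewrite Esg in *; lra.
    + destruct Hsg as [Esg|Esg]; rewrite Esg in *; lra.
    + intros y1 y2 Hy1 Hy2; apply Hcut; [lra| |];
        destruct Hsg as [Esg|Esg]; rewrite Esg in *; lra.
Qed.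

Lemma not_weakly_stable_beyond_l (l th0 : R) (U : pt -> Prop) : 0 < E0 a -> 0 < l ->
  ufield (- l) = 0 -> open_in X U -> (forall x, band X (fun s => - l < s) x -> U x) ->
  U (X (- l) th0) -> ~ weakly_stable X U.
Proof.
  intros HE Hl El HU Hsub HUp; pose proof c_gt_1 as Hc.
  apply (not_weakly_stable_beyond ufield ufield1 (fun s => - l < s)
    (- l) 1 1 th0 U (or_introl eq_refl) Rlt_0_1 (ufield_sol)
    smooth_ufield El); [| |exact HU|exact Hsub|exact HUp].
  - intro E1; pose proof (wronskian (- l)) as W.
    unfold ufield in El; unfold ufield1 in E1.
    replace (efield (- l)) with (sqrt 2 * E0 a * vfield (- l)) in W by lra.
    replace (efield1 (- l)) with (sqrt 2 * E0 a * vfield1 (- l)) in W by lra.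
    assert (cosh (2 * a) = 0); [rewrite <- W; ring|lra].
  - intros eps Heps; destruct ufield_decay as [M HM].
    destruct (infinite_end_cutoff ufield M (cosh (2 * a)) eps
      (fun s => smooth_continuous _ s smooth_ufield) ltac:(lra) HM Heps)
      as [r [Hr Hcut]].
    exists (fun s => step (- 1 * (s - (r + 2)))), (r + 1 + l), (r + 1).
    split; [smooth_tac|repeat split; [lra|..]].
    + intros s Hs; apply step_1; apply Rabs_lt_between' in Hs; lra.
    + apply step_bounds.
    + apply step_bounds.
    + intros s Hs; apply step_0; lra.
    + intros s Hs; lra.
    + intros y1 y2 Hy1 Hy2; apply Hcut; lra.
Qed.

Lemma max_weakly_stable_z (z : R) : 0 < z -> efield z = 0 ->
  (forall s, - z < s < z -> efield s < 0) ->
  max_weakly_stable X (band X (fun s => - z < s < z)).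
Proof.
  intros Hz Ez Hneg.
  assert (Ho : open (fun s : R => - z < s < z))
    by (apply (open_and (fun s => - z < s) (fun s => s < z)); [apply open_gt|apply open_lt]).
  split; [|split].
  - apply (band_open_domain _ 0 Ho); [lra|intros; lra].
  - apply (band_weakly_stable_finite _ _ _ _ neg_efield_sol); [|lra].
    intros s Hs; pose proof (Hneg s Hs); lra.
  - intros U HU Hlarger.
    destruct (larger_domain_boundary (fun s => - z < s < z)
      (fun s => s < - z \/ z < s) (fun s => s = - z \/ s = z) U 0 Ho) as [s [th0 [Hs HUs]]].
    + apply (open_or (fun s => s < - z) (fun s => z < s)); [apply open_lt|apply open_gt].
    + lra.
    + intros s [H1 H2]; lra.
    + intros s; lra.
    + exact HU.
    + exact Hlarger.
    + destruct Hs as [-> | ->].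
      * apply (not_weakly_stable_beyond_z z th0 1 U Hz Ez); [auto|apply HU|apply Hlarger|].
        replace (- (1) * z) with (- z) by ring; exact HUs.
      * apply (not_weakly_stable_beyond_z z th0 (- 1) U Hz Ez); [auto|apply HU|apply Hlarger|].
        replace (- - 1 * z) with z by ring; exact HUs.
Qed.

Lemma band_l_domain (l : R) : (forall s, - l < s -> 0 < ufield s) ->
  open_domain X (band X (fun s => - l < s)) /\ weakly_stable X (band X (fun s => - l < s)).
Proof.
  intro Hpos; split.
  - apply (band_open_domain _ (- l + 1)); [apply open_gt|lra|intros; lra].
  - apply (band_weakly_stable_infinite _ _ _ ufield_sol); assumption.
Qed.

Lemma max_weakly_stable_rot_l (l : R) : 0 < E0 a -> 0 < l -> ufield (- l) = 0 ->
  (forall s, - l < s -> 0 < ufield s) ->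
  max_weakly_stable_rot X (band X (fun s => - l < s)).
Proof.
  intros HE Hl El Hpos; destruct (band_l_domain l Hpos) as [Hdom Hws].
  split; [exact Hdom|split; [apply band_rotation_invariant|split; [exact Hws|]]].
  intros U HU _ Hlarger.
  destruct (larger_domain_boundary (fun s => - l < s)
    (fun s => s < - l) (fun s => s = - l) U (- l + 1)) as [s [th0 [-> HUs]]].
  - apply open_gt.
  - apply open_lt.
  - lra.
  - intros s [H1 H2]; lra.
  - intros s; lra.
  - exact HU.
  - exact Hlarger.
  - apply (not_weakly_stable_beyond_l l th0 U HE Hl El); [apply HU|apply Hlarger|exact HUs].
Qed.

Lemma jacobi_form_scal (f : pt -> R) (k : R) : test_function X (whole X) f ->
  test_function X (whole X) (fun p => k * f p) /\
  jacobi_form X (fun p => k * f p) = k ^ 2 * jacobi_form X f.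
Proof.
  intro Hf; destruct (test_function_bounded _ f Hf) as [B [HB Hout]].
  assert (Hk : smooth2 (fun s th => k * f (X s th)))
    by (intros n s th; apply (ex_diff_n_scal n k (fun s th => f (X s th))), Hf).
  split.
  - split; [exact Hk|].
    destruct Hf as [_ [K [H1 [H2 [H3 H4]]]]]; exists K; repeat split; try assumption.
    intros p Hp; rewrite H4 by assumption; ring.
  - rewrite (jacobi_form_energy f (- B) B ltac:(lra) (proj1 Hf) Hout).
    rewrite (jacobi_form_energy (fun p => k * f p) (- B) B ltac:(lra) Hk)
      by (intros s th Hs; rewrite Hout by assumption; ring).
    set (F := fun s th => f (X s th)).
    assert (He : forall s, energy (fun s th => k * f (X s th)) s = k ^ 2 * energy F s).
    { intro s; unfold energy.
      assert (HF : smooth2 F) by exact (proj1 Hf).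
      pose proof (c2_ex_RInt _ s 0 (2 * PI) (c2_energy_density F HF)) as Hex.
      rewrite <- (RInt_scalR _ (k ^ 2) 0 (2 * PI) Hex).
      apply RInt_ext; intros th _.
      replace (ds (fun s th => k * f (X s th)) s th) with (k * ds F s th)
        by (symmetry; apply (Derive_scal (fun u => F u th))).
      replace (dt (fun s th => k * f (X s th)) s th) with (k * dt F s th)
        by (symmetry; apply (Derive_scal (fun v => F s v))).
      unfold F; toR; unfold Rdiv; ring. }
    rewrite (RInt_ext _ (fun s => k ^ 2 * energy F s)) by (intros; apply He).
    apply RInt_scalR.
    apply ex_RInt_cont; intro; apply energy_continuous; exact (proj1 Hf).
Qed.

(** A plane of test functions contains a nonzero one with mean value zero on the waist
    circle. *)
Lemma index_le_1 (m : nat) (V : (pt -> R) -> Prop) : 0 < E0 a ->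
  neg_def_subspace X (whole X) m V -> (m <= 1)%nat.
Proof.
  intros HE [[e [Hind Hspan]] [Htest Hneg]].
  destruct (le_lt_dec m 1) as [|Hm]; [assumption|exfalso].
  destruct m as [|[|m]]; [lia|lia|clear Hm].
  destruct (efield_zero HE) as [z [Hz [Ez _]]].
  destruct (ufield_zero HE z Hz Ez) as [l [Hl [_ Hpos]]].
  set (co := fun al be : R =>
    fun i => match i with 0%nat => al | 1%nat => be | _ => 0 end).
  assert (HV : forall al be, V (fun p => al * e 0%nat p + be * e 1%nat p)).
  { intros al be; apply Hspan; exists (co al be); intro p; symmetry; apply lin_comb_two. }
  assert (T : forall al be,
    test_function X (whole X) (fun p => al * e 0%nat p + be * e 1%nat p))
    by (intros; apply Htest, HV).
  set (M := fun i => mean (fun s th => e i (X s th)) 0).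
  assert (Hc : forall i, (i <= 1)%nat ->
            forall th, continuous (fun th => e i (X 0 th)) th).
  { intros i Hi th; apply (c2_th (fun s th => e i (X s th))), smooth2_c2.
    assert (E : exists al be, e i = fun p => al * e 0%nat p + be * e 1%nat p).
    { destruct i as [|[|i]]; [exists 1, 0|exists 0, 1|lia];
        apply functional_extensionality; intro p; ring. }
    destruct E as [al [be ->]]; exact (proj1 (T al be)). }
  assert (Hmean : forall al be, mean (fun s th => al * e 0%nat (X s th) + be * e 1%nat (X s th)) 0
            = al * M 0%nat + be * M 1%nat).
  { intros al be; apply (RInt_lin (fun th => e 0%nat (X 0 th)) (fun th => e 1%nat (X 0 th)));
      apply ex_RInt_cont; intro; apply Hc; lia. }
  assert (Hex : exists al be, al * M 0%nat + be * M 1%nat = 0 /\ (al <> 0 \/ be <> 0)).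
  { destruct (Req_dec (M 0%nat) 0) as [E0'|N0].
    - exists 1, 0; split; [rewrite E0'; ring|left; lra].
    - exists (M 1%nat), (- M 0%nat); split; [ring|right; lra]. }
  destruct Hex as [al [be [Hab Hne]]].
  set (f := fun p => al * e 0%nat p + be * e 1%nat p).
  assert (Hf0 : exists p, f p <> 0).
  { apply NNPP; intro Hno.
    assert (H : forall i, (i < S (S m))%nat -> co al be i = 0).
    { apply Hind; intro p; unfold co; rewrite lin_comb_two.
      apply NNPP; intro Hp; apply Hno; exists p; exact Hp. }
    pose proof (H 0%nat ltac:(lia)) as H0; pose proof (H 1%nat ltac:(lia)) as H1.
    simpl in H0, H1; lra. }
  pose proof (Hneg f (HV al be) Hf0) as Hlt.
  assert (0 <= jacobi_form X f); [|lra].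
  apply (jacobi_form_ge_0_waist f ufield ufield1 (T al be)
    ufield_sol).
  - intros s Hs; apply Hpos; lra.
  - unfold f; rewrite Hmean; exact Hab.
Qed.

(** The whole catenoid is strictly larger than a maximal weakly stable domain. *)
Lemma index_1_of_E0 : 0 < E0 a -> catenoid_has_index a 1.
Proof.
  intro HE; split; [|intros m V; apply index_le_1, HE].
  destruct (efield_zero HE) as [z [Hz [Ez Hneg]]].
  destruct (max_weakly_stable_z z Hz Ez Hneg) as [_ [_ Hmax]].
  assert (Hnot : ~ weakly_stable X (whole X)).
  { apply Hmax; [apply whole_open_domain|split].
    - intros p Hp; destruct (band_point _ p Hp) as [s [th [_ ->]]]; apply whole_X.
    - exists (X z 0); split; [apply whole_X|].
      rewrite band_X; lra. }
  assert (Hex : exists f, test_function X (whole X) f /\ jacobi_form X f < 0).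
  { apply NNPP; intro Hno; apply Hnot; intros f Hf.
    destruct (Rle_lt_dec 0 (jacobi_form X f)) as [|Hlt]; [assumption|].
    exfalso; apply Hno; exists f; auto. }
  destruct Hex as [f [Hf Hlt]].
  assert (Hf0 : exists p, f p <> 0).
  { apply NNPP; intro Hno.
    assert (E : f = fun p => 0 * f p).
    { apply functional_extensionality; intro p; rewrite Rmult_0_l.
      apply NNPP; intro Hp; apply Hno; exists p; exact Hp. }
    rewrite E, (proj2 (jacobi_form_scal f 0 Hf)) in Hlt; simpl in Hlt; lra. }
  exists (fun h => exists k, h = fun p => k * f p); split; [|split].
  - exists (fun _ => f); split.
    + intros co Hco i Hi; assert (i = 0%nat) as -> by lia.
      destruct Hf0 as [p Hp]; specialize (Hco p); simpl in Hco.
      apply Rmult_eq_reg_r with (f p); lra.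
    + intro h; split.
      * intros [k ->]; exists (fun _ => k); intro p; simpl; ring.
      * intros [co Hco]; exists (co 0%nat); apply functional_extensionality; intro p.
        rewrite Hco; simpl; ring.
  - intros h [k ->]; apply jacobi_form_scal, Hf.
  - intros h [k ->] [p Hp]; rewrite (proj2 (jacobi_form_scal f k Hf)).
    assert (0 < k ^ 2); [apply pow2_gt_0; intro E; apply Hp; rewrite E; ring|nra].
Qed.

Lemma E0_of_index_1 : catenoid_has_index a 1 -> 0 < E0 a.
Proof.
  intros [[V [[e [Hind Hspan]] [Htest Hneg]]] _].
  destruct (Rle_lt_dec (E0 a) 0) as [HE|]; [exfalso|assumption].
  assert (HV : V (e 0%nat)) by (apply Hspan; exists (fun _ => 1); intro p; simpl; ring).
  assert (Hne : exists p, e 0%nat p <> 0).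
  { apply NNPP; intro Hno.
    assert (1 = 0); [|lra].
    apply (Hind (fun _ => 1)) with (i := 0%nat); [|lia].
    intro p; simpl.
    assert (Hp : e 0%nat p = 0) by (apply NNPP; intro Hp; apply Hno; exists p; exact Hp).
    rewrite Hp; ring. }
  pose proof (stable_of_E0 HE _ (Htest _ HV) Hne) as H1.
  pose proof (Hneg _ HV Hne) as H2; lra.
Qed.

(** A larger rotation invariant domain is weakly stable: the whole catenoid if [E0 a <= 0],
    the band beyond - l otherwise. *)
Lemma not_lindelof : ~ lindelof_property a.
Proof.
  intros [_ [_ [_ Hmax]]].
  assert (Hband : forall I : R -> Prop, (forall s, 0 < s -> I s) -> I 0 ->
    open_domain X (band X I) -> ~ weakly_stable X (band X I)).
  { intros I Hsub H0 Hdom; apply Hmax; [assumption|apply band_rotation_invariant|split].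
    - intros p Hp; destruct (band_point _ p Hp) as [s [th [Hs ->]]].
      apply band_X, Hsub, Hs.
    - exists (X 0 0); split; [apply band_X; assumption|].
      rewrite band_X; lra. }
  destruct (Rle_lt_dec (E0 a) 0) as [HE|HE].
  - apply (Hband (fun _ => True)); auto.
    + apply whole_open_domain.
    + apply whole_weakly_stable_of_E0, HE.
  - destruct (efield_zero HE) as [z [Hz [Ez _]]].
    destruct (ufield_zero HE z Hz Ez) as [l [Hl [_ Hpos]]].
    destruct (band_l_domain l Hpos) as [Hdom Hws].
    apply (Hband (fun s => - l < s)); [intros; lra|lra|exact Hdom|exact Hws].
Qed.

End Catenoid.

Lemma E0_large (a : R) : 3 < a -> E0 a <= 0.
Proof.
  intro Ha; apply E0_neg; [lra|].
  pose proof (exp_ineq1 (2 * a) ltac:(lra)); pose proof (exp_pos (- (2 * a))).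
  unfold cosh; lra.
Qed.

Lemma E0_small : exists a2, 0 < a2 /\ a2 < 3 /\ forall a, 0 < a < a2 -> 0 < E0 a.
Proof.
  set (k := / (8 * (1 + cosh 4) ^ 3)).
  assert (Hk : 0 < k) by (unfold k; pose proof (cosh_ge_1 4); pos_tac).
  set (n := Rmin (/ 6) (k / 3)).
  assert (Hn : 0 < n) by (apply Rmin_pos; lra).
  pose proof (smooth_continuous cosh 0 smooth_cosh) as Hc.
  apply continuity_pt_filterlim in Hc.
  destruct (proj1 (continuity_pt_locally cosh 0) Hc (mkposreal n Hn)) as [d Hd]; simpl in Hd.
  pose proof (cond_pos d).
  exists (Rmin (d / 2) 1); split; [apply Rmin_pos; lra|].
  pose proof (Rmin_l (d / 2) 1); pose proof (Rmin_r (d / 2) 1).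
  split; [lra|intros a Ha].
  assert (H3 : Rabs (cosh (2 * a) - cosh 0) < n).
  { apply Hd, Rabs_lt_between'; lra. }
  rewrite cosh_0 in H3; apply Rabs_lt_between in H3.
  pose proof (Rmin_l (/ 6) (k / 3)); pose proof (Rmin_r (/ 6) (k / 3)).
  unfold n in *; apply (E0_pos_small a ltac:(lra) k); [lra|reflexivity|lra].
Qed.

Theorem theorem7p7 :
  (forall a : R, 0 < a ->
     (E0 a <= 0 -> catenoid_stable a) /\
     (0 < E0 a -> catenoid_has_index a 1)) /\
  (forall a : R, 0 < a -> catenoid_has_index a 1 ->
     exists z : R, 0 < z /\
       max_weakly_stable (Y0 a) (band (Y0 a) (fun s : R => - z < s < z)) /\
       exists l : R, 0 < l < z /\
         max_weakly_stable_rot (Y0 a) (band (Y0 a) (fun s : R => - l < s))) /\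
  (forall a : R, 0 < a -> ~ lindelof_property a) /\
  (exists a1 a2 : R, 0 < a2 /\ a2 < a1 /\
     (forall a : R, a1 < a -> catenoid_stable a) /\
     (forall a : R, 0 < a < a2 -> catenoid_has_index a 1)).
Proof.
  split; [|split; [|split]].
  - intros a Ha; split; [apply stable_of_E0|apply index_1_of_E0]; assumption.
  - intros a Ha Hidx; pose proof (E0_of_index_1 a Ha Hidx) as HE.
    destruct (efield_zero a Ha HE) as [z [Hz [Ez Hneg]]].
    destruct (ufield_zero a Ha HE z Hz Ez) as [l [Hl [El Hpos]]].
    exists z; split; [assumption|split; [apply max_weakly_stable_z; assumption|]].
    exists l; split; [assumption|apply max_weakly_stable_rot_l; lra || assumption].
  - exact not_lindelof.
  - destruct E0_small as [a2 [H1 [H2 H3]]].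
    exists 3, a2; split; [assumption|split; [assumption|split]].
    + intros a Ha; apply stable_of_E0; [lra|apply E0_large, Ha].
    + intros a Ha; apply index_1_of_E0; [apply Ha|apply H3, Ha].
Qed.
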